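(* Reachability can be maintained in $\mathrm{DynFO}(+,\times)$ under changes that affect $\mathcal{O}\!\left(\frac{\log n}{\log\log n}\right)$ nodes of a graph, where $n$ is the number of nodes of the graph.
   Context: Reachability is the query that, given a directed graph $G$, returns all pairs $(s,t)$ of nodes such that there is a path from $s$ to $t$ in $G$. Dynamic complexity framework: a dynamic program works over a fixed finite domain of size $n$ (the nodes) and stores auxiliary relations over this domain. Initially the input graph is empty and all auxiliary relations are empty, except that in $\mathrm{DynFO}(+,\times)$ a linear order and the corresponding addition and multiplication relations on the whole domain are present at all times. A change $\Delta$ consists of a set of edges to insert and a set of edges to delete (applied simultaneously); the elements affected by a change are the nodes occurring in its tuples. After each change, every auxiliary relation is replaced by the set of tuples satisfying a fixed first-order formula evaluated over the changed input graph together with the current auxiliary relations (and the built-in arithmetic). A query is maintained under changes affecting $k$ elements if there is a designated auxiliary relation that, after every nonempty sequence of such changes applied to the initially empty graph, equals the query result on the current graph. *)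

(* Defs.v *)
From mathcomp Require Import all_boot all_order.

Set Implicit Arguments.
Unset Strict Implicit.
Unset Printing Implicit Defensive.

(* First-order formulas over the vocabulary {E, =, <=, +, *} extended by the
   auxiliary symbols [sym] of arities [ar].  [formula ar m] has its free
   variables among 0, ..., m-1; the quantifiers bind variable 0 of their body
   and shift the other variables by one. *)
Inductive formula (sym : finType) (ar : sym -> nat) : nat -> Type :=
| FEq m (x y : 'I_m) : formula ar m
| FLe m (x y : 'I_m) : formula ar m
| FAdd m (x y z : 'I_m) : formula ar m
| FMul m (x y z : 'I_m) : formula ar m
| FEdge m (x y : 'I_m) : formula ar m
| FAux m (s : sym) (xs : (ar s).-tuple 'I_m) : formula ar m
| FNot m (f : formula ar m) : formula ar m
| FAnd m (f g : formula ar m) : formula ar m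
| FOr m (f g : formula ar m) : formula ar m
| FForall m (f : formula ar m.+1) : formula ar m
| FExists m (f : formula ar m.+1) : formula ar m.

Definition aux_state (sym : finType) (ar : sym -> nat) (V : finType) :=
  forall s : sym, {set (ar s).-tuple V}.

(* Position of x in the linear order of V, counted from 0. *)
Definition rank (d : Order.disp_t) (V : finOrderType d) (x : V) : nat :=
  #|[set y : V | (y < x)%O]|.

Fixpoint eval (sym : finType) (ar : sym -> nat) (d : Order.disp_t)
    (V : finOrderType d) (E : {set V * V}) (A : aux_state ar V)
    (m : nat) (f : formula ar m) : m.-tuple V -> bool :=
  match f in formula _ m return m.-tuple V -> bool with
  | FEq _ x y => fun e => tnth e x == tnth e y
  | FLe _ x y => fun e => (tnth e x <= tnth e y)%O
  | FAdd _ x y z => fun e => rank (tnth e x) + rank (tnth e y) == rank (tnth e z)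
  | FMul _ x y z => fun e => rank (tnth e x) * rank (tnth e y) == rank (tnth e z)
  | FEdge _ x y => fun e => (tnth e x, tnth e y) \in E
  | FAux _ s xs => fun e => [tuple of map (tnth e) xs] \in A s
  | FNot _ f => fun e => ~~ eval E A f e
  | FAnd _ f g => fun e => eval E A f e && eval E A g e
  | FOr _ f g => fun e => eval E A f e || eval E A g e
  | FForall _ f => fun e => [forall a : V, eval E A f [tuple of a :: e]]
  | FExists _ f => fun e => [exists a : V, eval E A f [tuple of a :: e]]
  end.

Record dyn_program := DynProgram {
  aux_sym : finType;
  aux_ar : aux_sym -> nat;
  update : forall s : aux_sym, formula aux_ar (aux_ar s);
  answer : aux_sym;
  answer_ar : aux_ar answer = 2
}.

Record change (V : finType) := Change {
  ins : {set V * V};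
  del : {set V * V}
}.

(* [ins] and [del] are not required to be disjoint; on an overlap, deletion
   wins.  Every such change has the same effect as one with disjoint sets that
   affects no further nodes. *)
Definition apply_change (V : finType) (E : {set V * V}) (c : change V) :
    {set V * V} :=
  (E :|: ins c) :\: del c.

Definition affected (V : finType) (c : change V) : {set V} :=
  [set p.1 | p in ins c :|: del c] :|: [set p.2 | p in ins c :|: del c].

Definition step (P : dyn_program) (d : Order.disp_t) (V : finOrderType d)
    (S : {set V * V} * aux_state (@aux_ar P) V) (c : change V) :
    {set V * V} * aux_state (@aux_ar P) V :=
  let E := apply_change S.1 c in
  (E, fun s => [set t | eval E S.2 (update s) t]).

Definition run (P : dyn_program) (d : Order.disp_t) (V : finOrderType d)
    (cs : seq (change V)) : {set V * V} * aux_state (@aux_ar P) V :=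
  foldl (@step P d V) (set0, fun=> set0) cs.

Definition answer_set (P : dyn_program) (V : finType)
    (A : aux_state (@aux_ar P) V) : {set V * V} :=
  [set p | tcast (esym (answer_ar P)) [tuple p.1; p.2] \in A (answer P)].

Definition graph_query := forall V : finType, {set V * V} -> {set V * V}.

(* [connect] is reflexive: the path of length 0 counts. *)
Definition reachability : graph_query := fun V E =>
  [set p | connect [rel x y | (x, y) \in E] p.1 p.2].

Definition maintains (P : dyn_program) (Q : graph_query) (k : nat -> nat) :
    Prop :=
  forall (d : Order.disp_t) (V : finOrderType d) (cs : seq (change V)),
    cs <> [::] ->
    all (fun c => #|affected c| <= k #|V|) cs ->
    answer_set (run P cs).2 = Q V (run P cs).1.

Definition DynFO_arith (Q : graph_query) (k : nat -> nat) : Prop :=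
  exists P : dyn_program, maintains P Q k.

(* Main.v *)
(* The matrix (n+1) I - A is invertible over the rationals, and entry (s, t) of its inverse is nonzero
   iff t is reachable from s. The program stores this inverse modulo all primes p in (n^3, n^6].
   A change on a node set K alters the matrix on K x K only, so by Woodbury's identity each entry of
   the new inverse is characterised by the singularity modulo p of matrices of size 2|K| + 1, which is
   O(log n / log log n). For a prime q polylogarithmic in n, a vector of this length over F_q has
   O(log n) bits and can be quantified; this makes det^2 mod q definable, and Chinese remaindering
   over all small q decides whether p divides det^2.
   A prime dividing one of the determinants is lost. Therefore a second copy is rebuilt from the empty
   graph, one edge position per step, and replaces the first one after n^2 steps; the determinants met
   during the lifetime of a copy have too few prime divisors to kill all p. *)

Require Import Defs.
From mathcomp Require Import all_boot all_order all_algebra all_fingroup.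
From mathcomp Require Import boolp zify.

Set Implicit Arguments.
Unset Strict Implicit.
Unset Printing Implicit Defensive.

Import Order.TTheory GRing.Theory Num.Theory.

(** * Products of primes *)

(** The obstacle is the size of an element. A vector with |K| entries modulo a prime p of polynomial
    size needs |K| log n bits, more than boundedly many nodes can carry, so an elimination modulo p
    cannot be guessed. Modulo a polylogarithmic prime the vector needs O(log n) bits, and |K| =
    O(log n / log log n) is what fits. The hidden constant is absorbed by evaluating all formulas
    over a universe of n^(2^j) numbers, each a tuple of 2^j nodes; this also makes room for primes
    up to n^6 and for fixed-point fractions. The diagonal n + 1 exceeds every row sum of A, so over
    the rationals the inverse is the sum of A^i / (n+1)^(i+1), in which nothing cancels. Primes are
    taken between s and s^2 for s = n^3 because their product is at least 2^(s^2/4), here 2^(n^6/4),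
    whereas the fewer than 2 n^2 determinants met by a copy, together with one entry of the
    adjugate, have a product of at most 2^(4 n^4). The estimates on primes are elementary and come
    from the least common multiple of 1, ..., n. *)

Definition lcm_upto n := \big[lcmn/1]_(1 <= i < n.+1) i.

Lemma lcm_upto_gt0 n : 0 < lcm_upto n.
Proof.
rewrite /lcm_upto big_nat_cond; apply: (big_ind (fun x => 0 < x)) => //.
  by move=> x y x0 y0; rewrite lcmn_gt0 x0.
by move=> i /andP[/andP[]].
Qed.

Lemma lcm_uptoS n : lcm_upto n.+1 = lcmn (lcm_upto n) n.+1.
Proof. by rewrite /lcm_upto big_nat_recr. Qed.

Lemma dvdn_lcm_upto n i : 0 < i <= n -> i %| lcm_upto n.
Proof.
elim: n => [|n IH]; first by lia.
move=> hi; rewrite lcm_uptoS; have [->|ne] := eqVneq i n.+1; first exact: dvdn_lcmr.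
by apply: dvdn_trans (dvdn_lcml _ _); apply: IH; lia.
Qed.

Lemma lcm_upto_dvd n d : (forall i, 0 < i <= n -> i %| d) -> lcm_upto n %| d.
Proof.
elim: n => [|n IH] h; first by rewrite /lcm_upto big_geq ?dvd1n.
rewrite lcm_uptoS dvdn_lcm IH ?h //; first by lia.
by move=> i hi; apply: h; lia.
Qed.

(* Leibniz's harmonic triangle: 1/(m C(n,m)) = 1/(m C(n-1,m)) - 1/((m+1) C(n,m+1)). *)
Lemma leibniz_dvd_lcm n m : 0 < m <= n -> m * 'C(n, m) %| lcm_upto n.
Proof.
elim: n m => [|n IH] m; first by lia.
move=> /andP[m0 mn]; move: {2}(n.+1 - m) (erefl (n.+1 - m)) => k.
elim: k m m0 mn => [|k IHk] m m0 mn ek.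
  have -> : m = n.+1 by lia.
  by rewrite binn muln1; apply: dvdn_lcm_upto; lia.
have /dvdnP[a ea] : m * 'C(n, m) %| lcm_upto n.+1.
  by apply: (dvdn_trans (IH m _)); [lia | rewrite lcm_uptoS dvdn_lcml].
have /dvdnP[b eb] : m.+1 * 'C(n.+1, m.+1) %| lcm_upto n.+1.
  by apply: IHk; lia.
have h1 : n.+1 * 'C(n, m) = (n.+1 - m) * 'C(n.+1, m).
  exact: mul_bin_down n.+1 m.
have h2 : m.+1 * 'C(n.+1, m.+1) = (n.+1 - m) * 'C(n.+1, m) by rewrite mul_bin_left.
have d0 := lcm_upto_gt0 n.+1.
have C0 : 0 < 'C(n.+1, m) by rewrite bin_gt0.
move: ea eb; set d := lcm_upto _ in d0 *; rewrite h2.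
set C := 'C(n.+1, m) in C0 h1 *; set A := 'C(n, m) in h1 *.
have [w ew] : exists w, n.+1 = m + w by exists (n.+1 - m); lia.
rewrite !ew in h1 *; rewrite (_ : m + w - m = w) in h1 *; last by lia.
have w0 : 0 < w by lia.
move=> ea eb.
apply/dvdnP; exists (a - b).
have ha : d * (m + w) = a * m * w * C by rewrite ea; nia.
have hb : d = b * w * C by rewrite eb; lia.
have hab : b * (m + w) = a * m.
  apply/eqP; rewrite -(eqn_pmul2r (_ : 0 < w * C)) ?muln_gt0 ?w0 //; apply/eqP.
  by rewrite -[RHS]/(_ * (w * C)); move: ha; rewrite hb; lia.
have : m * (a - b) = b * w by rewrite mulnBr; nia.
by move=> e; rewrite mulnA [(a - b) * m]mulnC e -hb.
Qed.

Lemma central_bin_ge m : 2 ^ m <= 'C(m.*2, m).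
Proof.
elim: m => [|m IH] //.
have -> : 'C(m.+1.*2, m.+1) = 2 * 'C(m.*2.+1, m).
  rewrite doubleS binS -[in X in X + _](@bin_sub m.*2.+1 m.+1) ?subSS; last by lia.
  by rewrite (_ : m.*2 - m = m); lia.
rewrite expnS leq_pmul2l //; apply: (leq_trans IH).
by case: m {IH} => // m; rewrite [X in _ <= X]binS leq_addr.
Qed.

(** For m the half of n, the central binomial coefficient ['C(m.*2, m)] divides the least common
    multiple by [leibniz_dvd_lcm]. *)
Lemma lcm_upto_ge n : 2 ^ n./2 <= lcm_upto n.
Proof.
case: n => [|[|n]] //; first exact: lcm_upto_gt0.
  exact: lcm_upto_gt0.
set m := n.+2./2; have m0 : 0 < m by rewrite /m /=.
have hm : m.*2 <= n.+2 by rewrite /m; have := odd_double_half n.+2; lia.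
apply: (leq_trans (central_bin_ge m)).
apply: (@leq_trans (lcm_upto m.*2)).
  apply: dvdn_leq (lcm_upto_gt0 _) _.
  apply: dvdn_trans (leibniz_dvd_lcm (_ : 0 < m <= m.*2)); last by lia.
  exact: dvdn_mull.
apply: dvdn_leq (lcm_upto_gt0 _) _; apply: lcm_upto_dvd => i hi.
by apply: dvdn_lcm_upto; lia.
Qed.

Definition prime_prod s m := \prod_(s.+1 <= p < m.+1 | prime p) p.

Lemma prime_prod_gt0 s m : 0 < prime_prod s m.
Proof. by apply: prodn_cond_gt0 => p /prime_gt0. Qed.

Lemma dvdn_big_prod (F : nat -> nat) a b (Q : pred nat) p :
  a <= p < b -> Q p -> F p %| \prod_(a <= i < b | Q i) F i.
Proof.
move=> hp Qp; rewrite big_mkcond /= (big_cat_nat _ (n := p)) /=; try lia.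
rewrite (big_cat_nat _ (m := p) (n := p.+1)) /=; try lia.
by rewrite big_nat1 Qp dvdn_mull // dvdn_mulr.
Qed.

(** Each prime up to s contributes a prime power of at most m; a prime above s occurs at most once,
    because its square exceeds m. *)
Lemma lcm_upto_le_prime_prod s m : m < s.+1 ^ 2 -> 0 < m ->
  lcm_upto m <= m ^ s * prime_prod s m.
Proof.
move=> hm m0.
set Z := \prod_(1 <= p < s.+1 | prime p) p ^ trunc_log p m.
have hZ : Z <= m ^ s.
  apply: (@leq_trans (\prod_(1 <= p < s.+1) m)).
    rewrite /Z big_mkcond; apply: leq_prod => p _; case: ifP => // pp.
    exact: trunc_logP (prime_gt1 pp) m0.
  by rewrite prod_nat_const_nat subn1.
apply: (@leq_trans (Z * prime_prod s m)); last by rewrite leq_mul.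
have Z0 : 0 < Z * prime_prod s m.
  rewrite muln_gt0 prime_prod_gt0 andbT /Z; apply: prodn_cond_gt0 => p hp.
  by rewrite expn_gt0 prime_gt0.
apply: dvdn_leq => //; apply: lcm_upto_dvd => i /andP[i0 im].
apply/dvdn_partP => // p; rewrite mem_primes => /and3P[pp _ pi].
have ple : p ^ logn p i <= m by apply: leq_trans im; apply: dvdn_leq => //; exact: pfactor_dvdnn.
have p2 := prime_gt1 pp.
rewrite p_part; have [ps|ps] := leqP p s.
  apply: dvdn_mulr; apply: (@dvdn_trans (p ^ trunc_log p m)).
    apply: dvdn_exp2l; have := trunc_log_ltn m p2 => h.
    by have := leq_ltn_trans ple h; rewrite ltn_exp2l.
  by rewrite /Z; apply: (dvdn_big_prod (fun p => p ^ trunc_log p m)); lia.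
have hl : logn p i <= 1.
  rewrite leqNgt; apply/negP => h.
  have : p ^ 2 <= p ^ logn p i by rewrite leq_exp2l.
  have : s.+1 ^ 2 <= p ^ 2 by rewrite leq_exp2r.
  by lia.
apply: dvdn_mull; apply: (@dvdn_trans p).
  by rewrite -[X in _ %| X]expn1; apply: dvdn_exp2l.
apply: (dvdn_big_prod id) => //; rewrite ps /=.
by rewrite ltnS; apply: leq_trans im; exact: dvdn_leq.
Qed.

Lemma leq_exp2_div16 s : 128 <= s -> s <= 2 ^ (s %/ 16).
Proof.
elim/ltn_ind: s => s IH hs; have [h|h] := leqP 144 s; last first.
  have : 8 <= s %/ 16 by lia.
  by move=> h8; apply: (@leq_trans (2 ^ 8)); [lia | rewrite leq_exp2l].
have := IH (s - 16) _ _; rewrite (_ : s %/ 16 = ((s - 16) %/ 16).+1); last by lia.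
by rewrite expnS => h'; have := h' ltac:(lia) ltac:(lia); lia.
Qed.

(** With m = s^2, the factor m^s = s^(2s) is at most 2^(s^2/8) by s <= 2^(s/16), which is small
    against the 2^(s^2/2) of [lcm_upto_ge]. *)
Lemma prime_prod_ge s : 128 <= s -> 2 ^ (s ^ 2 %/ 4) <= prime_prod s (s ^ 2).
Proof.
move=> hs; have s0 : 0 < s ^ 2 by rewrite expn_gt0; lia.
have h1 := leq_trans (lcm_upto_ge (s ^ 2)) (lcm_upto_le_prime_prod (s := s) _ s0).
have {}h1 := h1 ltac:(by rewrite ltn_exp2r).
have h2 : (s ^ 2) ^ s <= 2 ^ (s ^ 2 %/ 8).
  rewrite -expnM; apply: (@leq_trans ((2 ^ (s %/ 16)) ^ (2 * s))).
    by rewrite leq_exp2r ?leq_exp2_div16 //; lia.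
  rewrite -expnM leq_exp2l //.
  have -> : s ^ 2 = s * s by rewrite mulnn.
  by have := leq_divM s 16; nia.
have h3 : 2 ^ (s ^ 2)./2 <= 2 ^ (s ^ 2 %/ 8) * prime_prod s (s ^ 2).
  by apply: (leq_trans h1); rewrite leq_mul2r h2 orbT.
rewrite -(leq_pmul2l (_ : 0 < 2 ^ (s ^ 2 %/ 8))) ?expn_gt0 //.
apply: leq_trans h3; rewrite -expnD leq_exp2l //.
have : 128 * 128 <= s ^ 2 by rewrite -mulnn; nia.
by move: (s ^ 2) => x; lia.
Qed.

Lemma prime_prod_dvd s m d :
  (forall p, prime p -> s < p <= m -> p %| d) -> prime_prod s m %| d.
Proof.
rewrite /prime_prod; elim: m => [|m IH] h; first by rewrite big_geq // dvd1n.
have [ms|ms] := leqP m.+1 s; first by rewrite big_geq // dvd1n.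
rewrite big_mkcond big_nat_recr //= -big_mkcond /=; case: ifP => pm; last first.
  by rewrite muln1; apply: IH => p pp hp; apply: h => //; lia.
rewrite Gauss_dvd; last first.
  rewrite coprime_sym prime_coprime //; apply/negP; rewrite Euclid_dvd_prod //.
  rewrite big_has_cond => /hasP[p]; rewrite mem_index_iota => hp /andP[pp].
  by rewrite dvdn_prime2 // => /eqP e; move: hp; rewrite -e; lia.
have -> : m.+1 %| d by apply: h => //; rewrite ms leqnn.
by rewrite andbT IH // => p pp hp; apply: h => //; lia.
Qed.

Lemma prime_ndvd_exists s d : 128 <= s -> 0 < d < 2 ^ (s ^ 2 %/ 4) ->
  exists p, [/\ prime p, s < p <= s ^ 2 & ~~ (p %| d)].
Proof.
move=> hs /andP[d0 hd].
have [/hasP[p]|/hasPn h] := boolP (has (fun p => prime p && ~~ (p %| d)) (iota s.+1 (s ^ 2 - s))).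
  rewrite mem_iota => hp /andP[pp nd]; exists p; split=> //.
  have : s <= s ^ 2 by rewrite -mulnn; nia.
  by lia.
have : prime_prod s (s ^ 2) %| d.
  apply: prime_prod_dvd => p pp hp; have := h p; rewrite mem_iota pp /= negbK; apply.
  by lia.
by move/(dvdn_leq d0); have := prime_prod_ge hs; lia.
Qed.

Lemma sqrt_between y : 0 < y -> exists s, s ^ 2 < y /\ y <= s.+1 ^ 2.
Proof.
elim: y => // -[_ _|y /(_ isT) [s [h1 h2]] _]; first by exists 0.
have [h|h] := leqP y.+2 (s.+1 ^ 2); first by exists s; split; lia.
by exists s.+1; split=> //; apply: (leq_ltn_trans h2); rewrite -!mulnn in h h2 *; nia.
Qed.

Lemma sqrt_large y : 2 ^ 16 <= y -> exists s, [/\ 128 <= s, s ^ 2 < y & y %/ 16 <= s ^ 2 %/ 4].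
Proof.
move=> hy; have [|s [h1 h2]] := @sqrt_between y; first by apply: leq_trans hy; rewrite expn_gt0.
have hs : 255 <= s.
  rewrite leqNgt; apply/negP => h.
  have : s.+1 ^ 2 <= 255 ^ 2 by rewrite leq_exp2r.
  have -> : 255 ^ 2 = 2 ^ 16 - 511 by [].
  by have : 511 < 2 ^ 16 by []; lia.
exists s; split=> //; first by lia.
by rewrite -!mulnn in h1 h2 *; nia.
Qed.

Definition primorial y := \prod_(0 <= q < y | prime q) q.

Lemma primorial_gt0 y : 0 < primorial y.
Proof. by apply: prodn_cond_gt0 => p /prime_gt0. Qed.

Lemma primorial_ge y : 2 ^ 16 <= y -> 2 ^ (y %/ 16) <= primorial y.
Proof.
move=> hy; have [s [hs h1 h2]] := sqrt_large hy.
apply: (@leq_trans (2 ^ (s ^ 2 %/ 4))); first by rewrite leq_exp2l.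
apply: (leq_trans (prime_prod_ge hs)).
apply: dvdn_leq (primorial_gt0 _) _; apply: prime_prod_dvd => p pp hp.
by apply: (dvdn_big_prod id) => //; lia.
Qed.

Lemma small_prime_ndvd y d : 2 ^ 16 <= y -> 0 < d < 2 ^ (y %/ 16) ->
  exists p, [/\ prime p, p < y & ~~ (p %| d)].
Proof.
move=> hy /andP[d0 hd]; have [s [hs h1 h2]] := sqrt_large hy.
have [|p [pp hp nd]] := prime_ndvd_exists (d := d) hs.
  by rewrite d0 (leq_trans hd) // leq_exp2l.
by exists p; split=> //; lia.
Qed.

(** Chinese remaindering in the form used throughout: a nonzero difference below 2^(y/16) is missed
    by some prime below y. *)
Lemma eq_mod_small y a b : 2 ^ 16 <= y -> a < 2 ^ (y %/ 16) -> b < 2 ^ (y %/ 16) ->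
  (forall q, 0 < q < y -> a = b %[mod q]) -> a = b.
Proof.
move=> hy; wlog hab : a b / b <= a.
  by move=> W ha hb h; case: (leqP b a) => [|/ltnW] hab; [|symmetry]; apply: W => // q hq; rewrite h.
move=> ha hb h; apply/eqP; rewrite eqn_leq hab andbT -subn_eq0; apply: contraT.
rewrite -lt0n => d0; have [|p [pp hp]] := @small_prime_ndvd y (a - b) hy; first by lia.
by rewrite -eqn_mod_dvd // h ?eqxx // prime_gt0.
Qed.

(** * First-order definability over arithmetic structures *)

(** [sz] and [nn] are separate because the universe will be replaced by a power of itself while the
    nodes remain the initial segment below [nn]. [au] accepts sequences of any length, so one
    relation carries all stored data. *)
Record model := Model {
  sz : nat;
  nn : nat;
  ed : nat -> nat -> Prop;
  au : seq nat -> Prop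
}.

(* Variables are de Bruijn indices; quantifiers range over [0, sz). *)
Inductive bform :=
| BEq of nat & nat
| BAdd of nat & nat & nat
| BMul of nat & nat & nat
| BNode of nat
| BEdge of nat & nat
| BAux of seq nat
| BNot of bform
| BAnd of bform & bform
| BEx of bform.

Definition env := nat -> nat.

Definition econs (a : nat) (e : env) : env := fun i => if i is j.+1 then e j else a.

Fixpoint sem (M : model) (e : env) (b : bform) : Prop :=
  match b with
  | BEq x y => e x = e y
  | BAdd x y z => e x + e y = e z
  | BMul x y z => e x * e y = e z
  | BNode x => e x < nn M
  | BEdge x y => ed M (e x) (e y)
  | BAux xs => au M (map e xs)
  | BNot b => ~ sem M e b
  | BAnd b1 b2 => sem M e b1 /\ sem M e b2
  | BEx b => exists2 a, a < sz M & sem M (econs a e) b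
  end.

Definition upren (r : nat -> nat) : nat -> nat := fun i => if i is j.+1 then (r j).+1 else 0.

Fixpoint ren (r : nat -> nat) (b : bform) : bform :=
  match b with
  | BEq x y => BEq (r x) (r y)
  | BAdd x y z => BAdd (r x) (r y) (r z)
  | BMul x y z => BMul (r x) (r y) (r z)
  | BNode x => BNode (r x)
  | BEdge x y => BEdge (r x) (r y)
  | BAux xs => BAux (map r xs)
  | BNot b => BNot (ren r b)
  | BAnd b1 b2 => BAnd (ren r b1) (ren r b2)
  | BEx b => BEx (ren (upren r) b)
  end.

Lemma sem_ren M b r e : sem M e (ren r b) <-> sem M (fun i => e (r i)) b.
Proof.
elim: b r e => //=.
- by move=> xs r e; rewrite -map_comp.
- by move=> b IH r e; rewrite IH.
- by move=> b1 IH1 b2 IH2 r e; rewrite IH1 IH2.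
- move=> b IH r e.
  suff h a : sem M (econs a e) (ren (upren r) b) <-> sem M (econs a (fun i => e (r i))) b.
    by split=> -[a ha hb]; exists a => //; apply/h.
  rewrite IH; suff -> : (fun i => econs a e (upren r i)) = econs a (fun i => e (r i)) by [].
  by apply/funext => -[|i].
Qed.

Definition bounded (M : model) (e : env) := forall i, e i < sz M.

Lemma bounded_econs M a e : a < sz M -> bounded M e -> bounded M (econs a e).
Proof. by move=> ha he [|i] /=. Qed.

(** One formula serves all structures of the class [G]; a dynamic program needs this uniformity. *)
Definition dpred (G : model -> Prop) (P : model -> env -> Prop) :=
  exists b, forall M e, G M -> bounded M e -> (sem M e b <-> P M e).

(* Graph definability only: the value may exceed the size of the structure. *)
Definition dfun (G : model -> Prop) (f : model -> env -> nat) :=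
  dpred G (fun M e => f M (fun i => e i.+1) = e 0).

(** Only such values can be named by a quantifier and inserted into relations. *)
Definition dval (G : model -> Prop) (f : model -> env -> nat) :=
  dfun G f /\ forall M e, G M -> bounded M e -> f M e < sz M.

(* The least [x < n] with [P x], and [0] if there is none. *)
Definition mu (n : nat) (P : nat -> Prop) : nat :=
  let s := find (fun x => `[< P x >]) (iota 0 n) in if s < n then s else 0.

Lemma muP n (P : nat -> Prop) :
  (exists2 x, x < n & P x) ->
  [/\ mu n P < n, P (mu n P) & forall y, P y -> mu n P <= y].
Proof.
move=> [x xn Px]; rewrite /mu.
have hh : has (fun x => `[< P x >]) (iota 0 n).
  by apply/hasP; exists x; [rewrite mem_iota | apply/asboolP].
have hs : find (fun x => `[< P x >]) (iota 0 n) < n.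
  by rewrite -[X in _ < X](size_iota 0 n) -has_find.
rewrite hs; split=> //.
  by have := nth_find 0 hh; rewrite nth_iota // => /asboolP.
move=> y Py; rewrite leqNgt; apply/negP => hy.
have := before_find 0 hy; rewrite nth_iota ?(ltn_trans hy) // add0n.
by move/asboolPn; apply.
Qed.

Lemma mu_none n (P : nat -> Prop) : (forall x, x < n -> ~ P x) -> mu n P = 0.
Proof.
move=> h; rewrite /mu; case: ifP => // hs.
have := hs; rewrite -[X in _ < X](size_iota 0 n) -has_find => /hasP[x].
by rewrite mem_iota add0n => /andP[_ hx] /asboolP /(h x hx).
Qed.

Lemma mu_lt n P : 0 < n -> mu n P < n.
Proof. by rewrite /mu; case: ifP. Qed.

Lemma mu_eq n (P : nat -> Prop) x : x < n -> P x -> (forall y, y < n -> P y -> y = x) -> mu n P = x.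
Proof. by move=> xn Px h; have [h1 h2 _] := muP (ex_intro2 _ _ x xn Px); apply: h. Qed.

Lemma eq_mu n (P Q : nat -> Prop) : (forall x, x < n -> (P x <-> Q x)) -> mu n P = mu n Q.
Proof.
move=> h; rewrite /mu; suff -> : find (fun x => `[< P x >]) (iota 0 n) =
  find (fun x => `[< Q x >]) (iota 0 n) by [].
apply: eq_in_find => x; rewrite mem_iota add0n => /andP[_ hx].
by apply: asbool_equiv_eq; apply: h.
Qed.

Definition cif {A : Type} (P : Prop) (x y : A) := if `[< P >] then x else y.

Lemma cifT A (P : Prop) (x y : A) : P -> cif P x y = x.
Proof. by move=> h; rewrite /cif; case: asboolP. Qed.

Lemma cifF A (P : Prop) (x y : A) : ~ P -> cif P x y = y.
Proof. by move=> h; rewrite /cif; case: asboolP. Qed.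

(* Truncation turns a possibly overflowing value into an element of the structure. *)
Definition tr (M : model) (x : nat) := if x < sz M then x else 0.

Lemma trE M x : x < sz M -> tr M x = x.
Proof. by rewrite /tr => ->. Qed.

(** * Closure properties of definable predicates, functions and values *)

Section Calculus.
Variable G : model -> Prop.

Notation dpred := (dpred G).
Notation dfun := (dfun G).
Notation dval := (dval G).

Lemma d_ext P Q : (forall M e, G M -> bounded M e -> (P M e <-> Q M e)) -> dpred Q -> dpred P.
Proof. by move=> h [b hb]; exists b => M e hM he; rewrite hb // h. Qed.

Lemma d_not P : dpred P -> dpred (fun M e => ~ P M e).
Proof. by move=> [b hb]; exists (BNot b) => M e hM he /=; rewrite hb. Qed.

Lemma d_and P Q : dpred P -> dpred Q -> dpred (fun M e => P M e /\ Q M e).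
Proof.
by move=> [b hb] [c hc]; exists (BAnd b c) => M e hM he /=; rewrite hb // hc.
Qed.

Lemma d_or P Q : dpred P -> dpred Q -> dpred (fun M e => P M e \/ Q M e).
Proof.
move=> hP hQ; apply: (d_ext _ (d_not (d_and (d_not hP) (d_not hQ)))) => M e _ _ /=.
by have [h|h] := pselect (P M e); have [h'|h'] := pselect (Q M e); tauto.
Qed.

Lemma d_imp (P Q : model -> env -> Prop) :
  dpred P -> dpred Q -> dpred (fun M e => P M e -> Q M e).
Proof.
move=> hP hQ; apply: (d_ext _ (d_not (d_and hP (d_not hQ)))) => M e _ _ /=.
by have [h|h] := pselect (P M e); have [h'|h'] := pselect (Q M e); tauto.
Qed.

Lemma d_ren r P : dpred P -> dpred (fun M e => P M (fun i => e (r i))).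
Proof. by move=> [b hb]; exists (ren r b) => M e hM he; rewrite sem_ren hb. Qed.

Lemma d_ex (P : model -> env -> nat -> Prop) :
  dpred (fun M e => P M (fun i => e i.+1) (e 0)) ->
  dpred (fun M e => exists2 x, x < sz M & P M e x).
Proof.
move=> [b hb]; exists (BEx b) => M e hM he /=.
by split=> -[a ha h]; exists a => //; move: h; rewrite hb //; apply: bounded_econs.
Qed.

Lemma d_all (P : model -> env -> nat -> Prop) :
  dpred (fun M e => P M (fun i => e i.+1) (e 0)) ->
  dpred (fun M e => forall x, x < sz M -> P M e x).
Proof.
move=> h; apply: (d_ext _ (d_not (d_ex (P := fun M e x => ~ P M e x) (d_not h)))) => M e _ _.
split; first by move=> h1 [x hx]; apply; apply: h1.
by move=> h1 x hx; apply: contrapT => h2; apply: h1; exists x.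
Qed.

Lemma dfun_graph f r k : dfun f -> dpred (fun M e => f M (fun i => e (r i)) = e k).
Proof. by move=> /(d_ren (fun i => if i is j.+1 then r j else k)). Qed.

Lemma dfun_ext f g : (forall M e, G M -> bounded M e -> f M e = g M e) -> dfun g -> dfun f.
Proof.
move=> h; apply: d_ext => M e hM he; by rewrite h.
Qed.

Lemma dval_ext f g : (forall M e, G M -> bounded M e -> f M e = g M e) -> dval g -> dval f.
Proof.
by move=> h [h1 h2]; split; [apply: dfun_ext h1 | move=> M e hM he; rewrite h // h2].
Qed.

Lemma dfun_ren r f : dfun f -> dfun (fun M e => f M (fun i => e (r i))).
Proof. exact: dfun_graph. Qed.

Lemma dval_ren r f : dval f -> dval (fun M e => f M (fun i => e (r i))).
Proof.
by move=> [h1 h2]; split; [apply: dfun_ren | move=> M e hM he; apply: h2 => // i].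
Qed.

Lemma dval_dfun f : dval f -> dfun f. Proof. by case. Qed.

Lemma dval_var k : dval (fun M e => e k).
Proof. by split; [exists (BEq k.+1 0) | move=> M e hM he; apply: he]. Qed.

Lemma d_eq f g : dfun f -> dval g -> dpred (fun M e => f M e = g M e).
Proof.
move=> hf [hg hb].
apply: (@d_ext _ (fun M e => exists2 x, x < sz M & f M e = x /\ g M e = x)).
  move=> M e hM he; split=> [h|[x _ [-> ->]] //].
  by exists (g M e); rewrite ?hb.
by apply: d_ex; apply: d_and; apply: dfun_graph.
Qed.

Lemma d_eq2 f g : dval f -> dfun g -> dpred (fun M e => f M e = g M e).
Proof. by move=> hf hg; apply: d_ext (d_eq hg hf) => M e _ _; split. Qed.

Lemma dfun_add f g : dfun f -> dfun g -> dfun (fun M e => f M e + g M e).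
Proof.
move=> hf hg.
apply: (@d_ext _ (fun M e => exists2 x, x < sz M & exists2 y, y < sz M &
  f M (fun i => e i.+1) = x /\ (g M (fun i => e i.+1) = y /\ x + y = e 0))).
  move=> M e hM he; split=> [h|[x _ [y _ [-> [-> //]]]]].
  have := he 0; rewrite -h => h0.
  by exists (f M (fun i => e i.+1)); [lia|exists (g M (fun i => e i.+1)); [lia|split]].
apply: d_ex; apply: d_ex; apply: d_and; first exact: (@dfun_graph f (fun i => i.+3) 1).
apply: d_and; first exact: (@dfun_graph g (fun i => i.+3) 0).
by exists (BAdd 1 0 2).
Qed.

Lemma dfun0 : dfun (fun _ _ => 0).
Proof. by exists (BAdd 0 0 0) => M e hM he /=; lia. Qed.

Lemma dfun1 : dfun (fun _ _ => 1).
Proof.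
by exists (BAnd (BMul 0 0 0) (BNot (BAdd 0 0 0))) => M e hM he /=; split; [nia|move=> <-].
Qed.

Lemma dfun_succ f : dfun f -> dfun (fun M e => (f M e).+1).
Proof. by move=> hf; apply: dfun_ext (dfun_add hf dfun1) => M e _ _; rewrite addn1. Qed.

Lemma dfun_const c : dfun (fun _ _ => c).
Proof. by elim: c => [|c]; [exact: dfun0 | exact: dfun_succ]. Qed.

Lemma dfun_mul f g : dfun f -> dfun g -> dfun (fun M e => f M e * g M e).
Proof.
move=> hf hg.
(* A product 0 lies in the structure even when one of the factors does not, so a vanishing factor is
   a case of its own. *)
apply: (@d_ext _ (fun M e => (exists2 x, x < sz M & exists2 y, y < sz M &
  f M (fun i => e i.+1) = x /\ (g M (fun i => e i.+1) = y /\ x * y = e 0)) \/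
  (0 = e 0 /\ ((exists2 x, x < sz M & f M (fun i => e i.+1) = x /\ 0 = x) \/
   (exists2 x, x < sz M & g M (fun i => e i.+1) = x /\ 0 = x))))).
  move=> M e hM he; split.
    move=> h; have := he 0 => h0.
    have [E|E] := posnP (e 0); last first.
      move: E h0; rewrite -h muln_gt0 => /andP[f0 g0] h0; left.
      exists (f M (fun i => e i.+1)); first exact: leq_ltn_trans (leq_pmulr _ g0) h0.
      exists (g M (fun i => e i.+1)); first exact: leq_ltn_trans (leq_pmull _ f0) h0.
      by split.
    move: h; rewrite E => /eqP; rewrite muln_eq0 => /orP[]/eqP h; right; split=> //.
      by left; exists 0 => //; lia.
    by right; exists 0 => //; lia.
  case=> [[x _ [y _ [-> [-> //]]]]|[<-]].
  by case=> [[x _ [-> <-]] //|[x _ [-> <-]]]; rewrite muln0.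
apply: d_or.
  apply: d_ex; apply: d_ex; apply: d_and; first exact: (@dfun_graph f (fun i => i.+3) 1).
  apply: d_and; first exact: (@dfun_graph g (fun i => i.+3) 0).
  by exists (BMul 1 0 2).
apply: d_and; first exact: dfun0.
apply: d_or; apply: d_ex; (apply: d_and; [exact: (dfun_graph (fun i => i.+2) 0)|exact: dfun0]).
Qed.

Lemma d_le f g : dfun f -> dval g -> dpred (fun M e => f M e <= g M e).
Proof.
move=> hf hg.
apply: (@d_ext _ (fun M e => exists2 x, x < sz M & f M e + x = g M e)).
  move=> M e hM he; split=> [h|[x _ <-]]; last exact: leq_addr.
  by exists (g M e - f M e); [have := hg.2 M e hM he; lia | lia].
apply: d_ex; apply: d_eq; last exact: dval_ren.
by apply: dfun_add; [apply: dfun_ren | case: (dval_var 0)].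
Qed.

Lemma d_le2 f g : dval f -> dfun g -> dpred (fun M e => f M e <= g M e).
Proof.
move=> hf hg; apply: (d_ext _ (d_not (d_le (dfun_succ hg) hf))) => M e _ _.
by rewrite leqNgt; split => /negP.
Qed.

Lemma d_lt2 f g : dval f -> dfun g -> dpred (fun M e => f M e < g M e).
Proof.
move=> hf hg; apply: (d_ext _ (d_not (d_le hg hf))) => M e _ _.
by rewrite ltnNge; split => /negP.
Qed.

Lemma dval0 : dval (fun _ _ => 0).
Proof. by split=> [|M e _ he]; [exact: dfun0|apply: leq_ltn_trans (he 0)]. Qed.

Lemma dval_mu (P : model -> env -> nat -> Prop) :
  dpred (fun M e => P M (fun i => e i.+1) (e 0)) -> dval (fun M e => mu (sz M) (P M e)).
Proof.
move=> hP; split; last by move=> M e hM he; apply: mu_lt; apply: leq_ltn_trans (he 0).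
apply: (@d_ext _ (fun M e => (P M (fun i => e i.+1) (e 0) /\
   forall x, x < sz M -> x < e 0 -> ~ P M (fun i => e i.+1) x) \/
   (e 0 = 0 /\ forall x, x < sz M -> ~ P M (fun i => e i.+1) x))).
  move=> M e hM he; set Q := P M _; split=> [<-|].
    have [h|h] := pselect (exists2 x, x < sz M & Q x).
      have [h1 h2 h3] := muP h; left; split=> // x _ hx /h3; lia.
    right; have h' x : x < sz M -> ~ Q x by move=> hx hq; apply: h; exists x.
    by split=> //; apply: mu_none.
  case=> [[h1 h2]|[-> h]]; last exact: mu_none.
  have [h3 h4 h5] := muP (ex_intro2 _ _ (e 0) (he 0) h1).
  apply/eqP; rewrite eqn_leq h5 //= leqNgt; apply/negP => h6.
  by apply: (h2 _ h3 h6).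
have v k := dval_var k; apply: d_or; apply: d_and => //.
- apply: d_all; apply: d_imp; first by apply: d_le => //; apply: dfun_succ; case: (v 0).
  apply: d_not; exact: (d_ren (fun i => if i is j.+1 then j.+2 else 0) hP).
- by apply: d_eq2 => //; apply: dfun0.
- apply: d_all; apply: d_not; exact: (d_ren (fun i => if i is j.+1 then j.+2 else 0) hP).
Qed.

Lemma dval_cif P f g : dpred P -> dval f -> dval g -> dval (fun M e => cif (P M e) (f M e) (g M e)).
Proof.
move=> hP hf hg; split; last first.
  by move=> M e hM he; rewrite /cif; case: ifP => _; [apply: hf.2 | apply: hg.2].
apply: (@d_ext _ (fun M e => (P M (fun i => e i.+1) /\ f M (fun i => e i.+1) = e 0) \/
  (~ P M (fun i => e i.+1) /\ g M (fun i => e i.+1) = e 0))).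
  by move=> M e hM he; rewrite /cif; case: asboolP; tauto.
have h := d_ren (fun i => i.+1) hP.
by apply: d_or; apply: d_and; [|exact: hf.1| exact: d_not|exact: hg.1].
Qed.

Lemma dval_tr f : dfun f -> dval (fun M e => tr M (f M e)).
Proof.
move=> hf.
apply: (@dval_ext _ (fun M e => mu (sz M) (fun x => f M e = x))).
  move=> M e hM he; rewrite /tr; case: ltnP => h; first by symmetry; apply: mu_eq.
  by symmetry; apply: mu_none => x hx E; lia.
by apply: dval_mu; apply: dfun_graph.
Qed.

Lemma dval_const c : (forall M, G M -> c < sz M) -> dval (fun _ _ => c).
Proof. by move=> h; split=> [|M e hM _]; [apply: dfun_const | apply: h]. Qed.

Lemma dval_szp : dval (fun M _ => (sz M).-1).
Proof.
apply: (@dval_ext _ (fun M e => mu (sz M) (fun x => forall y, y < sz M -> y <= x))).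
  move=> M e hM he; have h0 : 0 < sz M by apply: leq_ltn_trans (he 0).
  symmetry; apply: mu_eq; [lia|move=> y; lia|].
  by move=> y hy /(_ (sz M).-1); lia.
by apply: dval_mu; apply: d_all; apply: d_le2; [exact: (dval_var 0)|case: (dval_var 1)].
Qed.

Lemma d_node f : dval f -> dpred (fun M e => f M e < nn M).
Proof.
move=> hf; apply: (@d_ext _ (fun M e => exists2 x, x < sz M & f M e = x /\ x < nn M)).
  move=> M e hM he; split=> [h|[x _ [-> //]]].
  by exists (f M e) => //; apply: hf.2.
apply: d_ex; apply: d_and; first by apply: dfun_graph; case: hf.
by exists (BNode 0).
Qed.

(** Only the graph is definable: in the base structure [nn] equals [sz] and is not an element. The
    formula describes the least element that is not a node. *)
Lemma dfun_nn : dfun (fun M _ => nn M).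
Proof.
apply: (@d_ext _ (fun M e => ~ (e 0 < nn M) /\ forall x, x < sz M -> x < e 0 -> x < nn M)).
  move=> M e hM he; split=> [-> | [h1 h2]]; first by split=> [|x _ //]; rewrite ltnn.
  apply/eqP; rewrite eqn_leq; apply/andP; split; first by lia.
  case: (posnP (e 0)) => [h|h]; first by rewrite h; lia.
  by have := he 0; have := h2 (e 0).-1; lia.
apply: d_and; first by apply: d_not; apply: d_node; exact: dval_var.
apply: d_all; apply: d_imp; last by apply: d_node; exact: dval_var.
by apply: d_le (dval_var 1); apply: dfun_succ; case: (dval_var 0).
Qed.

Lemma d_edge f g : dval f -> dval g -> dpred (fun M e => ed M (f M e) (g M e)).
Proof.
move=> hf hg; apply: (@d_ext _ (fun M e => exists2 x, x < sz M & exists2 y, y < sz M &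
   f M e = x /\ (g M e = y /\ ed M x y))).
  move=> M e hM he; split=> [h|[x _ [y _ [-> [-> //]]]]].
  by exists (f M e); [apply: hf.2 | exists (g M e) => //; apply: hg.2].
apply: d_ex; apply: d_ex; apply: d_and; first exact: (@dfun_graph f (fun i => i.+2) 1 hf.1).
apply: d_and; first exact: (@dfun_graph g (fun i => i.+2) 0 hg.1).
by exists (BEdge 1 0).
Qed.

Lemma d_aux5 f1 f2 f3 f4 f5 : dval f1 -> dval f2 -> dval f3 -> dval f4 -> dval f5 ->
  dpred (fun M e => au M [:: f1 M e; f2 M e; f3 M e; f4 M e; f5 M e]).
Proof.
move=> h1 h2 h3 h4 h5.
apply: (@d_ext _ (fun M e => exists2 x1, x1 < sz M & exists2 x2, x2 < sz M &
   exists2 x3, x3 < sz M & exists2 x4, x4 < sz M & exists2 x5, x5 < sz M &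
   f1 M e = x1 /\ (f2 M e = x2 /\ (f3 M e = x3 /\ (f4 M e = x4 /\ (f5 M e = x5 /\
   au M [:: x1; x2; x3; x4; x5])))))).
  move=> M e hM he; split=> [h|[x1 _ [x2 _ [x3 _ [x4 _ [x5 _ [-> [-> [-> [-> [-> //]]]]]]]]]]].
  exists (f1 M e); first exact: h1.2.
  exists (f2 M e); first exact: h2.2.
  exists (f3 M e); first exact: h3.2.
  exists (f4 M e); first exact: h4.2.
  by exists (f5 M e); first exact: h5.2.
do 5!apply: d_ex.
apply: d_and; first exact: (@dfun_graph f1 (fun i => i.+4.+1) 4 h1.1).
apply: d_and; first exact: (@dfun_graph f2 (fun i => i.+4.+1) 3 h2.1).
apply: d_and; first exact: (@dfun_graph f3 (fun i => i.+4.+1) 2 h3.1).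
apply: d_and; first exact: (@dfun_graph f4 (fun i => i.+4.+1) 1 h4.1).
apply: d_and; first exact: (@dfun_graph f5 (fun i => i.+4.+1) 0 h5.1).
by exists (BAux [:: 4; 3; 2; 1; 0]).
Qed.

End Calculus.

(** Redefined after each group of new operations, so that [dp] finds their closure lemmas. *)
Ltac dhook := fail.

(** Follows the syntax of the predicate. The comparisons sit under [solve] because it is not known
    beforehand which side is a value inside the structure, and a failed choice must be undone. *)
Ltac dp :=
  cbv beta;
  first
  [ assumption
  | lazymatch goal with
    | |- forall _, _ => intro; dp
    | |- dpred _ _ =>
      first
      [ simple apply d_and; dp
      | simple apply d_or; dp
      | simple apply d_not; dp
      | simple apply d_ex; dp
      | simple apply d_all; dp
      | simple apply d_imp; dp
      | solve [simple apply d_node; dp]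
      | solve [simple apply d_le; dp]
      | solve [simple apply d_le2; dp]
      | solve [simple apply d_lt2; dp]
      | solve [simple apply d_eq; dp]
      | solve [simple apply d_eq2; dp]
      | simple apply d_edge; dp
      | simple apply d_aux5; dp
      | dhook; dp
      | match goal with H : _ |- _ => solve [simple apply H; dp] end
      | simple apply d_ren; assumption ]
    | |- dfun _ _ =>
      first
      [ simple apply dfun_const
      | simple apply dfun_nn
      | simple apply dfun_succ; dp
      | simple apply dfun_add; dp
      | simple apply dfun_mul; dp
      | simple apply dval_dfun; dp
      | simple apply dfun_ren; assumption ]
    | |- dval _ _ =>
      first
      [ simple apply dval_var
      | simple apply dval0
      | simple apply dval_szp
      | simple apply dval_mu; dp
      | simple apply dval_cif; dp
      | simple apply dval_tr; dp
      | dhook; dp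
      | match goal with H : _ |- _ => solve [simple apply H; dp] end
      | simple apply dval_ren; assumption ]
    end
  ].

(** * Divisibility, division, subtraction and primality *)

Section Arith.
Variable G : model -> Prop.
Notation dpred := (dpred G).
Notation dfun := (dfun G).
Notation dval := (dval G).

Lemma d_dvd f g : dfun f -> dval g -> dpred (fun M e => f M e %| g M e).
Proof.
move=> hf hg.
apply: (@d_ext _ _ (fun M e => exists2 x, x < sz M & x * f M e = g M e)).
  move=> M e hM he; split=> [/dvdnP[x ex]|[x _ <-]]; last exact: dvdn_mull.
  have [f0|f0] := posnP (f M e).
    by exists 0; [apply: leq_ltn_trans (he 0)|rewrite ex f0 !muln0].
  by exists x; rewrite -?ex //; apply: leq_ltn_trans (hg.2 M e hM he); rewrite ex leq_pmulr.
have hg' := dval_ren (fun i => i.+1) hg; have hf' := dfun_ren (fun i => i.+1) hf; dp.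
Qed.

Lemma dval_divmod f g : dval f -> dfun g ->
  dval (fun M e => f M e %% g M e) /\ dval (fun M e => f M e %/ g M e).
Proof.
move=> hf hg.
have hf1 := dval_ren (fun i => i.+1) hf; have hg1 := dfun_ren (fun i => i.+1) hg.
have hf2 := dval_ren (fun i => i.+2) hf; have hg2 := dfun_ren (fun i => i.+2) hg.
split.
  (* The disjunct [g M e <= 0] implements the conventions [x %% 0 = x] and [x %/ 0 = 0]. *)
  apply: (@dval_ext _ _ (fun M e => mu (sz M) (fun r =>
     (g M e <= 0 /\ r = f M e) \/ (r < g M e /\ exists2 q, q < sz M & q * g M e + r = f M e)))).
    move=> M e hM he; have hb := hf.2 M e hM he; symmetry.
    move: (f M e) (g M e) hb => x y hb; apply: mu_eq.
    - exact: leq_ltn_trans (leq_mod _ _) hb.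
    - have [->|y0] := posnP y; [left; rewrite modn0|right; rewrite ltn_pmod //]; split=> //.
      by exists (x %/ y); rewrite -?divn_eq //; apply: leq_ltn_trans (leq_div _ _) hb.
    - move=> r hr [[]|[h [q _ <-]]]; first by rewrite leqn0 => /eqP -> ->; rewrite modn0.
      by rewrite modnMDl modn_small.
  dp.
apply: (@dval_ext _ _ (fun M e => mu (sz M) (fun q =>
     (g M e <= 0 /\ q = 0) \/ (exists2 r, r < sz M & r < g M e /\ q * g M e + r = f M e)))).
  move=> M e hM he; have hb := hf.2 M e hM he; symmetry.
  move: (f M e) (g M e) hb => x y hb; apply: mu_eq.
  - exact: leq_ltn_trans (leq_div _ _) hb.
  - have [->|y0] := posnP y; [by left; rewrite divn0|right].
    exists (x %% y); first exact: leq_ltn_trans (leq_mod _ _) hb.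
    by rewrite ltn_pmod // -divn_eq.
  - move=> q hq [[]|[r _ [h <-]]]; first by rewrite leqn0 => /eqP -> ->; rewrite divn0.
    by rewrite divnMDl ?divn_small ?addn0 //; apply: leq_ltn_trans h.
dp.
Qed.

Lemma dval_mod f g : dval f -> dfun g -> dval (fun M e => f M e %% g M e).
Proof. by move=> hf hg; case: (dval_divmod hf hg). Qed.

Lemma dval_div f g : dval f -> dfun g -> dval (fun M e => f M e %/ g M e).
Proof. by move=> hf hg; case: (dval_divmod hf hg). Qed.

Lemma dval_sub f g : dval f -> dfun g -> dval (fun M e => f M e - g M e).
Proof.
move=> hf hg.
have hf1 := dval_ren (fun i => i.+1) hf; have hg1 := dfun_ren (fun i => i.+1) hg.
apply: (@dval_ext _ _ (fun M e => mu (sz M) (fun r =>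
     (f M e <= g M e /\ r = 0) \/ (g M e + r = f M e)))).
  move=> M e hM he; have hb := hf.2 M e hM he; symmetry.
  by apply: mu_eq; [lia|lia|move=> y hy; lia].
dp.
Qed.

Lemma d_prime f : dval f -> dpred (fun M e => prime (f M e)).
Proof.
move=> hf; have hf1 := dval_ren (fun i => i.+1) hf.
apply: (@d_ext _ _ (fun M e => 1 < f M e /\ forall d, d < sz M -> d %| f M e -> d = 1 \/ d = f M e)).
  move=> M e hM he; split.
    move=> /primeP[h1 h2]; split; first exact: h1.
    by move=> d _ hd; have /pred2P := h2 d hd.
  move=> [h1 h2]; apply/primeP; split=> // d hd; have := h2 d _ hd.
  case; [|by move=> ->; rewrite eqxx|by move=> ->; rewrite eqxx orbT].
  by apply: leq_ltn_trans (hf.2 M e hM he); apply: dvdn_leq => //; lia.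
apply: d_and; first dp.
apply: d_all; apply: d_imp; first by apply: d_dvd; dp.
dp.
Qed.

End Arith.

Ltac dhook ::=
  first [ simple apply dval_mod | simple apply dval_div | simple apply dval_sub
        | simple apply d_prime | simple apply d_dvd ].

(** * Sequences of small numbers coded by digits *)

(* The constants are locked because their unary form must never be computed. *)
Definition ymin : nat := locked (2 ^ 24).
Definition ydeg : nat := locked 64.

(** Taking the predecessor of N makes y^t < N strict for t = [ylog N y], so every number with t
    digits in base y lies in the structure. *)
Definition ylog N y := trunc_log y N.-1.

(* A digit base [y] polynomially related to the number [ylog N y] of digits. *)
Definition valid_base N y :=
  [&& prime y, ymin <= y, ydeg < ylog N y, ylog N y ^ 12 <= y & y <= ylog N y ^ ydeg].

Definition YM M := mu (sz M) (fun y => valid_base (sz M) y).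
Definition TM M := ylog (sz M) (YM M).

(** The bound on [sz] leaves room for p (n+1) with p <= n^6 and for the fractions of [Sing], which
    need 16 p Y^3. [YM M <= nn M] places every p > n^3 above all primes used for Chinese
    remaindering. *)
Definition goodM M :=
  [/\ exists2 y, y < sz M & valid_base (sz M) y, YM M <= nn M & 16 * nn M ^ 8 * YM M ^ 3 <= sz M].

Lemma ylog_bounds N y : 1 < y -> y < N -> [/\ 0 < ylog N y, y ^ ylog N y < N & N <= y ^ (ylog N y).+1].
Proof.
move=> y1 yN; have N0 : 0 < N.-1 by lia.
have h1 := trunc_logP y1 N0; have h2 := trunc_log_ltn N.-1 y1.
split; rewrite /ylog; [|lia|lia].
by rewrite trunc_log_gt0 y1 /=; lia.
Qed.

(** * Size estimates for the digit base and the number of digits *)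

Section Good.
Variables (M : model) (hM : goodM M).
Let N := sz M.
Let Y := YM M.
Let T := TM M.

Lemma valid_YM : valid_base N Y /\ Y < N.
Proof. by case: hM => h _ _; have [h1 h2 _] := muP h. Qed.

Lemma YM_lt : Y < N. Proof. by case: valid_YM. Qed.
Lemma YM_prime : prime Y. Proof. by case: valid_YM => /and5P[]. Qed.
Lemma YM_ge : 2 ^ 24 <= Y.
Proof. by case: valid_YM => /and5P[_ h _ _ _] _; rewrite /ymin -lock in h. Qed.
Lemma TM_gt : ydeg < T. Proof. by case: valid_YM => /and5P[]. Qed.
Lemma TM_le_YM12 : T ^ 12 <= Y. Proof. by case: valid_YM => /and5P[]. Qed.
Lemma YM_le_TM : Y <= T ^ ydeg. Proof. by case: valid_YM => /and5P[]. Qed.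
Lemma YM_gt1 : 1 < Y. Proof. exact: prime_gt1 YM_prime. Qed.
Lemma YM_gt0 : 0 < Y. Proof. exact: prime_gt0 YM_prime. Qed.
Lemma TM_gt0 : 0 < T. Proof. exact: leq_ltn_trans TM_gt. Qed.
Lemma TM_le : T <= Y.
Proof. by apply: leq_trans TM_le_YM12; rewrite -{1}(expn1 T) leq_pexp2l // TM_gt0. Qed.
Lemma YT_lt : Y ^ T < N. Proof. by have [] := ylog_bounds YM_gt1 YM_lt. Qed.
Lemma sz_le_YT : N <= Y ^ T.+1. Proof. by have [] := ylog_bounds YM_gt1 YM_lt. Qed.
Lemma sz_gt1 : 1 < N. Proof. exact: ltn_trans YM_gt1 YM_lt. Qed.
Lemma Yexp_lt i : i <= ydeg.+1 -> Y ^ i < N.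
Proof. by move=> h; apply: leq_ltn_trans YT_lt; rewrite leq_pexp2l ?YM_gt0 //; have := TM_gt; lia. Qed.
Lemma Texp_le i : i <= ydeg.+1 -> T ^ i < N.
Proof. by move=> h; apply: leq_ltn_trans (Yexp_lt h); case: i {h} => // i; rewrite leq_exp2r // TM_le. Qed.
Lemma ydeg_ge : 64 <= ydeg. Proof. by rewrite /ydeg -lock. Qed.

Lemma log_pow_le L : 24 <= L -> (1168 * L.+1) ^ 4 <= 2 ^ (3 * L).
Proof.
elim: L => // L IH hL; have [h|h] := leqP 24 L; last first.
  have -> : L = 23 by lia.
  apply: (@leq_trans (2 ^ (16 * 4))); last by rewrite leq_exp2l.
  by rewrite expnM leq_exp2r // (expnD 2 11 5) leq_mul.
have {}IH := IH h; rewrite [3 * _]mulnS expnD; apply: (@leq_trans (2 ^ 3 * (1168 * L.+1) ^ 4)); last first.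
  by rewrite leq_mul2l IH orbT.
rewrite !expnMn [2 ^ 3 * _]mulnCA leq_mul2l; apply/orP; right.
have h2 : L.+2 ^ 2 <= 2 * L.+1 ^ 2 by rewrite -!mulnn; nia.
rewrite (_ : 4 = 2 * 2) // !expnM; apply: (@leq_trans ((2 * L.+1 ^ 2) ^ 2)); first by rewrite leq_exp2r.
by rewrite expnMn leq_mul2r orbC.
Qed.

(** T^12 <= Y bounds T^3 by the fourth root of Y, and [log_pow_le] bounds the logarithm times 1168
    by Y^(3/4); the two are combined after raising to the fourth power. *)
Lemma log_YM_le : exists L, Y < 2 ^ L /\ L * T ^ 3 * 1168 <= Y.
Proof.
have Y0 := YM_gt0; set L := trunc_log 2 Y.
have h1 : 2 ^ L <= Y by apply: trunc_logP.
have h2 : Y < 2 ^ L.+1 by apply: trunc_log_ltn.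
have hL : 24 <= L by apply: trunc_log_max => //; exact: YM_ge.
exists L.+1; split=> //; rewrite leqNgt; apply/negP => h.
have h3 : Y ^ 4 < (L.+1 * T ^ 3 * 1168) ^ 4 by rewrite ltn_exp2r.
have h4 : (L.+1 * T ^ 3 * 1168) ^ 4 = (1168 * L.+1) ^ 4 * T ^ 12.
  by rewrite -mulnA [T ^ 3 * _]mulnC mulnA [L.+1 * _]mulnC expnMn -expnM.
have h5 : (1168 * L.+1) ^ 4 * T ^ 12 <= Y ^ 3 * Y.
  apply: leq_mul TM_le_YM12; apply: (leq_trans (log_pow_le hL)).
  by rewrite [3 * L]mulnC expnM leq_exp2r.
by move: h3; rewrite h4 ltnNge -expnSr in h5 *; rewrite h5.
Qed.

(** N <= Y^(T+1) < 2^(L (T+1)), so an exponent of order L T^3 is compared with Y / 16. The square of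
    T is called for by products of the pairwise differences of T numbers, in [hashr_exists]. *)
Lemma sz_exp_lt : N ^ (8 * T ^ 2 + 8) < 2 ^ (Y %/ 16).
Proof.
have [L [h1 h2]] := log_YM_le; have T0 := TM_gt0.
set m := 8 * T ^ 2 + 8.
have m0 : 0 < m by rewrite /m addn_gt0 orbT.
have h3 : N ^ m <= Y ^ (T.+1 * m) by rewrite expnM leq_exp2r ?sz_le_YT.
have h4 : Y ^ (T.+1 * m) < (2 ^ L) ^ (T.+1 * m) by rewrite ltn_exp2r ?muln_gt0.
apply: (leq_ltn_trans h3); apply: (leq_trans h4); rewrite -expnM leq_exp2l //.
rewrite leq_divRL //; apply: leq_trans h2; rewrite -!mulnA leq_mul2l; apply/orP; right.
have hm : m <= 16 * (T * T) by rewrite /m -mulnn; nia.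
apply: (@leq_trans ((2 * T) * (16 * (T * T) * 16))); last by lia.
by apply: leq_mul; [lia | rewrite leq_mul2r hm orbT].
Qed.

Lemma sz_exp_lt_lin : N ^ (8 * T + 8) < 2 ^ (Y %/ 16).
Proof.
apply: leq_ltn_trans sz_exp_lt; rewrite leq_pexp2l ?(ltnW sz_gt1) // leq_add2r leq_mul2l /=.
by rewrite -mulnn leq_pmull // TM_gt0.
Qed.

End Good.

(** Makes being a power of y first-order without exponentiation; for this reason digit bases are
    prime. *)
Lemma prime_powP y z : prime y -> 0 < z ->
  (forall d, d %| z -> d = 1 \/ y %| d) <-> exists k, z = y ^ k.
Proof.
move=> py z0; split=> [h|[k ->] d /(dvdn_pfactor _ _ py)[[|m] _ ->]]; last 2 first.
- by left.
- by right; rewrite expnS dvdn_mulr.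
have [m cm ez] := pfactor_coprime py z0; exists (logn y z).
have [|m1|ym] := h m; first by rewrite ez dvdn_mulr.
  by rewrite {1}ez m1 mul1n.
by move: cm; rewrite prime_coprime // ym.
Qed.

Definition ispow M y z := 0 < z /\ forall d, d < sz M -> d %| z -> d = 1 \/ y %| d.
Definition istop M y z := ispow M y z /\ ~ exists2 w, w < sz M & z * y = w.
(** The digits of x below the power z are 0, 1, 2, ... in base y. Looking up a digit of x therefore
    converts between a power y^i and its exponent i, although exponentiation is not a basic
    relation. *)
Definition isseq M y z x := x %% y = 0 /\
  forall w, w < sz M -> ispow M y w -> w * y < z -> (x %/ (w * y)) %% y = ((x %/ w) %% y).+1.
(** Reads the number of digits off the top digit of the sequence 0, 1, 2, .... The digits only fit
    if their number is at most y, which [lgrelP] records. *)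
Definition lgrel M y t := exists2 z, z < sz M & exists2 x, x < sz M &
  istop M y z /\ (isseq M y z x /\ ((x %/ (z %/ y)) %% y).+1 = t).

Lemma ispowP M y z : prime y -> z < sz M -> ispow M y z <-> exists k, z = y ^ k.
Proof.
move=> py hz; split=> [[z0 h]|h].
  apply/(prime_powP py z0) => d hd; apply: h => //.
  by apply: leq_ltn_trans hz; apply: dvdn_leq.
have z0 : 0 < z by case: h => k ->; rewrite expn_gt0 prime_gt0.
by split=> // d _; move/(prime_powP py z0): h; apply.
Qed.

Lemma istopP M y z : prime y -> y < sz M -> z < sz M -> istop M y z <-> z = y ^ ylog (sz M) y.
Proof.
move=> py hy hz; have y1 := prime_gt1 py; have [t0 h1 h2] := ylog_bounds y1 hy.
rewrite /istop ispowP //; split=> [[[k ez] h]|ez].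
  rewrite ez in hz h *; congr (y ^ _).
  have hk : sz M <= y ^ k.+1.
    by rewrite leqNgt; apply/negP => hk; apply: h; exists (y ^ k.+1); rewrite // expnSr.
  have : k < (ylog (sz M) y).+1 by rewrite -(ltn_exp2l _ _ y1); apply: leq_trans h2.
  have : ylog (sz M) y < k.+1 by rewrite -(ltn_exp2l _ _ y1); apply: leq_trans hk.
  by lia.
split; first by exists (ylog (sz M) y).
by move=> [w hw]; rewrite ez -expnSr; lia.
Qed.

Lemma isseq_digit M y x : prime y -> y < sz M -> isseq M y (y ^ ylog (sz M) y) x ->
  forall i, i < ylog (sz M) y -> (x %/ y ^ i) %% y = i.
Proof.
move=> py hy [h0 h1]; have y1 := prime_gt1 py; have [t0 h2 h3] := ylog_bounds y1 hy.
elim=> [|i IH] hi; first by rewrite divn1.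
rewrite expnSr h1 ?IH //; try lia.
- by apply: leq_ltn_trans h2; rewrite leq_exp2l //; lia.
- apply/ispowP => //; last by exists i.
  by apply: leq_ltn_trans h2; rewrite leq_exp2l //; lia.
- by rewrite -expnSr ltn_exp2l.
Qed.

Definition code y t (s : nat -> nat) := \sum_(j < t) s j * y ^ j.

Lemma code_lt y t s : 0 < y -> (forall j, j < t -> s j < y) -> code y t s < y ^ t.
Proof.
move=> y0 h; rewrite /code; elim: t h => [|t IH] h; first by rewrite big_ord0.
rewrite big_ord_recr /= expnS; have := IH (fun j hj => h j (leqW hj)); have := h t (ltnSn t).
by move: (\sum_(j < t) _) (y ^ t) => a b; nia.
Qed.

Lemma code_digit y t s i : 0 < y -> (forall j, j < t -> s j < y) -> i < t ->
  (code y t s %/ y ^ i) %% y = s i.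
Proof.
move=> y0 h hi; rewrite /code.
have -> : \sum_(j < t) s j * y ^ j =
   (\sum_(j < t - i.+1) s (j + i.+1) * y ^ j * y + s i) * y ^ i + code y i s.
  rewrite /code -(big_mkord xpredT (fun j => s j * y ^ j)) (big_cat_nat (n := i)) //=; last by lia.
  rewrite addnC big_mkord; congr (_ + _); rewrite big_ltn // addnC mulnDl; congr (_ + _).
  rewrite -{1}[i.+1]add0n big_addn big_mkord big_distrl /=; apply: eq_bigr => j _.
  by rewrite expnD expnS; lia.
rewrite divnMDl ?expn_gt0 ?y0 // divn_small ?addn0; last first.
  by apply: code_lt => // j hj; apply: h; lia.
by rewrite -big_distrl /= modnMDl modn_small // h.
Qed.

Lemma isseq_code M y : prime y -> y < sz M -> ylog (sz M) y <= y ->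
  isseq M y (y ^ ylog (sz M) y) (code y (ylog (sz M) y) id).
Proof.
move=> py hy ht; have y1 := prime_gt1 py; have [t0 h2 h3] := ylog_bounds y1 hy.
have y0 : 0 < y by lia.
have hd i : i < ylog (sz M) y -> (code y (ylog (sz M) y) id %/ y ^ i) %% y = i.
  by move=> hi; rewrite code_digit // => j hj; lia.
split; first by have := hd 0 t0; rewrite divn1.
move=> w hw /(ispowP py hw)[k ->]; rewrite -expnSr => /[dup]; rewrite ltn_exp2l // => hk _.
by rewrite !hd //; lia.
Qed.

Lemma lgrelP M y t : prime y -> y < sz M ->
  lgrel M y t <-> t = ylog (sz M) y /\ ylog (sz M) y <= y.
Proof.
move=> py hy; have y1 := prime_gt1 py; have [t0 h2 h3] := ylog_bounds y1 hy.
have e1 : y ^ ylog (sz M) y %/ y = y ^ (ylog (sz M) y).-1.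
  by rewrite -{1}(prednK t0) expnS mulKn //; lia.
split.
  move=> [z hz [x hx [/(istopP py hy hz) -> [hs <-]]]].
  have hd := isseq_digit py hy hs; rewrite e1 hd ?prednK // ?leqnn //.
  split=> //; have hp : (ylog (sz M) y).-1 < ylog (sz M) y by lia.
  by have := ltn_pmod (x %/ y ^ (ylog (sz M) y).-1) (prime_gt0 py); rewrite hd //; lia.
move=> [-> ht]; exists (y ^ ylog (sz M) y) => //; exists (code y (ylog (sz M) y) id).
  by apply: ltn_trans h2; apply: code_lt; lia.
split; first exact/istopP.
split; first exact: isseq_code.
by rewrite e1 (isseq_digit py hy (isseq_code py hy ht)) prednK.
Qed.

Lemma d_ispow G f g : dval G f -> dval G g -> dpred G (fun M e => ispow M (f M e) (g M e)).
Proof. by move=> hf hg; rewrite /ispow; dp. Qed.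

Ltac dhook ::=
  first [ simple apply dval_mod | simple apply dval_div | simple apply dval_sub
        | simple apply d_prime | simple apply d_dvd | simple apply d_ispow ].

Lemma d_isseq G f g h : dval G f -> dval G g -> dval G h ->
  dpred G (fun M e => isseq M (f M e) (g M e) (h M e)).
Proof. by move=> hf hg hh; rewrite /isseq; dp. Qed.

Lemma d_lgrel G f g : dval G f -> dval G g -> dpred G (fun M e => lgrel M (f M e) (g M e)).
Proof.
move=> hf hg; rewrite /lgrel /istop; apply: d_ex; apply: d_ex; apply: d_and; first dp.
by apply: d_and; [apply: d_isseq; dp | dp].
Qed.

Lemma dfun_expc G f k : dfun G f -> dfun G (fun M e => f M e ^ k).
Proof.
move=> hf; elim: k => [|k IH]; first exact: dfun_const.
by apply: (dfun_ext (g := fun M e => f M e * f M e ^ k)); [move=> *; rewrite expnS|apply: dfun_mul].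
Qed.

Lemma goodM_gt M c : goodM M -> c <= 24 -> c < sz M.
Proof.
move=> hM hc; apply: leq_ltn_trans (YM_lt hM); apply: leq_trans (YM_ge hM).
by apply: leq_trans hc _; apply: ltnW; apply: ltn_expl.
Qed.

Lemma dval_YM : dval goodM (fun M _ => YM M).
Proof.
apply: (@dval_ext _ _ (fun M e => mu (sz M) (fun y => prime y /\ (ymin <= y /\
   exists2 t, t < sz M & lgrel M y t /\ (ydeg < t /\ (t ^ 12 <= y /\ y <= t ^ ydeg)))))).
  move=> M e hM he; apply: eq_mu => y hy; rewrite /valid_base; split.
    move=> /and5P[py h1 h2 h3 h4]; split=> //; split=> //; exists (ylog (sz M) y).
      apply: leq_ltn_trans hy; apply: leq_trans h3; rewrite -{1}(expn1 (ylog _ _)) leq_pexp2l //.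
      exact: leq_ltn_trans h2.
    rewrite lgrelP //; split; last by rewrite h2.
    split=> //; apply: leq_trans h3; rewrite -{1}(expn1 (ylog _ _)) leq_pexp2l //.
    exact: leq_ltn_trans h2.
  move=> [py [h1 [t ht [/(lgrelP _ py hy)[-> _] [h2 [h3 h4]]]]]].
  by apply/and5P.
apply: dval_mu; apply: d_and; first dp; apply: d_and; first dp.
apply: d_ex; apply: d_and; first by apply: d_lgrel; dp.
apply: d_and; first dp.
by apply: d_and; [apply: d_le | apply: d_le2]; try apply: dfun_expc; dp.
Qed.

Lemma dval_TM : dval goodM (fun M _ => TM M).
Proof.
apply: (@dval_ext _ _ (fun M e => mu (sz M) (fun t => lgrel M (YM M) t))).
  move=> M e hM he; symmetry; have hT : TM M < sz M.
    by apply: leq_ltn_trans (YM_lt hM); apply: TM_le.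
  have h := fun t => @lgrelP M (YM M) t (YM_prime hM) (YM_lt hM).
  by apply: mu_eq => // [|y _]; rewrite h; [split=> //; exact: TM_le|case].
by apply: dval_mu; apply: d_lgrel; [exact: dval_YM|dp].
Qed.

Definition X0 M := mu (sz M) (fun x => isseq M (YM M) (YM M ^ TM M) x).

Lemma X0_digit M i : goodM M -> i < TM M -> (X0 M %/ YM M ^ i) %% YM M = i.
Proof.
move=> hM hi; apply: (isseq_digit (YM_prime hM) (YM_lt hM)) hi.
suff [] : [/\ X0 M < sz M, isseq M (YM M) (YM M ^ TM M) (X0 M) &
  forall x, isseq M (YM M) (YM M ^ TM M) x -> X0 M <= x] by [].
apply: muP; exists (code (YM M) (TM M) id).
  apply: ltn_trans (YT_lt hM); apply: code_lt; first exact: YM_gt0.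
  by move=> j hj; apply: leq_trans hj (TM_le hM).
apply: isseq_code; [exact: YM_prime|exact: YM_lt|exact: TM_le].
Qed.

Lemma dval_YT : dval goodM (fun M _ => YM M ^ TM M).
Proof.
apply: (@dval_ext _ _ (fun M e => mu (sz M) (fun z => istop M (YM M) z))).
  move=> M e hM he; symmetry; have h := YT_lt hM.
  have hh := fun t ht => @istopP M (YM M) t (YM_prime hM) (YM_lt hM) ht.
  by apply: mu_eq => // [|y hy]; rewrite hh.
by have hY := dval_YM; rewrite /istop; dp.
Qed.

Lemma dval_X0 : dval goodM (fun M _ => X0 M).
Proof.
by apply: dval_mu; apply: d_isseq; [exact: dval_YM|exact: dval_YT|dp].
Qed.

Definition pwr M i := mu (sz M) (fun z => i < TM M /\ (ispow M (YM M) z /\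
  (z < YM M ^ TM M /\ (X0 M %/ z) %% YM M = i))).

Lemma pwrE M i : goodM M -> i < TM M -> pwr M i = YM M ^ i.
Proof.
move=> hM hi; have Y1 := YM_gt1 hM.
have hlt : YM M ^ i < YM M ^ TM M by rewrite ltn_exp2l.
apply: mu_eq; first exact: ltn_trans hlt (YT_lt hM).
  rewrite hi hlt X0_digit //; split=> //; split=> //.
  by apply/ispowP; [exact: YM_prime|exact: ltn_trans hlt (YT_lt hM)|exists i].
move=> z hz [_ [/(ispowP (YM_prime hM) hz)[k ->]]]; rewrite ltn_exp2l // => -[hk].
by rewrite X0_digit // => ->.
Qed.

Lemma dval_pwr f : dval goodM f -> dval goodM (fun M e => pwr M (f M e)).
Proof.
by move=> hf; have h1 := dval_YM; have h2 := dval_TM; have h3 := dval_YT; have h4 := dval_X0;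
  rewrite /pwr; dp.
Qed.

Definition dig M x i := cif (i < TM M) ((x %/ pwr M i) %% YM M) 0.

Lemma digE M x i : goodM M -> i < TM M -> dig M x i = (x %/ YM M ^ i) %% YM M.
Proof. by move=> hM hi; rewrite /dig cifT // pwrE. Qed.

Lemma dig_lt M x i : goodM M -> dig M x i < YM M.
Proof.
move=> hM; rewrite /dig /cif; case: ifP => _; last exact: YM_gt0.
by rewrite ltn_pmod // YM_gt0.
Qed.

Lemma dval_dig f g : dval goodM f -> dval goodM g -> dval goodM (fun M e => dig M (f M e) (g M e)).
Proof.
move=> hf hg; have hY := dval_YM; have hT := dval_TM; have hp := dval_pwr hg; rewrite /dig; dp.
Qed.

Lemma dig_code M (s : nat -> nat) : goodM M -> (forall j, j < TM M -> s j < YM M) ->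
  exists2 x, x < sz M & forall j, j < TM M -> dig M x j = s j.
Proof.
move=> hM hs; have Y0 := YM_gt0 hM.
exists (code (YM M) (TM M) s).
  by apply: ltn_trans (YT_lt hM); apply: code_lt.
by move=> j hj; rewrite digE // code_digit.
Qed.

Lemma dval_c c : c <= 24 -> dval goodM (fun _ _ => c).
Proof. by move=> hc; apply: dval_const => M hM; apply: goodM_gt. Qed.

Ltac dhook ::=
  first [ simple apply dval_mod | simple apply dval_div | simple apply dval_sub
        | simple apply dval_YM | simple apply dval_TM | simple apply dval_dig
        | solve [simple apply dval_c; reflexivity]
        | simple apply d_prime | simple apply d_dvd ].

(** * Iterating a definable step on small states *)

Fixpoint iter_from (f : nat -> nat -> nat) i m a :=
  if m is m'.+1 then f (i + m') (iter_from f i m' a) else a.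

Lemma iter_from_add f i m l a :
  iter_from f i (m + l) a = iter_from f (i + m) l (iter_from f i m a).
Proof. by elim: l => [|l IH]; rewrite ?addn0 // addnS /= IH addnA. Qed.

Lemma eq_iter_from f g i j m a : (forall l x, l < m -> f (i + l) x = g (j + l) x) ->
  iter_from f i m a = iter_from g j m a.
Proof.
elim: m => //= m IH h; rewrite IH ?h // => l x hl.
by apply: h; lia.
Qed.

Lemma iter_from_mul f i t m a :
  iter_from (fun j a => iter_from f (i + j * m) m a) 0 t a = iter_from f i (t * m) a.
Proof. by elim: t => //= t IH; rewrite IH add0n mulSnr iter_from_add. Qed.

(* [T^d] steps: a guessed digit sequence holds the states after each of [T] blocks of [T^(d-1)] steps. *)
Fixpoint run_levels M (f : nat -> nat -> nat) d i a :=
  if d is d'.+1 then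
    iter_from (fun j a => run_levels M f d' (tr M (i + j * TM M ^ d')) a) 0 (TM M) a
  else f i a.

Lemma run_levelsE M f d i a : i + TM M ^ d <= sz M -> 
  run_levels M f d i a = iter_from f i (TM M ^ d) a.
Proof.
elim: d i a => [|d IH] i a h /=; first by rewrite addn0.
rewrite expnS -iter_from_mul; apply: eq_iter_from => j x hj; rewrite add0n.
have hl : i + j * TM M ^ d + TM M ^ d <= sz M.
  by apply: leq_trans h; rewrite expnS -addnA -mulSnr leq_add2l leq_mul2r hj orbT.
rewrite trE ?IH //; apply: leq_trans hl; rewrite -ltn_subLR // subnn expn_gt0.
by case: (TM M) hj.
Qed.

Section Run.
Variable f : model -> env -> nat -> nat -> nat.
Hypothesis hf : forall r g h, dval goodM g -> dval goodM h ->
  dval goodM (fun M e => f M (fun i => e (r i)) (g M e) (h M e)).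
Hypothesis fY : forall M e i a, goodM M -> f M e i a < YM M.

Lemma run_levels_lt M e d i a : goodM M -> run_levels M (f M e) d i a < YM M.
Proof.
move=> hM; elim: d i a => [|d IH] i a /=; first exact: fY.
by rewrite -(prednK (TM_gt0 hM)) /= IH.
Qed.

(** Induction on the constant d; every level costs one more quantified digit sequence, whose entries
    must be below [YM M]. The step function is assumed definable after any renaming [r] because it
    is used below quantifiers. *)
Lemma dval_run_levels d r g h : dval goodM g -> dval goodM h ->
  dval goodM (fun M e => run_levels M (f M (fun i => e (r i))) d (g M e) (h M e)).
Proof.
elim: d r g h => [|d IH] r g h hg hh; first exact: hf.
have hTd : dfun goodM (fun M _ => TM M ^ d) by apply: dfun_expc; case: dval_TM.
apply: (@dval_ext _ _ (fun M e => mu (sz M) (fun b => exists2 x, x < sz M &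
  dig M x 0 = run_levels M (f M (fun i => e (r i))) d (tr M (g M e + 0 * TM M ^ d)) (h M e) /\
  ((forall j, j < sz M -> j.+1 < TM M -> dig M x (tr M j.+1) =
    run_levels M (f M (fun i => e (r i))) d (tr M (g M e + j.+1 * TM M ^ d)) (dig M x j)) /\
  b = dig M x (TM M - 1))))).
  move=> M e hM he; symmetry; have T0 := TM_gt0 hM.
  rewrite -[run_levels _ _ d.+1 _ _]/(iter_from _ _ _ _).
  set F := fun j a => run_levels M (f M (fun i => e (r i))) d (tr M (g M e + j * TM M ^ d)) a.
  have FY j a : F j a < YM M by apply: run_levels_lt.
  set s := fun j => iter_from F 0 j.+1 (h M e).
  have sY j : s j < YM M by rewrite /s /= FY.
  have Ts : TM M < sz M := leq_ltn_trans (TM_le hM) (YM_lt hM).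
  apply: mu_eq.
  - rewrite -(prednK T0); apply: ltn_trans (YM_lt hM); exact: sY.
  - have [x hx hd] := dig_code hM (fun j (_ : j < TM M) => sY j); exists x => //.
    rewrite !hd //; last by lia.
    split=> //; split; last by rewrite /s subn1 prednK.
    by move=> j hj hj1; rewrite trE ?(ltn_trans hj1 Ts) // !hd //; lia.
  - move=> b hb [x hx [h0 [h1 ->]]].
    have hd j : j < TM M -> dig M x j = s j.
      elim: j => [|j IHj] hj; first by rewrite h0.
      by have := h1 j; rewrite trE ?(ltn_trans hj Ts) // => ->; rewrite ?IHj //; lia.
    by rewrite hd /s ?subn1 ?prednK //; lia.
by dp.
Qed.

End Run.

(** Since Y <= T^[ydeg], the [ydeg] levels pass every i < Y, and the later steps keep the state. The
    outer reduction modulo [YM M] makes the state a digit for arbitrary arguments. *)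
Definition Msum M (g : nat -> nat) q :=
  run_levels M (fun i a => cif (i < YM M) (tr M (a %% q + g i %% q) %% q %% YM M) (a %% YM M)) ydeg 0 0.
Definition Mprod M (g : nat -> nat) q :=
  run_levels M (fun i a => cif (i < YM M) (tr M ((a %% q) * (g i %% q)) %% q %% YM M) (a %% YM M)) ydeg 0 1.

Lemma dval_Msum g q : 
  (forall r h, dval goodM h -> dval goodM (fun M e => g M (fun i => e (r i)) (h M e))) ->
  dval goodM q -> dval goodM (fun M e => Msum M (g M e) (q M e)).
Proof.
move=> hg hq; rewrite /Msum; apply: (@dval_run_levels
 (fun M e i a => cif (i < YM M) (tr M (a %% q M e + g M e i %% q M e) %% q M e %% YM M) (a %% YM M))
 _ _ ydeg id); [by dp| |by dp|by dp].
by move=> M e i a hM; rewrite /cif; case: ifP => _; rewrite ltn_pmod // YM_gt0.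
Qed.

Lemma dval_Mprod g q : 
  (forall r h, dval goodM h -> dval goodM (fun M e => g M (fun i => e (r i)) (h M e))) ->
  dval goodM q -> dval goodM (fun M e => Mprod M (g M e) (q M e)).
Proof.
move=> hg hq; rewrite /Mprod; apply: (@dval_run_levels
 (fun M e i a => cif (i < YM M) (tr M ((a %% q M e) * (g M e i %% q M e)) %% q M e %% YM M) (a %% YM M))
 _ _ ydeg id); [by dp| |by dp|by dp].
by move=> M e i a hM; rewrite /cif; case: ifP => _; rewrite ltn_pmod // YM_gt0.
Qed.

Lemma MsumE M (g : nat -> nat) q : goodM M -> 0 < q <= YM M -> Msum M g q = (\sum_(i < YM M) g i) %% q.
Proof.
move=> hM /andP[q0 qY]; rewrite /Msum run_levelsE ?add0n; last first.
  exact: ltnW (Texp_le hM (leqnSn _)).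
have Ys : YM M ^ 2 < sz M by apply: Yexp_lt => //; have := ydeg_ge; lia.
suff h m : iter_from (fun i a => cif (i < YM M)
    (tr M (a %% q + g i %% q) %% q %% YM M) (a %% YM M)) 0 m 0 = (\sum_(i < minn m (YM M)) g i) %% q.
  by rewrite h (minn_idPr (YM_le_TM hM)).
elim: m => [|m IH]; first by rewrite min0n big_ord0 mod0n.
rewrite /= IH add0n; set S := \sum_(i < minn m _) g i.
have Sq : S %% q < q by rewrite ltn_pmod.
have [hm|hm] := ltnP m (YM M); last first.
  rewrite cifF; last by lia.
  rewrite (minn_idPr (leqW hm)) /S (minn_idPr hm) modn_small //.
  by apply: leq_trans qY; rewrite ltn_pmod.
rewrite cifT // (minn_idPl hm) big_ord_recr /= trE; last first.
  rewrite modn_mod; have : g m %% q < q by rewrite ltn_pmod.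
  by move: Ys; rewrite -mulnn; have := YM_gt1 hM; nia.
rewrite modn_mod modnDm /S (minn_idPl (ltnW hm)) modn_small //.
by apply: leq_trans qY; rewrite ltn_pmod.
Qed.

Lemma MprodE M (g : nat -> nat) q : goodM M -> 1 < q <= YM M -> Mprod M g q = (\prod_(i < YM M) g i) %% q.
Proof.
move=> hM /andP[q1 qY]; have q0 : 0 < q by lia.
rewrite /Mprod run_levelsE ?add0n; last first.
  exact: ltnW (Texp_le hM (leqnSn _)).
have Ys : YM M ^ 2 < sz M by apply: Yexp_lt => //; have := ydeg_ge; lia.
suff h m : iter_from (fun i a => cif (i < YM M)
    (tr M ((a %% q) * (g i %% q)) %% q %% YM M) (a %% YM M)) 0 m 1 = (\prod_(i < minn m (YM M)) g i) %% q.
  by rewrite h (minn_idPr (YM_le_TM hM)).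
elim: m => [|m IH]; first by rewrite min0n big_ord0 modn_small.
rewrite /= IH add0n; set S := \prod_(i < minn m _) g i.
have Sq : S %% q < q by rewrite ltn_pmod.
have [hm|hm] := ltnP m (YM M); last first.
  rewrite cifF; last by lia.
  rewrite (minn_idPr (leqW hm)) /S (minn_idPr hm) modn_small //.
  by apply: leq_trans qY; rewrite ltn_pmod.
rewrite cifT // (minn_idPl hm) big_ord_recr /= trE; last first.
  rewrite modn_mod; have : g m %% q < q by rewrite ltn_pmod.
  by move: Ys; rewrite -mulnn; have := YM_gt1 hM; nia.
rewrite modn_mod modnMm /S (minn_idPl (ltnW hm)) modn_small //.
by apply: leq_trans qY; rewrite ltn_pmod.
Qed.

(** An exact sum, recovered by [eq_mod_small] from its residues modulo all q < Y. *)
Definition Bsum M (g : nat -> nat) :=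
  mu (sz M) (fun S => forall q, q < sz M -> 0 < q -> q < YM M -> S %% q = Msum M g q).

Lemma dval_Bsum g : 
  (forall r h, dval goodM h -> dval goodM (fun M e => g M (fun i => e (r i)) (h M e))) ->
  dval goodM (fun M e => Bsum M (g M e)).
Proof.
move=> hg; rewrite /Bsum; apply: dval_mu; apply: d_all; apply: d_imp; first dp.
apply: d_imp; first dp; apply: d_eq; first dp.
by apply: dval_Msum => [r h hh|]; dp.
Qed.

Lemma BsumE M (g : nat -> nat) : goodM M -> \sum_(i < YM M) g i < sz M -> Bsum M g = \sum_(i < YM M) g i.
Proof.
move=> hM hS; apply: mu_eq => //.
  by move=> q _ q0 qY; rewrite MsumE // q0 ltnW.
move=> S hS' h; have hb : sz M <= 2 ^ (YM M %/ 16).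
  apply: ltnW; apply: leq_ltn_trans (sz_exp_lt_lin hM).
  by rewrite -{1}(expn1 (sz M)) leq_pexp2l //; have := sz_gt1 hM; lia.
apply: (@eq_mod_small (YM M)).
- by apply: leq_trans (YM_ge hM); rewrite leq_exp2l.
- exact: leq_trans hS' hb.
- exact: leq_trans hS hb.
move=> q /andP[q0 qY]; have qN := ltn_trans qY (YM_lt hM).
by rewrite h // MsumE // q0 ltnW.
Qed.

Ltac dhook ::=
  first [ simple apply dval_mod | simple apply dval_div | simple apply dval_sub
        | simple apply dval_YM | simple apply dval_TM | simple apply dval_dig
        | solve [simple apply dval_c; reflexivity]
        | simple apply dval_Msum | simple apply dval_Mprod | simple apply dval_Bsum
        | simple apply d_prime | simple apply d_dvd ].

(** * Determinants modulo small primes *)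

Section Cert.
Local Open Scope ring_scope.
Variable F : fieldType.

Lemma det_cert n (C V : 'M[F]_n) (s : 'S_n) (rho : 'I_n -> F) :
  (forall i, V i i = 1) -> (forall i j : 'I_n, (j < i)%N -> V i j = 0) ->
  (forall l i : 'I_n, (l < i)%N -> \sum_j C l (s j) * V j i = 0) ->
  (forall i, \sum_j C i (s j) * V j i = rho i) ->
  (\det C) ^+ 2 = (\prod_i rho i) ^+ 2.
Proof.
move=> V1 V0 L0 L1; set L := col_perm s C *m V.
have LE l i : L l i = \sum_j C l (s j) * V j i.
  by rewrite mxE; apply: eq_bigr => j _; rewrite mxE.
have dL : \det L = \prod_i rho i.
  rewrite det_trig; first by apply: eq_bigr => i _; rewrite LE L1.
  by apply/is_trig_mxP => i j hij; rewrite LE L0.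
have dV : \det V = 1.
  rewrite -det_tr det_trig; first by rewrite big1 // => i _; rewrite mxE V1.
  by apply/is_trig_mxP => i j hij; rewrite mxE V0.
by rewrite -dL /L det_mulmx dV mulr1 col_permE det_mulmx det_perm exprMn sqrr_sign mulr1.
Qed.

(** Descending induction on the row: row i of [U *m V = 1] expresses row i of V by the rows below
    it. *)
Lemma inv_unit_upper n (U V : 'M[F]_n) :
  (forall i j : 'I_n, (j <= i)%N -> U i j = (i == j)%:R) -> U *m V = 1%:M ->
  forall i j : 'I_n, (j <= i)%N -> V i j = (i == j)%:R.
Proof.
move=> hU UV i; move: {2}(n - i)%N (leqnn (n - i)) => m.
elim: m i => [|m IH] i; first by have := ltn_ord i; lia.
move=> hm j ji; have := congr1 (fun A : 'M_n => A i j) UV; rewrite !mxE (bigD1 i) //=.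
rewrite hU // eqxx mul1r big1 ?addr0 // => k ki.
have [h|h] := leqP k i; first by rewrite hU // eq_sym (negbTE ki) mul0r.
rewrite IH; [|lia|lia].
by rewrite (_ : (k == j) = false) ?mulr0 //; apply/eqP => e; move: h; rewrite e; lia.
Qed.

(** The decomposition P C^T = L U transposes to C P^T (L^T)^-1 = U^T, so V is the inverse of L^T.
    Working with the transpose turns the row pivoting of the algorithm into a column permutation. *)
Lemma lup_cert n (C : 'M[F]_n.+1) : exists (s : 'S_n.+1) (V : 'M[F]_n.+1),
  [/\ forall i, V i i = 1, forall i j : 'I_n.+1, (j < i)%N -> V i j = 0 &
      forall l i : 'I_n.+1, (l < i)%N -> \sum_j C l (s j) * V j i = 0].
Proof.
have := cormen_lup_perm C^T; have := cormen_lup_correct C^T.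
have := cormen_lup_lower C^T; have := cormen_lup_upper C^T.
case: (cormen_lup C^T) => [[P L] U] /= hU hL PLU /is_perm_mxP[s Ps].
have hL' (i j : 'I_n.+1) : (j <= i)%N -> L^T i j = (i == j)%:R.
  by move=> ji; rewrite mxE hL // eq_sym.
have uL : L^T \in unitmx.
  rewrite unitmxE det_tr det_trig; last first.
    by apply/is_trig_mxP => i j ij; rewrite hL ?(ltnW ij) // (_ : i == j = false) //; apply/eqP=> e; move: ij; rewrite e ltnn.
  by rewrite big1 ?unitr1 // => i _; rewrite hL // eqxx.
have hV := inv_unit_upper hL' (mulmxV uL).
exists s, (invmx L^T); split.
- by move=> i; rewrite hV // eqxx.
- by move=> i j ji; rewrite hV ?(ltnW ji) // (_ : i == j = false) //; apply/eqP=> e; move: ji; rewrite e ltnn.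
move=> l i li.
have e : col_perm s C *m invmx L^T = U^T.
  rewrite col_permE -tr_perm_mx -Ps -[C]trmxK -trmx_mul.
  by rewrite [P *m C^T]PLU -[L * U]/(L *m U) trmx_mul -mulmxA mulmxV // mulmx1.
have : (col_perm s C *m invmx L^T) l i = U^T l i by rewrite e.
rewrite [U^T _ _]mxE hU // => h; rewrite -[RHS]h mxE; apply: eq_bigr => j _.
by congr (_ * _); rewrite mxE.
Qed.

End Cert.

Lemma Fp_val_lt q (x : 'F_q) : prime q -> (x : nat) < q.
Proof. by move=> pq; rewrite -[X in _ < X](Fp_cast pq) ltn_ord. Qed.

Lemma Fp_natr_val q (x : 'F_q) : ((x : nat)%:R = x)%R.
Proof. exact: natr_Zp. Qed.

Lemma Fp_eq q a b : prime q -> ((a%:R == b%:R :> 'F_q)%R) = (a == b %[mod q]).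
Proof. by move=> pq; rewrite -val_eqE /= !val_Fp_nat. Qed.

Lemma Fp_eq0 q a : prime q -> ((a%:R == 0 :> 'F_q)%R) = (q %| a).
Proof. by move=> pq; rewrite -[0%R]/(0%:R)%R Fp_eq // mod0n. Qed.

Lemma sum_cif (n m : nat) (F : nat -> nat) : n <= m ->
  \sum_(i < m) cif (i < n) (F i) 0 = \sum_(i < n) F i.
Proof.
move=> h; rewrite [RHS](big_ord_widen m F h) [RHS]big_mkcond; apply: eq_bigr => i _.
by case: ifP => hi; [rewrite cifT|rewrite cifF // hi].
Qed.

Lemma prod_cif (n m : nat) (F : nat -> nat) : n <= m ->
  \prod_(i < m) cif (i < n) (F i) 1 = \prod_(i < n) F i.
Proof.
move=> h; rewrite [RHS](big_ord_widen m F h) [RHS]big_mkcond; apply: eq_bigr => i _.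
by case: ifP => hi; [rewrite cifT|rewrite cifF // hi].
Qed.

(* Guess a column permutation [P] of [C] (the digits of [sg]) and, column by column, a unit upper
   triangular [V] such that [C P V] is lower triangular with diagonal [rr]; squaring the determinant
   removes the sign of [P]. *)
Definition row_sum M k (c : nat -> nat -> nat) q l sg x :=
  Msum M (fun j => cif (j < k) (tr M ((c l (dig M sg j) %% q) * dig M x j)) 0) q.
Definition diag_prod M k q rr :=
  Mprod M (fun i => cif (i < k) (tr M (dig M rr i * dig M rr i)) 1) q.

(** The whole matrix V has too many entries for one element. Once [sg] and [rr] are fixed, the
    conditions on V concern one column x at a time, so each column gets its own quantifier. *)
Definition det_certificate M k (c : nat -> nat -> nat) q sg rr :=
  (forall j, j < sz M -> j < k -> dig M sg j < k) /\
  ((forall j, j < sz M -> j < k -> forall j', j' < sz M -> j' < k ->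
     dig M sg j = dig M sg j' -> j = j') /\
  forall i, i < sz M -> i < k -> exists2 x, x < sz M & dig M x i = 1 /\
    ((forall j, j < sz M -> i < j -> j < k -> dig M x j = 0) /\
     forall l, l < sz M -> l <= i ->
       row_sum M k c q l sg x =
       cif (l = i) (dig M rr i %% q) 0)).

Definition detsq M k c q := mu (sz M) (fun D => exists2 sg, sg < sz M & exists2 rr, rr < sz M &
  det_certificate M k c q sg rr /\
  D = diag_prod M k q rr).

Lemma dval_detsq (c : model -> env -> nat -> nat -> nat) k q :
  (forall r g h, dval goodM g -> dval goodM h ->
     dval goodM (fun M e => c M (fun i => e (r i)) (g M e) (h M e))) ->
  dval goodM k -> dval goodM q ->
  dval goodM (fun M e => detsq M (k M e) (c M e) (q M e)).
Proof. by move=> hc hk hq; rewrite /detsq /det_certificate /row_sum /diag_prod; dp. Qed.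

Definition nat_mx (R : nzRingType) k (c : nat -> nat -> nat) : 'M[R]_k :=
  (\matrix_(i, j) (c i j)%:R)%R.

Section DetSq.
Variables (M : model) (k : nat) (c : nat -> nat -> nat) (q : nat).
Hypotheses (hM : goodM M) (pq : prime q) (qY : q < YM M) (k0 : 0 < k) (kT : k <= TM M).

Let Y0 := YM_gt0 hM.
Let kY : k <= YM M. Proof. exact: leq_trans kT (TM_le hM). Qed.
Let kN : k < sz M. Proof. exact: leq_ltn_trans kY (YM_lt hM). Qed.
Let YY : YM M * YM M < sz M.
Proof. by rewrite mulnn; apply: Yexp_lt => //; have := ydeg_ge; lia. Qed.

Lemma Msum_row l sg x : l < k ->
  ((row_sum M k c q l sg x)%:R =
   \sum_(j < k) (c l (dig M sg j))%:R * (dig M x j)%:R :> 'F_q)%R.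
Proof.
move=> lk; rewrite /row_sum MsumE ?prime_gt0 ?(ltnW qY) // Fp_nat_mod //.
rewrite (@sum_cif k _ (fun j => tr M ((c l (dig M sg j) %% q) * dig M x j))) // natr_sum.
apply: eq_bigr => j _; rewrite trE ?natrM ?Fp_nat_mod //.
apply: leq_ltn_trans YY; apply: leq_mul; last by rewrite ltnW // dig_lt.
by apply: leq_trans (ltnW qY); rewrite ltnW // ltn_pmod // prime_gt0.
Qed.

Lemma Mprod_diag rr :
  ((diag_prod M k q rr)%:R = (\prod_(i < k) (dig M rr i)%:R) ^+ 2 :> 'F_q)%R.
Proof.
rewrite /diag_prod MprodE ?prime_gt1 ?(ltnW qY) // Fp_nat_mod //.
rewrite (@prod_cif k _ (fun i => tr M (dig M rr i * dig M rr i))) // natr_prod -prodrXl.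
apply: eq_bigr => j _; rewrite trE ?natrM ?expr2 //.
by apply: leq_ltn_trans YY; apply: leq_mul; rewrite ltnW // dig_lt.
Qed.

Lemma det_certificate_sound sg rr : det_certificate M k c q sg rr ->
  ((\det (nat_mx 'F_q k c)) ^+ 2 = (\prod_(i < k) (dig M rr i)%:R) ^+ 2)%R.
Proof.
move=> [h1 [h2 h3]].
have ltN j : j < k -> j < sz M by move=> h; apply: ltn_trans h kN.
have s_inj : injective (fun j : 'I_k => Ordinal (h1 j (ltN _ (ltn_ord j)) (ltn_ord j))).
  move=> j j' [] e; apply/val_inj.
  exact: (h2 _ (ltN _ (ltn_ord j)) (ltn_ord j) _ (ltN _ (ltn_ord j')) (ltn_ord j') e).
have /choice[x hx] : forall i : 'I_k, exists x, dig M x i = 1 /\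
    ((forall j, j < sz M -> i < j -> j < k -> dig M x j = 0) /\
     forall l, l < sz M -> l <= i ->
       row_sum M k c q l sg x =
       cif (l = i) (dig M rr i %% q) 0).
  by move=> i; have [x _ hx] := h3 i (ltN _ (ltn_ord i)) (ltn_ord i); exists x.
apply: (@det_cert _ _ _ (\matrix_(j, i) (dig M (x i) j)%:R)%R (perm s_inj)).
- by move=> i; rewrite mxE (hx i).1.
- move=> i j ji; rewrite mxE; have [_ [h _]] := hx j.
  by rewrite h // ltN.
- move=> l i li; transitivity (\sum_(j < k) (c l (dig M sg j))%:R * (dig M (x i) j)%:R : 'F_q)%R.
    by apply: eq_bigr => j _; rewrite !mxE permE.
  rewrite -Msum_row ?ltn_ord //; have [_ [_ h]] := hx i.
  rewrite h ?ltN ?ltn_ord ?(ltnW li) // cifF // => e; by move: li; rewrite e ltnn.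
- move=> i; transitivity (\sum_(j < k) (c i (dig M sg j))%:R * (dig M (x i) j)%:R : 'F_q)%R.
    by apply: eq_bigr => j _; rewrite !mxE permE.
  rewrite -Msum_row ?ltn_ord //; have [_ [_ h]] := hx i.
  by rewrite h ?ltN ?ltn_ord // cifT // Fp_nat_mod.
Qed.

Lemma det_certificate_complete : exists2 sg, sg < sz M & exists2 rr, rr < sz M &
  det_certificate M k c q sg rr.
Proof.
have [k' ek] : exists k', k = k'.+1 by exists k.-1; lia.
have [s [V [hV1 hV0 hL]]] : exists (s : 'S_k) (V : 'M['F_q]_k),
  [/\ forall i, V i i = 1%R, forall i j : 'I_k, (j < i)%N -> V i j = 0%R &
      forall l i : 'I_k, (l < i)%N -> (\sum_j nat_mx 'F_q k c l (s j) * V j i = 0)%R].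
  by move: (nat_mx _ _ _); rewrite ek => C; apply: lup_cert.
pose f (g : 'I_k -> nat) (j : nat) := if insub j is Some i then g i else 0.
have fE g (j : 'I_k) : f g j = g j by rewrite /f valK.
have fY g : (forall i, g i < YM M) -> forall j, j < TM M -> f g j < YM M.
  by move=> hg j _; rewrite /f; case: insub.
have vY (x : 'F_q) : (x : nat) < YM M by apply: ltn_trans qY; apply: Fp_val_lt.
have [sg sgN hsg] : exists2 x, x < sz M & forall j, j < TM M -> dig M x j = f (fun j => s j : nat) j.
  by apply: dig_code => //; apply: fY => i; apply: leq_trans kY.
pose Li (i : 'I_k) := (\sum_j nat_mx 'F_q k c i (s j) * V j i)%R.
have [rr rrN hrr] : exists2 x, x < sz M & forall j, j < TM M -> dig M x j = f (fun j => Li j : nat) j.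
  by apply: dig_code => //; apply: fY => i; apply: vY.
have kltT j : j < k -> j < TM M by move=> h; apply: leq_trans kT.
have hsg' (j : 'I_k) : dig M sg j = s j by rewrite hsg ?fE // kltT.
have hrr' (j : 'I_k) : dig M rr j = Li j by rewrite hrr ?fE // kltT.
exists sg => //; exists rr => //; split; [|split].
- by move=> j _ hj; rewrite (hsg' (Ordinal hj)).
- move=> j _ hj j' _ hj'; rewrite (hsg' (Ordinal hj)) (hsg' (Ordinal hj')).
  by move=> /val_inj /perm_inj /(congr1 val).
move=> i _ hi; pose io := Ordinal hi.
have [x xN hx] : exists2 x, x < sz M & forall j, j < TM M -> dig M x j = f (fun j => V j io : nat) j.
  by apply: dig_code => //; apply: fY => j; apply: vY.
have hx' (j : 'I_k) : dig M x j = V j io by rewrite hx ?fE // kltT.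
exists x => //; split; [|split].
- rewrite (hx' io) hV1 -[1%R]/(1%:R)%R val_Fp_nat // modn_small //; exact: prime_gt1.
- by move=> j _ ij jk; rewrite (hx' (Ordinal jk)) hV0.
move=> l _ li; have lk : l < k by lia.
have hlt : row_sum M k c q l sg x < q.
  by rewrite /row_sum MsumE ?prime_gt0 ?(ltnW qY) // ltn_pmod // prime_gt0.
rewrite -[LHS](modn_small hlt) -(val_Fp_nat pq) Msum_row //.
transitivity (((\sum_j nat_mx 'F_q k c (Ordinal lk) (s j) * V j io)%R : 'F_q) : nat).
  by congr (nat_of_ord _); apply: eq_bigr => j _; rewrite mxE hsg' hx' Fp_natr_val.
have [e|ne] := eqVneq l i; last first.
  rewrite cifF; last by apply/eqP.
  by rewrite hL //= ltn_neqAle ne.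
rewrite cifT // (hrr' io) modn_small ?Fp_val_lt // /Li; congr (nat_of_ord _).
by apply: eq_bigr => j _; rewrite !mxE /= e.
Qed.

(** Some certificate exists, and by soundness every accepted one yields the same value, so choosing
    the least is harmless. *)
Lemma detsqP : detsq M k c q < q /\
  ((detsq M k c q)%:R = (\det (nat_mx 'F_q k c)) ^+ 2 :> 'F_q)%R.
Proof.
have [sg sgN [rr rrN hc]] := det_certificate_complete.
have hlt rr' : diag_prod M k q rr' < q.
  by rewrite /diag_prod MprodE ?prime_gt1 ?(ltnW qY) // ltn_pmod // prime_gt0.
have [|_ [sg' _ [rr' _ [hc' e]]] _] := @muP (sz M) (fun D => exists2 sg, sg < sz M & exists2 rr, rr < sz M &
  det_certificate M k c q sg rr /\
  D = diag_prod M k q rr).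
  exists (diag_prod M k q rr).
    by apply: ltn_trans (YM_lt hM); apply: ltn_trans qY.
  by exists sg => //; exists rr.
by rewrite /detsq e Mprod_diag -(det_certificate_sound hc').
Qed.

End DetSq.

(** * Singularity modulo a large prime *)

Lemma det_absz_le n (A : 'M[int]_n) m : (forall i j, `|A i j|%N <= m) ->
  `|(\det A)%R|%N <= n`! * m ^ n.
Proof.
move=> hA; rewrite -lez_nat abszE /determinant.
apply: (le_trans (ler_norm_sum _ _ _)).
apply: (@le_trans _ _ (\sum_(s : 'S_n) Posz (expn m n))%R); last first.
  by rewrite sumr_const card_Sn -mulr_natr PoszM mulrC natz.
apply: ler_sum => s _; rewrite normrM normrX normrN1 expr1n mul1r normr_prod.
apply: (@le_trans _ _ (\prod_(i < n) Posz m)%R).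
  by apply: ler_prod => i _; rewrite normr_ge0 /= -abszE lez_nat.
by rewrite prodr_const card_ord -!natz natrX.
Qed.

Lemma fact_le_exp n : n`! <= n ^ n.
Proof.
rewrite fact_prod; apply: (@leq_trans (\prod_(1 <= i < n.+1) n)).
  rewrite big_nat [X in _ <= X]big_nat; apply: leq_prod => i; lia.
by rewrite prod_nat_const_nat subn1.
Qed.

Lemma primorial_dvd y d : (forall q, prime q -> q < y -> q %| d) -> primorial y %| d.
Proof.
rewrite /primorial; elim: y => [|y IH] h; first by rewrite big_geq // dvd1n.
rewrite big_mkcond big_nat_recr //= -big_mkcond /=; case: ifP => py; last first.
  by rewrite muln1; apply: IH => q pq hq; apply: h => //; lia.
rewrite Gauss_dvd; last first.
  rewrite coprime_sym prime_coprime //; apply/negP; rewrite Euclid_dvd_prod //.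
  rewrite big_has_cond => /hasP[p]; rewrite mem_index_iota => hp /andP[pp].
  by rewrite dvdn_prime2 // => /eqP e; move: hp; rewrite -e ltnn.
have -> : y %| d by apply: h.
by rewrite andbT; apply: IH => q pq hq; apply: h => //; lia.
Qed.

Lemma bigD1_seq_cond (R : Type) (idx : R) (op : Monoid.com_law idx) (I : eqType) (r : seq I)
    (P : pred I) (F : I -> R) j : j \in r -> P j -> uniq r ->
  \big[op/idx]_(i <- r | P i) F i = op (F j) (\big[op/idx]_(i <- r | P i && (i != j)) F i).
Proof. by move=> jr Pj ur; rewrite big_mkcond (bigD1_seq j) //= Pj -big_mkcondl. Qed.

Lemma primorial_split y q : prime q -> q < y ->
  primorial y = q * \prod_(0 <= i < y | prime i && (i != q)) i.
Proof.
move=> pq qy; rewrite /primorial (@bigD1_seq_cond _ _ _ _ _ _ _ q) ?iota_uniq //.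
by rewrite mem_index_iota.
Qed.

Lemma eq_mod_primorial y a b :
  (forall q, prime q -> q < y -> a = b %[mod q]) -> a = b %[mod primorial y].
Proof.
move=> h; wlog hab : a b h / b <= a.
  move=> H; case: (leqP b a) => [|/ltnW] hab; first exact: H.
  by symmetry; apply: H => // q pq qy; symmetry; apply: h.
apply/eqP; rewrite eqn_mod_dvd //; apply: primorial_dvd => q pq qy.
by rewrite -eqn_mod_dvd //; apply/eqP; apply: h.
Qed.

(* The sum of [d q / q] is the fraction [(X / p mod P) / P] up to an integer: it is within
   [1 / (2 p)] of an integer from above iff [p] divides [X]. *)
Lemma crt_dvd_test y W p X (d : nat -> nat) : prime p -> y <= p -> 0 < y ->
  (forall q, prime q -> q < y -> d q * (primorial y %/ q) * p = X %[mod q]) ->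
  W * X < primorial y -> X < primorial y -> 8 * p * y <= W ->
  ((\sum_(0 <= q < y | prime q) (d q * W %/ q) + y) %% W <= y) = (p %| X).
Proof.
move=> pp yp y0 hd hWX hX hW; set P := primorial y in hd hWX hX *.
have P0 : 0 < P := primorial_gt0 y; have p0 := prime_gt0 pp.
set s := \sum_(_ <= _ < _ | _) _.
pose A := \sum_(0 <= q < y | prime q) d q * (P %/ q).
pose E := \sum_(0 <= q < y | prime q) ((d q * W) %% q) * (P %/ q).
have dvP q : prime q -> q < y -> q %| P by move=> pq qy; rewrite /P (primorial_split pq qy) dvdn_mulr.
(* [E] collects the remainders of the Euclidean divisions: s approximates W A / P from below with an
   error of at most y. *)
have WA : W * A = P * s + E.
  rewrite /A /s /E !big_distrr -big_split /= big_nat_cond [RHS]big_nat_cond.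
  apply: eq_bigr => q /andP[/andP[_ qy] pq].
  have -> : P * (d q * W %/ q) = (d q * W %/ q) * q * (P %/ q).
    by rewrite -mulnA [q * _]mulnC divnK ?dvP // mulnC.
  by rewrite -mulnDl -divn_eq; lia.
have hE : E <= P * y.
  rewrite /E; apply: (@leq_trans (\sum_(0 <= q < y) P)); last first.
    by rewrite sum_nat_const_nat subn0 mulnC.
  rewrite big_mkcond big_nat_cond [X in _ <= X]big_nat_cond; apply: leq_sum => q /andP[/andP[_ qy] _].
  case: ifP => pq //; rewrite -[X in _ <= X](divnK (dvP q pq qy)) mulnC leq_mul2l.
  by rewrite (ltnW (ltn_pmod _ (prime_gt0 pq))) orbT.
have cop : coprime p P.
  rewrite prime_coprime //; apply/negP; rewrite /P /primorial Euclid_dvd_prod //.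
  rewrite big_has_cond => /hasP[q]; rewrite mem_index_iota => hq /andP[pq].
  by rewrite dvdn_prime2 // => /eqP e; move: hq; rewrite -e; lia.
have pA : p * A = X %[mod P].
  apply: eq_mod_primorial => q pq qy.
  rewrite -(hd q pq qy) /A big_nat_cond.
  rewrite (@bigD1_seq_cond _ _ _ _ _ _ _ q) ?iota_uniq ?mem_index_iota ?qy ?pq //=.
  rewrite mulnDr [p * (d q * _)]mulnC -[LHS]modnDmr.
  suff /eqP -> : (p * \sum_(0 <= i < y | (0 <= i < y) && prime i && (i != q)) d i * (P %/ i)) %% q == 0.
    by rewrite addn0.
  rewrite -[_ == 0]/(q %| _); apply: dvdn_mull; apply: dvdn_sum => i /andP[/andP[iy pi] iq].
  apply: dvdn_mull; rewrite /P (primorial_split pi iy) mulKn ?prime_gt0 //.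
  by apply: (dvdn_big_prod id) => //; rewrite pq eq_sym.
set r := A %/ P; set Z := A %% P.
have eA : A = r * P + Z by apply: divn_eq.
have ZP : Z < P by rewrite ltn_pmod.
have pZ : p * Z = X %[mod P] by rewrite modnMmr.
have main : P * s + E = W * Z + W * r * P by rewrite -WA eA; lia.
have W0 : 0 < W by nia.
have yW : y < W by nia.
have modE u v : v < W -> (W * u + v) %% W = v by move=> h; rewrite mulnC modnMDl modn_small.
(* If p divides X, then Z = X / p and W Z < P, so s lies between W r - y and W r. *)
have [/dvdnP[X' eX]|npX] := boolP (p %| X).
  have ZX : Z = X'.
    have X'P : X' < P by apply: leq_ltn_trans hX; rewrite eX leq_pmulr.
    rewrite -(modn_small ZP) -(modn_small X'P); apply/eqP.
    move/eqP: pZ; rewrite eX [X' * p]mulnC.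
    wlog: Z X' {eX hX ZP main X'P eA} / X' <= Z.
      by move=> H; case: (leqP X' Z) => [|/ltnW] h e; [exact: H|rewrite eq_sym H // eq_sym].
    move=> h; rewrite !eqn_mod_dvd ?leq_mul2l ?h ?orbT // -mulnBr Gauss_dvdr //.
    by rewrite coprime_sym.
  have h1 : W * Z < P by apply: leq_ltn_trans hWX; rewrite leq_mul2l ZX eX leq_pmulr ?orbT.
  have h2 : s <= W * r.
    have : P * s < P * (W * r).+1 by rewrite mulnS; lia.
    by rewrite ltn_pmul2l.
  have h3 : W * r <= s + y.
    have : P * (W * r) <= P * (s + y) by rewrite mulnDr; lia.
    by rewrite leq_pmul2l.
  have -> : s + y = W * r + (s + y - W * r) by lia.
  by rewrite modE; lia.
(* Otherwise Z / P is close to j / p with 0 < j < p, hence about 1 / p away from the integers; W >=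
   8 p y makes this gap wider than the rounding error. *)
set j := (p * Z) %/ P.
have epZ : p * Z = j * P + X by rewrite {1}(divn_eq (p * Z) P) pZ (modn_small hX).
have j0 : 0 < j.
  rewrite lt0n; apply: contraNneq npX => j0; move: epZ; rewrite j0 mul0n add0n => <-.
  exact: dvdn_mulr.
have jp : j < p.
  have : j * P < p * P.
    by apply: (@leq_ltn_trans (p * Z)); [rewrite epZ leq_addr|rewrite ltn_pmul2l].
  by rewrite ltn_pmul2r.
have main2 : P * (p * s) + p * E = P * (W * j + p * (W * r)) + W * X.
  have -> : P * (W * j + p * (W * r)) + W * X = W * (j * P + X) + p * (W * r * P) by lia.
  by rewrite -epZ; move: main => /(congr1 (muln p)); rewrite !mulnDr; lia.
have h1 : 8 * y + W * r <= s + y.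
  have : P * (W * j + p * (W * r)) <= P * (p * (s + y)).
    by have := leq_mul (leqnn p) hE; rewrite !mulnDr in main2 *; lia.
  rewrite leq_pmul2l // => h.
  have : p * (8 * y + W * r) <= p * (s + y).
    apply: leq_trans h; rewrite mulnDr leq_add2r; apply: (@leq_trans W); first by lia.
    by rewrite leq_pmulr.
  by rewrite leq_pmul2l.
have h2 : s + 8 * y <= W * r.+1.
  have : P * (p * s) < P * (W * j + p * (W * r)).+1 by rewrite mulnS; lia.
  rewrite ltn_pmul2l // ltnS => h.
  have : p * (s + 8 * y) <= p * (W * r.+1).
    rewrite mulnDr mulnS mulnDr; have : W * j + W <= p * W.
      by rewrite -mulnSr [p * W]mulnC leq_mul2l jp orbT.
    by lia.
  by rewrite leq_pmul2l.
have -> : s + y = W * r + (s + y - W * r) by lia.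
by rewrite modE; [lia | rewrite mulnS in h2; lia].
Qed.

Definition cofactor_prod M q := Mprod M (fun i => cif (prime i /\ i <> q) i 1) q.
(** Dividing by p modulo q is possible because q < Y <= p. The square of the determinant is used
    since only this is available modulo q. *)
Definition crt_digit M k p (c : nat -> nat -> nat) q := mu (sz M) (fun d => d < q /\
  tr M ((tr M (d * cofactor_prod M q) %% q) * (p %% q)) %% q = detsq M k c q).
(** The denominator of the fixed-point fractions. Dividing by Y^2 leaves room for [d * W] with d < Y
    and for a sum of Y terms of size at most W. *)
Definition WM M := (sz M).-1 %/ (YM M * YM M).
Definition Sing M k p (c : nat -> nat -> nat) :=
  tr M (Bsum M (fun q => cif (prime q) (tr M (crt_digit M k p c q * WM M) %/ q) 0) + YM M) %% WM M <= YM M.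

Lemma d_Sing (c : model -> env -> nat -> nat -> nat) k p :
  (forall r g h, dval goodM g -> dval goodM h ->
     dval goodM (fun M e => c M (fun i => e (r i)) (g M e) (h M e))) ->
  dval goodM k -> dval goodM p ->
  dpred goodM (fun M e => Sing M (k M e) (p M e) (c M e)).
Proof.
move=> hc hk hp; rewrite /Sing /WM /crt_digit /cofactor_prod.
have hd r g : dval goodM g -> dval goodM (fun M e => detsq M (k M (fun i => e (r i))) (c M (fun i => e (r i))) (g M e)).
  move=> hg.
  apply: (@dval_detsq (fun M e => c M (fun i => e (r i)))); dp.
by dp.
Qed.

Lemma cofactor_prodE M q : goodM M -> prime q -> q < YM M ->
  cofactor_prod M q = (primorial (YM M) %/ q) %% q.
Proof.
move=> hM pq qY; rewrite /cofactor_prod MprodE ?prime_gt1 ?(ltnW qY) //.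
rewrite (primorial_split pq qY) mulKn ?prime_gt0 // big_mkord; congr (_ %% _).
rewrite [RHS]big_mkcond; apply: eq_bigr => i _; case: ifP => h.
  by rewrite cifT //; case/andP: h => h /eqP.
by rewrite cifF // => -[pi /eqP ne]; rewrite pi ne in h.
Qed.

Lemma nat_mx_intr (R : nzRingType) k c : nat_mx R k c = map_mx (intr : int -> R) (nat_mx int k c).
Proof. by apply/matrixP => i j; rewrite !mxE rmorph_nat. Qed.

Lemma absz_sqr_natr (R : nzRingType) (z : int) : ((`|z|%N ^ 2)%N%:R = (z%:~R) ^+ 2 :> R)%R.
Proof.
have e : Posz (`|z|%N ^ 2) = (z ^+ 2)%R.
  by rewrite -mulnn PoszM !abszE -normrM -expr2 ger0_norm ?sqr_ge0.
by transitivity ((z ^+ 2)%R%:~R : R)%R; [rewrite -e -pmulrn | rewrite rmorphXn].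
Qed.

Lemma detsq_natE (R : comNzRingType) k c :
  ((`|\det (nat_mx int k c)|%N ^ 2)%N%:R = (\det (nat_mx R k c)) ^+ 2)%R.
Proof. by rewrite [nat_mx R k c]nat_mx_intr det_map_mx /= absz_sqr_natr. Qed.

(** Over the integers |det| <= k! p^k <= N^(2T), so W times its square stays below the primorial by
    [sz_exp_lt_lin] and [crt_dvd_test] applies. The square vanishes modulo p iff the determinant
    does. *)
Lemma SingP M k p c : goodM M -> 0 < k <= TM M -> prime p -> YM M <= p ->
  16 * p * YM M ^ 3 <= sz M -> (forall i j, i < k -> j < k -> c i j < p) ->
  Sing M k p c <-> (\det (nat_mx 'F_p k c) = 0)%R.
Proof.
move=> hM /andP[k0 kT] pp Yp hp hc; have Y0 := YM_gt0 hM; have p0 := prime_gt0 pp.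
set C := nat_mx int k c; pose X := `|(\det C)%R|%N ^ 2.
have hY : 2 ^ 16 <= YM M by apply: leq_trans (YM_ge hM); rewrite leq_exp2l.
have N1 := sz_gt1 hM; have N0 : 0 < sz M by lia.
have Y3 : YM M * YM M <= YM M ^ 3 by rewrite !expnS expn0 muln1 leq_pmull.
have YY0 : 0 < YM M * YM M by rewrite muln_gt0 Y0.
have pN : p <= sz M by apply: leq_trans hp; nia.
have hX : X <= sz M ^ (4 * TM M).
  have -> : 4 * TM M = (TM M + TM M) * 2 by lia.
  rewrite /X expnM leq_exp2r // expnD.
  have h1 : `|(\det C)%R|%N <= k`! * p ^ k.
    by apply: det_absz_le => i j; rewrite mxE natz absz_nat ltnW // hc.
  apply: (leq_trans h1); apply: leq_mul.
    apply: (leq_trans (fact_le_exp k)); apply: (@leq_trans (sz M ^ k)); last by rewrite leq_pexp2l.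
    by rewrite leq_exp2r //; apply: leq_trans kT _; apply: leq_trans (TM_le hM) (ltnW (YM_lt hM)).
  by apply: (@leq_trans (sz M ^ k)); [rewrite leq_exp2r | rewrite leq_pexp2l].
have WN : WM M < sz M by rewrite /WM; apply: leq_ltn_trans (leq_div _ _) _; lia.
have hP : sz M * X < primorial (YM M).
  apply: leq_trans (primorial_ge hY); apply: leq_ltn_trans (sz_exp_lt_lin hM).
  apply: (@leq_trans (sz M * sz M ^ (4 * TM M))); first by rewrite leq_mul2l hX orbT.
  by rewrite -expnS leq_pexp2l //; lia.
have hWX : WM M * X < primorial (YM M) by apply: leq_ltn_trans hP; rewrite leq_mul2r (ltnW WN) orbT.
have hX' : X < primorial (YM M) by apply: leq_ltn_trans hP; rewrite leq_pmull.
have YYN : YM M * YM M < sz M by rewrite mulnn; apply: Yexp_lt => //; have := ydeg_ge; lia.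
have h8 : 8 * p * YM M <= WM M.
  rewrite /WM leq_divRL //; have -> : 8 * p * YM M * (YM M * YM M) = 8 * (p * YM M ^ 3).
    by rewrite !expnS expn0 muln1; lia.
  have : 0 < p * YM M ^ 3 by rewrite muln_gt0 p0 expn_gt0 Y0.
  by move: hp; rewrite -mulnA; lia.
have hWY : WM M * (YM M * YM M) < sz M.
  by apply: (@leq_ltn_trans (sz M).-1); [exact: leq_divM | lia].
have dP q : prime q -> q < YM M -> crt_digit M k p c q < q /\
    crt_digit M k p c q * (primorial (YM M) %/ q) * p = X %[mod q].
  move=> pq qY; have q0 := prime_gt0 pq; have qN := ltn_trans qY (YM_lt hM).
  have [ds1 ds2] := @detsqP M k c q hM pq qY k0 kT.
  have trs d : d < q -> tr M ((tr M (d * cofactor_prod M q) %% q) * (p %% q)) %% q =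
      (d * (primorial (YM M) %/ q) * p) %% q.
    move=> dq; rewrite cofactor_prodE //.
    have h1 x y : x < q -> y < q -> x * y < sz M.
      move=> hx hy; apply: leq_ltn_trans YYN; apply: leq_mul; apply: ltnW.
        exact: ltn_trans hx qY.
      exact: ltn_trans hy qY.
    rewrite (trE (h1 _ _ dq (ltn_pmod _ q0))) (trE (h1 _ _ (ltn_pmod _ q0) (ltn_pmod _ q0))).
    by rewrite modnMm -modnMml modnMmr modnMml.
  have Xds : X = detsq M k c q %[mod q].
    by apply/eqP; rewrite -Fp_eq // ds2 /X detsq_natE.
  have cop : coprime (primorial (YM M) %/ q * p) q.
    rewrite coprime_sym prime_coprime // (primorial_split pq qY) mulKn //.
    rewrite Euclid_dvdM // negb_or [q %| p]dvdn_prime2 //; apply/andP; split; last first.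
      by apply/eqP => e; move: qY; rewrite e ltnNge Yp.
    rewrite Euclid_dvd_prod // big_has_cond; apply/hasPn => i _ /=; apply/negP => /andP[/andP[pi iq]].
    by rewrite dvdn_prime2 // eq_sym (negbTE iq).
  have [|h1 [h2 h3] _] := @muP (sz M) (fun d => d < q /\
     tr M ((tr M (d * cofactor_prod M q) %% q) * (p %% q)) %% q = detsq M k c q).
    pose a := primorial (YM M) %/ q * p; pose x := ((detsq M k c q)%:R / a%:R : 'F_q)%R.
    have xq : (x : nat) < q by apply: Fp_val_lt.
    exists (x : nat); first exact: ltn_trans xq qN.
    split=> //; rewrite trs // -[RHS](modn_small ds1) -mulnA; apply/eqP; rewrite -Fp_eq // natrM Fp_natr_val /x.
    by rewrite divfK // Fp_eq0 // -prime_coprime // coprime_sym.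
  by split=> //; rewrite /crt_digit -trs // h3 Xds modn_small.
have sumE : \sum_(0 <= q < YM M | prime q) (crt_digit M k p c q * WM M %/ q) =
   \sum_(q < YM M) cif (prime q) (tr M (crt_digit M k p c q * WM M) %/ q) 0.
  rewrite big_mkord big_mkcond; apply: eq_bigr => q _; case: ifP => pq; last by rewrite cifF // pq.
  have [h _] := dP q pq (ltn_ord q); rewrite cifT // trE //; apply: leq_ltn_trans hWY.
  rewrite [_ * WM M]mulnC leq_mul2l; apply/orP; right; apply: (@leq_trans (YM M)); last by rewrite leq_pmulr.
  by apply: ltnW; apply: ltn_trans h _.
set s := \sum_(0 <= q < _ | _) _ in sumE.
have sN : s + YM M < sz M.
  apply: (@leq_ltn_trans (WM M * (YM M * YM M))) => //.
  have : s <= WM M * YM M.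
    rewrite /s big_mkcond; apply: (@leq_trans (\sum_(0 <= q < YM M) WM M)).
      rewrite big_nat_cond [X in _ <= X]big_nat_cond; apply: leq_sum => q /andP[/andP[_ qY] _].
      case: ifP => // pq; have [h _] := dP q pq qY.
      rewrite -[X in _ <= X](mulKn _ (prime_gt0 pq)); apply: leq_div2r.
      by rewrite leq_mul2r (ltnW h) orbT.
    by rewrite sum_nat_const_nat subn0 mulnC.
  have W0 : 0 < WM M by apply: leq_trans h8; rewrite !muln_gt0 p0 Y0.
  by have := YM_gt1 hM; nia.
have bs : Bsum M (fun q => cif (prime q) (tr M (crt_digit M k p c q * WM M) %/ q) 0) = s.
  by rewrite sumE; apply: BsumE => //; rewrite -sumE; apply: leq_ltn_trans sN; rewrite leq_addr.
rewrite /Sing bs trE // /s (crt_dvd_test pp Yp Y0 _ hWX hX' h8) //; last by move=> q pq qY; case: (dP q pq qY).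
rewrite -Fp_eq0 // /X detsq_natE sqrf_eq0.
by split=> [/eqP|->].
Qed.

(** * Updating the inverse of a matrix under a low-rank change *)

Section Woodbury.
Local Open Scope ring_scope.
Variable F : fieldType.

(** This and the next lemma factor the same block matrix in two ways; together they give det (1 + Z
    X) = det (1 + X Z). *)
Lemma det_block_one a b (X : 'M[F]_(a, b)) (Z : 'M[F]_(b, a)) :
  \det (block_mx 1%:M X (- Z) 1%:M) = \det (1%:M + Z *m X).
Proof.
have -> : block_mx 1%:M X (- Z) 1%:M =
   block_mx 1%:M 0 (- Z) 1%:M *m block_mx 1%:M X 0 (1%:M + Z *m X).
  rewrite mulmx_block !mul1mx !mulmx0 !mul0mx !mulmx1 !addr0; congr block_mx.
  by rewrite mulNmx addrCA addNr addr0.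
by rewrite det_mulmx det_lblock det_ublock !det1 !mul1r.
Qed.

Lemma det_block_one_swap a b (X : 'M[F]_(a, b)) (Z : 'M[F]_(b, a)) :
  \det (block_mx 1%:M X (- Z) 1%:M) = \det (1%:M + X *m Z).
Proof.
have -> : block_mx 1%:M X (- Z) 1%:M =
   block_mx 1%:M X 0 1%:M *m block_mx (1%:M + X *m Z) 0 (- Z) 1%:M.
  rewrite mulmx_block !mul1mx !mul0mx !mulmx1 !add0r; congr block_mx.
  by rewrite mulmxN addrK.
by rewrite det_mulmx det_lblock det_ublock !det1 !mul1r mulr1.
Qed.

Lemma det_border_unit m (A : 'M[F]_m) (b : 'cV[F]_m) (a : 'rV[F]_m) (c : 'M[F]_1) :
  A \in unitmx -> \det (block_mx A b a c) = \det A * (c - a *m invmx A *m b) 0 0.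
Proof.
move=> uA.
have -> : block_mx A b a c = block_mx A 0 a 1%:M *m block_mx 1%:M (invmx A *m b) 0 (c - a *m invmx A *m b).
  rewrite mulmx_block !mulmx1 !mul1mx !mulmx0 !mul0mx !addr0; congr block_mx.
    by rewrite mulmxA mulmxV // mul1mx.
  by rewrite mulmxA addrC subrK.
by rewrite det_mulmx det_lblock det_ublock !det1 mulr1 mul1r [\det (_ - _)]det_mx11.
Qed.

(** Multilinearity in the last row, instead of a Schur complement, covers singular A as well; the
    second test of [Upd] depends on that case. *)
Lemma det_border_add m (A : 'M[F]_m) (b : 'cV[F]_m) (a : 'rV[F]_m) (c d : 'M[F]_1) :
  \det (block_mx A b a (c + d)) = \det (block_mx A b a c) + \det A * d 0 0.
Proof.
have -> : \det A * d 0 0 = \det (block_mx A b 0 d) by rewrite det_ublock det_mx11.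
rewrite -[\det (block_mx A b a c)]mul1r -[\det (block_mx A b 0 d)]mul1r.
have ne (i : 'I_(m + 1).-1) (l : 'I_1) : lift (rshift m (0 : 'I_1)) i = m + l :> nat -> False.
  rewrite ord1 => e; have := neq_lift (rshift m (0 : 'I_1)) i.
  by move/eqP; apply; apply/val_inj; rewrite [RHS]e.
apply: (determinant_multilinear (i0 := rshift m 0)).
- by rewrite !scale1r /block_mx !rowKd !row_id add_row_mx addr0.
- apply/matrixP => i j; rewrite !mxE; case: splitP => // l /ne [].
- apply/matrixP => i j; rewrite !mxE; case: splitP => // l /ne [].
Qed.

Variables (n k : nat) (M0 M1 : 'M[F]_n) (P : 'M[F]_(n, k)) (D : 'M[F]_k) (Q : 'M[F]_(k, n)).
Hypotheses (uM0 : M0 \in unitmx) (eM1 : M1 = M0 + P *m D *m Q).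
Let B := invmx M0.
Let G0 := block_mx 1%:M (Q *m B *m P) (- D) 1%:M.

(** M1 = M0 (1 + B P D Q), and det G0 = det (1 + B P D Q) by exchanging the factors Q and B P D. *)
Lemma unit_border_core : (G0 \in unitmx) = (M1 \in unitmx).
Proof.
have e : \det G0 = \det B * \det M1.
  have -> : M1 = M0 *m (1%:M + B *m P *m D *m Q).
    by rewrite mulmxDr mulmx1 !mulmxA mulmxV // mul1mx.
  rewrite det_mulmx mulrA -det_mulmx mulVmx // det1 mul1r.
  rewrite /G0 det_block_one_swap (_ : Q *m B *m P *m D = Q *m (B *m P *m D)); last by rewrite !mulmxA.
  by rewrite -det_block_one_swap det_block_one.
rewrite !unitmxE e !unitfE mulf_eq0 negb_or.
have := unitmx_inv M0; rewrite uM0 unitmxE unitfE => -> /=.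
by [].
Qed.

(** The left side is the Schur complement of [G0] in the bordered matrix. No inverse is expanded:
    for x = M1^-1 V the vector w = (Q x, D Q x) solves G0 w = (Q B V, 0), because B P D Q x = B V -
    x. *)
Lemma border_value (U : 'rV[F]_n) (V : 'cV[F]_n) : M1 \in unitmx ->
  U *m B *m V - row_mx 0 (U *m B *m P) *m invmx G0 *m col_mx (Q *m B *m V) 0 =
  U *m invmx M1 *m V.
Proof.
move=> uM1; pose x := invmx M1 *m V; pose w := col_mx (Q *m x) (D *m (Q *m x)).
have M1x : M1 *m x = V by rewrite mulmxA mulmxV // mul1mx.
have eB : B *m (P *m (D *m (Q *m x))) = B *m V - x.
  have -> : P *m (D *m (Q *m x)) = M1 *m x - M0 *m x.
    by rewrite -mulmxBl eM1 [M0 + _]addrC addrK !mulmxA.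
  by rewrite mulmxBr M1x mulmxA mulVmx // mul1mx.
have e : G0 *m w = col_mx (Q *m B *m V) 0.
  rewrite /G0 /w mul_block_col !mul1mx mulNmx addNr; congr col_mx.
  by rewrite -!mulmxA eB mulmxBr addrC subrK !mulmxA.
rewrite -[_ *m invmx G0 *m _]mulmxA.
have <- : w = invmx G0 *m col_mx (Q *m B *m V) 0.
  by rewrite -e mulmxA mulVmx ?mul1mx // unit_border_core.
rewrite /w mul_row_col mul0mx add0r -!mulmxA eB mulmxBr opprB addrC subrK /x.
by [].
Qed.
End Woodbury.

(** * Enumerating a small definable set *)

(* The set is too large to be guessed; a modulus [r] injective on it lets its elements be counted. *)
Definition hashr M (K : nat -> Prop) := mu (sz M) (fun r => 0 < r /\ (r < YM M /\
  forall u, u < sz M -> forall v, v < sz M -> K u -> K v -> u %% r = v %% r -> u = v)).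
Definition rk M (K : nat -> Prop) u :=
  Msum M (fun h => cif (exists2 v, v < sz M & K v /\ (v < u /\ v %% hashr M K = h)) 1 0) (YM M).
Definition card_small M (K : nat -> Prop) :=
  Msum M (fun h => cif (exists2 v, v < sz M & K v /\ v %% hashr M K = h) 1 0) (YM M).
Definition elt M (K : nat -> Prop) i := mu (sz M) (fun u => K u /\ rk M K u = i).

Section EnumDef.
Variable K : model -> nat -> Prop.
Hypothesis hK : forall f, dval goodM f -> dpred goodM (fun M e => K M (f M e)).

Lemma dval_hashr : dval goodM (fun M _ => hashr M (K M)).
Proof. by rewrite /hashr; dp. Qed.

Lemma dval_rk f : dval goodM f -> dval goodM (fun M e => rk M (K M) (f M e)).
Proof. by move=> hf; have hh := dval_hashr; rewrite /rk; dp. Qed.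

Lemma dval_card_small : dval goodM (fun M _ => card_small M (K M)).
Proof. by have hh := dval_hashr; rewrite /card_small; dp. Qed.

Lemma dval_elt f : dval goodM f -> dval goodM (fun M e => elt M (K M) (f M e)).
Proof. by move=> hf; have hh := dval_rk; rewrite /elt; dp. Qed.

End EnumDef.

Lemma size_filter_lt_nth s i : sorted ltn s -> i < size s ->
  size [seq v <- s | v < nth 0 s i] = i.
Proof.
elim: s i => // a s IH [|i] /= hs hi.
  rewrite ltnn; apply/eqP; rewrite size_eq0 -[_ == _]negbK -has_filter; apply/hasPn => v hv.
  have /allP/(_ v hv) := order_path_min ltn_trans hs.
  by rewrite -leqNgt => /ltnW.
have h := order_path_min ltn_trans hs.
rewrite (_ : a < nth 0 s i) /=; first by rewrite IH // (path_sorted hs).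
by move/allP: h; apply; apply: mem_nth.
Qed.

Lemma sum_mem_cif n t (P : nat -> Prop) : uniq t -> all (fun x => x < n) t ->
  (forall h, h < n -> (P h <-> h \in t)) -> \sum_(h < n) cif (P h) 1 0 = size t.
Proof.
move=> ut /allP hn hP; rewrite -(big_mkord xpredT (fun h => cif (P h) 1 0)).
rewrite (eq_big_nat _ _ (F2 := fun h => if h \in t then 1 else 0)); last first.
  move=> h /andP[_ hh]; case: ifP => ht; first by rewrite cifT //; apply/hP.
  by rewrite cifF // => /(hP h hh); rewrite ht.
rewrite -big_mkcond sum1_count -size_filter; apply/perm_size/uniq_perm => //.
  by rewrite filter_uniq // iota_uniq.
move=> h; rewrite mem_filter mem_index_iota; case ht: (h \in t) => //=.
by rewrite hn.
Qed.

Lemma nn_lt_sz M : goodM M -> nn M < sz M.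
Proof.
move=> hM; have [_ h1 h2] := hM; apply: leq_trans h2; have Y0 := YM_gt0 hM.
have n0 : 0 < nn M by apply: leq_trans h1.
have -> : nn M ^ 8 = nn M * nn M ^ 7 by rewrite -expnS.
have : 0 < nn M ^ 7 * YM M ^ 3 by rewrite muln_gt0 !expn_gt0 n0 Y0.
by nia.
Qed.

Lemma TM_lt M : goodM M -> TM M < YM M.
Proof.
move=> hM; apply: leq_trans (TM_le_YM12 hM); rewrite -{1}(expn1 (TM M)) ltn_exp2l //.
by apply: leq_ltn_trans (TM_gt hM); have := ydeg_ge; lia.
Qed.

Section Enum.
Variables (M : model) (K : nat -> Prop).
Hypotheses (hM : goodM M) (Kn : forall u, K u -> u < nn M).
Let s := [seq u <- iota 0 (nn M) | `[< K u >]].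
Hypothesis (sT : size s <= TM M).

Lemma mem_enumK u : (u \in s) <-> K u.
Proof.
rewrite mem_filter mem_iota add0n; split; first by case/andP => /asboolP.
by move=> h; rewrite /= Kn // andbT; apply/asboolP.
Qed.

Lemma uniq_enumK : uniq s. Proof. by rewrite filter_uniq // iota_uniq. Qed.

Lemma sorted_enumK : sorted ltn s.
Proof. by apply: sorted_filter; [exact: ltn_trans | exact: iota_ltn_sorted]. Qed.

(** The product of all positive differences of elements of K is at most N^(T^2), so a prime below Y
    does not divide it and separates the elements. *)
Lemma hashr_exists : exists2 r, r < sz M & 0 < r /\ (r < YM M /\
  forall u, u < sz M -> forall v, v < sz M -> K u -> K v -> u %% r = v %% r -> u = v).
Proof.
have nN := nn_lt_sz hM.
pose D := \prod_(u <- s) \prod_(v <- s | u < v) (v - u).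
have D0 : 0 < D.
  by apply: prodn_cond_gt0 => u _; apply: prodn_cond_gt0 => v; rewrite subn_gt0.
have DN : D <= sz M ^ (TM M ^ 2).
  rewrite -mulnn; apply: (@leq_trans (\prod_(u <- s) sz M ^ TM M)); last first.
    by rewrite big_const_seq count_predT iter_muln_1 -expnM leq_pexp2l ?leq_mul2l ?sT ?orbT //; lia.
  apply: leq_prod => u _; rewrite big_mkcond.
  apply: (@leq_trans (\prod_(v <- s) sz M)); last first.
    by rewrite big_const_seq count_predT iter_muln_1 leq_pexp2l //; lia.
  rewrite big_seq [X in _ <= X]big_seq; apply: leq_prod => v.
  by rewrite mem_filter mem_iota => /andP[_ hv]; case: ifP => _; lia.
have [| |r [pr rY nd]] := @small_prime_ndvd (YM M) D.
- by apply: leq_trans (YM_ge hM); rewrite leq_exp2l.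
- rewrite D0; apply: leq_ltn_trans DN _; apply: leq_ltn_trans (sz_exp_lt hM).
  by rewrite leq_pexp2l; lia.
exists r; first exact: ltn_trans rY (YM_lt hM).
split; first exact: prime_gt0.
split=> // u _ v _ Ku Kv.
have main x y : K x -> K y -> x < y -> x %% r = y %% r -> False.
  move=> Kx Ky xy e; move/negP: nd; apply; apply: (@dvdn_trans (y - x)).
    by rewrite -eqn_mod_dvd ?(ltnW xy) // e.
  have hx : x \in s by apply/mem_enumK.
  have hy : y \in s by apply/mem_enumK.
  rewrite /D (@bigD1_seq_cond _ _ _ _ _ xpredT _ x) ?uniq_enumK //= dvdn_mulr //.
  by rewrite (@bigD1_seq_cond _ _ _ _ _ _ _ y) ?uniq_enumK //= dvdn_mulr.
by move=> e; case: (ltngtP u v) => // h; exfalso; [exact: (main u v)|apply: (main v u)].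
Qed.

Let r := hashr M K.

Lemma hashrP : [/\ 0 < r, r < YM M & {in s &, injective (fun u => u %% r)}].
Proof.
have [_ [r0 [rY h]] _] := muP hashr_exists; split=> // u v.
move=> /mem_enumK Ku /mem_enumK Kv; apply: h => //.
  exact: ltn_trans (Kn Ku) (nn_lt_sz hM).
exact: ltn_trans (Kn Kv) (nn_lt_sz hM).
Qed.

Lemma Msum_hash (P : nat -> Prop) (t : seq nat) : subseq t s -> (forall v, P v <-> v \in t) ->
  Msum M (fun h => cif (exists2 v, v < sz M & P v /\ v %% r = h) 1 0) (YM M) = size t.
Proof.
move=> ts hP; have [r0 rY inj] := hashrP.
have sub v : v \in t -> v \in s by apply: mem_subseq.
rewrite MsumE ?YM_gt0 ?leqnn //.
rewrite (@sum_mem_cif (YM M) [seq v %% r | v <- t] (fun h => exists2 v, v < sz M & P v /\ v %% r = h)).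
- rewrite size_map modn_small //; apply: leq_ltn_trans (TM_lt hM).
  by apply: leq_trans sT; apply: size_subseq.
- rewrite map_inj_in_uniq ?(subseq_uniq ts) ?uniq_enumK // => u v hu hv; apply: inj; exact: sub.
- by apply/allP => x /mapP[v _ ->]; apply: ltn_trans rY; rewrite ltn_pmod.
move=> h _; split.
  by move=> [v _ [/hP hv <-]]; apply: map_f.
move=> /mapP[v hv ->]; exists v; last by split=> //; apply/hP.
by apply: ltn_trans (nn_lt_sz hM); apply: Kn; apply/mem_enumK; exact: sub.
Qed.

Lemma card_smallE : card_small M K = size s.
Proof. by apply: Msum_hash => // v; split=> /mem_enumK. Qed.

Lemma rkE i : i < size s -> rk M K (nth 0 s i) = i.
Proof.
move=> hi; rewrite -[RHS](size_filter_lt_nth sorted_enumK hi) /rk.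
rewrite -(Msum_hash (P := fun v => K v /\ v < nth 0 s i) (t := [seq v <- s | v < nth 0 s i])).
- congr Msum; apply/funext => h; congr cif; apply/propext.
  by split=> -[v vN h']; exists v => //; tauto.
- exact: filter_subseq.
by move=> v; rewrite mem_filter; split=> [[/mem_enumK -> ->]//|/andP[-> /mem_enumK]].
Qed.

Lemma eltE i : i < size s -> elt M K i = nth 0 s i.
Proof.
move=> hi; have hm : nth 0 s i \in s by apply: mem_nth.
apply: mu_eq.
- by apply: ltn_trans (nn_lt_sz hM); apply: Kn; apply/mem_enumK.
- by split; [apply/mem_enumK | exact: rkE].
move=> y _ [/mem_enumK hy e].
by rewrite -[LHS](nth_index 0 hy) -e -{2}(nth_index 0 hy) rkE // index_mem.
Qed.

End Enum.

(** * The definable update of the inverse *)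

Definition changed M (g0 g1 : nat -> nat -> Prop) u := u < nn M /\
  exists2 v, v < sz M & v < nn M /\
    ((g0 u v /\ ~ g1 u v) \/ ((~ g0 u v /\ g1 u v) \/ ((g0 v u /\ ~ g1 v u) \/ (~ g0 v u /\ g1 v u)))).

Definition prange M p := prime p /\ (nn M ^ 3 < p /\ p <= nn M ^ 6).

Definition bval M (B : nat -> nat -> nat -> nat -> Prop) p x y := mu (sz M) (fun z => B p x y z).

(* Entry (i, j) of [[I, B_KK, B_Kv], [A1 - A0, I, 0], [0, B_uK, B_uv - z]] modulo p. *)
Definition border_entry M g0 g1 B p u v z i j :=
  let kk := card_small M (changed M g0 g1) in
  let el := elt M (changed M g0 g1) in
  cif (i < kk)
    (cif (j < kk) (cif (i = j) 1 0)
      (cif (j < kk + kk) (bval M B p (el i) (el (j - kk))) (bval M B p (el i) v)))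
    (cif (i < kk + kk)
      (cif (j < kk)
        (cif (g1 (el (i - kk)) (el j) /\ ~ g0 (el (i - kk)) (el j)) 1
          (cif (g0 (el (i - kk)) (el j) /\ ~ g1 (el (i - kk)) (el j)) (p - 1) 0))
        (cif (i = j) 1 0))
      (cif (j < kk) 0
        (cif (j < kk + kk) (bval M B p u (el (j - kk)))
          (tr M (bval M B p u v + (p - z)) %% p)))).

(* The determinant is affine in [z] with slope minus the determinant of the upper left block, so the
   second test says that this block, hence the new matrix, is invertible. *)
Definition Upd M g0 g1 B p u v z :=
  prange M p /\ (u < nn M /\ (v < nn M /\ (z < p /\ ((exists2 z0, z0 < sz M & B p u v z0) /\
  (Sing M (tr M (card_small M (changed M g0 g1) + card_small M (changed M g0 g1) + 1)) p
      (border_entry M g0 g1 B p u v z) /\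
  ~ Sing M (tr M (card_small M (changed M g0 g1) + card_small M (changed M g0 g1) + 1)) p
      (border_entry M g0 g1 B p u v (tr M z.+1 %% p))))))).

Lemma d_prange p : dval goodM p -> dpred goodM (fun M e => prange M (p M e)).
Proof.
move=> hp; have h3 := dfun_expc 3 (dfun_nn goodM); have h6 := dfun_expc 6 (dfun_nn goodM).
by rewrite /prange; dp.
Qed.

Section UpdDef.
Variables (g0 g1 : model -> nat -> nat -> Prop) (B : model -> nat -> nat -> nat -> nat -> Prop).
Hypothesis hg0 : forall f g, dval goodM f -> dval goodM g -> dpred goodM (fun M e => g0 M (f M e) (g M e)).
Hypothesis hg1 : forall f g, dval goodM f -> dval goodM g -> dpred goodM (fun M e => g1 M (f M e) (g M e)).
Hypothesis hB : forall p u v z, dval goodM p -> dval goodM u -> dval goodM v -> dval goodM z ->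
  dpred goodM (fun M e => B M (p M e) (u M e) (v M e) (z M e)).

Lemma d_changed f : dval goodM f -> dpred goodM (fun M e => changed M (g0 M) (g1 M) (f M e)).
Proof. by move=> hf; rewrite /changed; dp. Qed.

Lemma dval_card_changed : dval goodM (fun M _ => card_small M (changed M (g0 M) (g1 M))).
Proof. exact: (@dval_card_small (fun M => changed M (g0 M) (g1 M)) d_changed). Qed.

Lemma dval_elt_changed f : dval goodM f ->
  dval goodM (fun M e => elt M (changed M (g0 M) (g1 M)) (f M e)).
Proof. exact: (@dval_elt (fun M => changed M (g0 M) (g1 M)) d_changed). Qed.

Lemma dval_bval p x y : dval goodM p -> dval goodM x -> dval goodM y ->
  dval goodM (fun M e => bval M (B M) (p M e) (x M e) (y M e)).
Proof. by move=> hp hx hy; rewrite /bval; dp. Qed.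

Lemma dval_border_entry p u v z i j : dval goodM p -> dval goodM u -> dval goodM v ->
  dval goodM z -> dval goodM i -> dval goodM j ->
  dval goodM (fun M e => border_entry M (g0 M) (g1 M) (B M) (p M e) (u M e) (v M e) (z M e) (i M e) (j M e)).
Proof.
move=> hp hu hv hz hi hj; have hk := dval_card_changed; have he := dval_elt_changed.
have hb := dval_bval; rewrite /border_entry; dp.
Qed.

Lemma d_Upd p u v z : dval goodM p -> dval goodM u -> dval goodM v -> dval goodM z ->
  dpred goodM (fun M e => Upd M (g0 M) (g1 M) (B M) (p M e) (u M e) (v M e) (z M e)).
Proof.
move=> hp hu hv hz; have hk := dval_card_changed.
rewrite /Upd; apply: d_and; first exact: d_prange.
do 4![apply: d_and; first by dp].
apply: d_and; [|apply: d_not]; (apply: d_Sing; [|by dp|by dp]) => r g h hg hh.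
  by apply: dval_border_entry; dp.
by apply: dval_border_entry; dp.
Qed.

End UpdDef.

(** * Correctness of the update modulo a fixed prime *)

Definition adj_mx (F : nzRingType) n (g : nat -> nat -> Prop) : 'M[F]_n :=
  (\matrix_(i, j) (`[< g i j >] : nat)%:R)%R.
Definition reach_mx (F : nzRingType) n (g : nat -> nat -> Prop) : 'M[F]_n :=
  ((n.+1%:R)%:M - adj_mx F n g)%R.

Definition tabulates n p g (B : nat -> nat -> nat -> nat -> Prop) :=
  reach_mx 'F_p n g \in unitmx /\
  forall (u v : 'I_n) z, B p u v z <-> z < p /\ (z%:R = invmx (reach_mx 'F_p n g) u v :> 'F_p)%R.

Section UpdCorrect.
Variables (M : model) (g0 g1 : nat -> nat -> Prop) (B : nat -> nat -> nat -> nat -> Prop) (p : nat).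
Hypotheses (hM : goodM M) (hp : prange M p).
Let n := nn M.
Let K := changed M g0 g1.
Let s := [seq u <- iota 0 n | `[< K u >]].
Let k := size s.
Hypothesis (kT : k + k + 1 <= TM M).
Hypothesis hB : tabulates n p g0 B.
Let F := 'F_p.
Let M0 := reach_mx F n g0.
Let M1 := reach_mx F n g1.
Let Bi := invmx M0.

Let pp : prime p. Proof. by case: hp. Qed.
Let nN : n < sz M. Proof. exact: nn_lt_sz. Qed.
Let pN : 16 * p * YM M ^ 3 <= sz M.
Proof.
case: hM => _ hY; apply: leq_trans; case: hp => _ [_ h]; rewrite leq_mul2r leq_mul2l.
rewrite (leq_trans h) ?orbT // leq_pexp2l //; exact: leq_trans (YM_gt0 hM) hY.
Qed.
Let pN2 : p + p < sz M.
Proof.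
apply: leq_trans pN; have := YM_gt0 hM; have := prime_gt0 pp.
move=> p0 Y0; have : 0 < YM M ^ 3 by rewrite expn_gt0 Y0.
by nia.
Qed.
Let Yp : YM M <= p.
Proof.
case: hM => _ h _; apply: (leq_trans h); case: hp => _ [h3 _]; apply: ltnW; apply: leq_ltn_trans h3.
rewrite -{1}(expn1 (nn M)) leq_pexp2l //; exact: leq_trans (YM_gt0 hM) h.
Qed.

Let Kn u : K u -> u < nn M. Proof. by case. Qed.
Let kT' : size s <= TM M. Proof. by move: kT; rewrite /k; lia. Qed.
Let f_lt (a : 'I_k) : nth 0 s a < n.
Proof. by apply: Kn; apply/(mem_enumK Kn); apply: mem_nth. Qed.
Let f (a : 'I_k) : 'I_n := Ordinal (f_lt a).
Let f_inj : injective f.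
Proof.
move=> a b /(congr1 val) /= e; apply/val_inj/eqP.
by rewrite -(nth_uniq 0 (ltn_ord a) (ltn_ord b)) ?e // /s uniq_enumK.
Qed.
Let f_in (u : 'I_n) : K u -> exists a, u = f a.
Proof.
move/(mem_enumK Kn) => hu; have hi : index (u : nat) s < k by rewrite index_mem.
by exists (Ordinal hi); apply/val_inj; rewrite /= nth_index.
Qed.

Local Open Scope ring_scope.

Let Delta : 'M[F]_n := M1 - M0.
Let P : 'M[F]_(n, k) := colsub f 1%:M.
Let Q : 'M[F]_(k, n) := rowsub f 1%:M.
Let D : 'M[F]_k := mxsub f f Delta.

Lemma DeltaE (i j : 'I_n) : Delta i j = (`[< g0 i j >] : nat)%:R - (`[< g1 i j >] : nat)%:R.
Proof. by rewrite !mxE opprB addrC subrKA. Qed.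

Lemma Delta0 (i j : 'I_n) : ~ K i \/ ~ K j -> Delta i j = 0.
Proof.
move=> h; rewrite DeltaE; suff e : g0 i j <-> g1 i j by rewrite (asbool_equiv_eq e) subrr.
apply: contrapT => ne; case: h => h; apply: h; split=> //.
- exists (j : nat); first exact: ltn_trans (ltn_ord j) nN.
  split=> //; have [?|?] := pselect (g0 i j); have [?|?] := pselect (g1 i j); tauto.
- exists (i : nat); first exact: ltn_trans (ltn_ord i) nN.
  split=> //; have [?|?] := pselect (g0 i j); have [?|?] := pselect (g1 i j); tauto.
Qed.

Lemma M1E : M1 = M0 + P *m D *m Q.
Proof.
suff <- : Delta = P *m D *m Q by rewrite addrC subrK.
have PE (i : 'I_n) a : P i a = (i == f a)%:R by rewrite !mxE.
have QE (i : 'I_n) a : Q a i = (f a == i)%:R by rewrite !mxE.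
have e1 (X : 'M[F]_(k, n)) (i : 'I_n) j : (P *m X) i j = \sum_a (i == f a)%:R * X a j.
  by rewrite mxE; apply: eq_bigr => a _; rewrite PE.
have e2 m (X : 'M[F]_(m, k)) i (j : 'I_n) : (X *m Q) i j = \sum_a X i a * (f a == j)%:R.
  by rewrite mxE; apply: eq_bigr => a _; rewrite QE.
apply/matrixP => i j; rewrite -mulmxA e1.
have [/f_in[a ea]|nK] := pselect (K i); last first.
  rewrite Delta0; last by left.
  rewrite big1 // => a _; rewrite (_ : i == f a = false) ?mul0r //; apply/eqP => e; apply: nK.
  by rewrite e; apply/(mem_enumK Kn); apply: mem_nth.
rewrite (bigD1 a) //= ea eqxx mul1r [X in _ + X]big1 ?addr0; last first.
  by move=> b ba; rewrite (inj_eq f_inj) eq_sym (negbTE ba) mul0r.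
rewrite e2; have [/f_in[b eb]|nK] := pselect (K j); last first.
  rewrite Delta0; last by right.
  rewrite big1 // => b _; rewrite (_ : f b == j = false) ?mulr0 //; apply/eqP => e; apply: nK.
  by rewrite -e; apply/(mem_enumK Kn); apply: mem_nth.
rewrite (bigD1 b) //= eb eqxx mulr1 [X in _ + X]big1 ?addr0; last first.
  by move=> c cb; rewrite (inj_eq f_inj) (negbTE cb) mulr0.
by rewrite [RHS]mxE.
Qed.

Lemma bvalP (x y : 'I_n) : (bval M B p x y < p)%N /\ (bval M B p x y)%:R = Bi x y.
Proof.
have hz : exists2 z, (z < sz M)%N & B p x y z.
  exists (Bi x y : nat); last by apply/hB.2; rewrite Fp_natr_val Fp_val_lt.
  by apply: ltn_trans (Fp_val_lt _ pp) _; lia.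
by have [_ /hB.2[h1 h2] _] := muP hz.
Qed.

Let UB (u : 'I_n) : 'rV[F]_n := delta_mx 0 u.
Let VB (v : 'I_n) : 'cV[F]_n := delta_mx v 0.
Let G0 := block_mx 1%:M (Q *m Bi *m P) (- D) 1%:M.

Let cardE : card_small M K = k. Proof. exact: card_smallE. Qed.
Let eltE' (a : 'I_k) : elt M K a = f a. Proof. exact: eltE. Qed.

Ltac cifs := repeat first [rewrite cifT; last by rewrite /=; lia | rewrite cifF; last by rewrite /=; lia].

Lemma border_entryE (u v : 'I_n) (z : nat) : (z < p)%N ->
  nat_mx F (k + k + 1) (border_entry M g0 g1 B p u v z) =
  block_mx G0 (col_mx (Q *m Bi *m VB v) 0) (row_mx 0 (UB u *m Bi *m P))
    (UB u *m Bi *m VB v - (z%:R)%:M)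
  /\ (forall i j, (i < k + k + 1)%N -> (j < k + k + 1)%N -> (border_entry M g0 g1 B p u v z i j < p)%N).
Proof.
move=> zp.
have QB a (y : 'I_n) : (Q *m Bi) a y = Bi (f a) y by rewrite mul_rowsub_mx mul1mx mxE.
have QBP a b : (Q *m Bi *m P) a b = Bi (f a) (f b).
  by rewrite /P mulmx_colsub mulmx1 mxE QB.
have QBV a : (Q *m Bi *m VB v) a 0 = Bi (f a) v by rewrite -colE mxE QB.
have UBP b : (UB u *m Bi *m P) 0 b = Bi u (f b).
  by rewrite /P mulmx_colsub mulmx1 mxE -rowE mxE.
have UBV : (UB u *m Bi *m VB v) 0 0 = Bi u v by rewrite -rowE -colE !mxE.
have p1 : (1 < p)%N := prime_gt1 pp.
have main (i j : 'I_(k + k + 1)) : (border_entry M g0 g1 B p u v z i j < p)%N /\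
   (border_entry M g0 g1 B p u v z i j)%:R = block_mx G0 (col_mx (Q *m Bi *m VB v) 0) (row_mx 0 (UB u *m Bi *m P))
    (UB u *m Bi *m VB v - (z%:R)%:M) i j.
  rewrite /border_entry cardE.
  have kd : (k + k - k = k)%N by lia.
  have [i' ->|i' ->] := split_ordP i; have [j' ->|j' ->] := split_ordP j;
   [rewrite block_mxEul|rewrite block_mxEur|rewrite block_mxEdl|rewrite block_mxEdr].
  - have [a ->|a ->] := split_ordP i'; have [b ->|b ->] := split_ordP j';
     [rewrite /G0 block_mxEul|rewrite /G0 block_mxEur|rewrite /G0 block_mxEdl|rewrite /G0 block_mxEdr].
    + cifs; rewrite /= mxE -val_eqE /=; have [e|e] := eqVneq (a : nat) b; last by rewrite cifF //; [split=> //; lia | apply/eqP].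
      by rewrite cifT.
    + cifs; rewrite /= addKn !eltE' QBP; exact: bvalP.
    + cifs; rewrite /= addKn !eltE' mxE mxE DeltaE opprB.
      have [h1|h1] := pselect (g1 (f a) (f b)); have [h0|h0] := pselect (g0 (f a) (f b)).
      * rewrite !cifF; [|tauto|tauto]; rewrite (asboolT h0) (asboolT h1) subrr; split=> //; lia.
      * by rewrite cifT // (asboolF h0) (asboolT h1) subr0.
      * rewrite cifF; [|tauto]; rewrite cifT // (asboolT h0) (asboolF h1) sub0r.
        split; first by lia.
        by rewrite natrB ?prime_gt0 // pchar_Fp_0 // sub0r.
      * rewrite !cifF; [|tauto|tauto]; rewrite (asboolF h0) (asboolF h1) subrr; split=> //; lia.
    + cifs; rewrite /= mxE -val_eqE /=; have [e|e] := eqVneq (a : nat) b; last by rewrite cifF //; [split=> //; lia | move/eqP; rewrite eqn_add2l; apply/negP].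
      by rewrite cifT // e.
  - have [a ->|a ->] := split_ordP i'; [rewrite col_mxEu|rewrite col_mxEd mxE].
    + rewrite ord1; cifs; rewrite /= eltE' QBV; exact: bvalP.
    + have ha := ltn_ord a; rewrite ord1; cifs; split=> //; lia.
  - have [b ->|b ->] := split_ordP j'; [rewrite row_mxEl mxE|rewrite row_mxEr].
    + rewrite ord1; cifs; split=> //; lia.
    + rewrite ord1; cifs; rewrite /= addKn eltE' UBP; exact: bvalP.
  - rewrite !ord1; cifs; have [b1 b2] := bvalP u v.
    rewrite trE; last by lia.
    rewrite ltn_pmod ?prime_gt0 // Fp_nat_mod //; split=> //.
    rewrite natrD natrB ?(ltnW zp) // b2 pchar_Fp_0 // sub0r [in RHS]mxE UBV [in RHS]mxE.
    by rewrite [in RHS]mxE mulr1n.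
split; first by apply/matrixP => i j; rewrite mxE; case: (main i j).
by move=> i j hi hj; case: (main (Ordinal hi) (Ordinal hj)).
Qed.

Lemma Sing_border (u v : 'I_n) (z : nat) : (z < p)%N ->
  Sing M (tr M (card_small M K + card_small M K + 1)) p (border_entry M g0 g1 B p u v z) <->
  \det (block_mx G0 (col_mx (Q *m Bi *m VB v) 0) (row_mx 0 (UB u *m Bi *m P))
    (UB u *m Bi *m VB v - (z%:R)%:M)) = 0.
Proof.
move=> zp; have [e h] := border_entryE u v zp.
have TN : (TM M < sz M)%N := leq_ltn_trans (TM_le hM) (YM_lt hM).
rewrite cardE trE; last exact: leq_ltn_trans kT TN.
by rewrite SingP ?e // addn1 /= -addn1.
Qed.

(** For invertible [G0] the bordered determinant is det G0 times (invmx M1 u v - z), which singles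
    out z; for singular [G0] it does not depend on z, and the two tests cannot disagree. *)
Lemma UpdP (u v : 'I_n) z :
  Upd M g0 g1 B p u v z <-> M1 \in unitmx /\ ((z < p)%N /\ z%:R = invmx M1 u v).
Proof.
have uM0 : M0 \in unitmx by case: hB.
have uG := unit_border_core uM0 M1E.
have hz0 : exists2 z0, (z0 < sz M)%N & B p u v z0.
  exists (Bi u v : nat); last by apply/hB.2; rewrite Fp_natr_val Fp_val_lt.
  by apply: ltn_trans (Fp_val_lt _ pp) _; lia.
have p0 := prime_gt0 pp.
have z1 (zp : (z < p)%N) : (tr M z.+1 %% p < p)%N /\ (tr M z.+1 %% p)%:R = z%:R + 1 :> F.
  rewrite ltn_pmod // Fp_nat_mod // trE; last by lia.
  by rewrite -natr1.
split.
  move=> [_ [_ [_ [zp [_ [S1 S2]]]]]]; have [z1p z1E] := z1 zp.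
  move/(Sing_border _ _ zp): S1 => S1.
  have {}S2 h : _ := S2 (iffRL (Sing_border u v z1p) h).
  have uG0 : G0 \in unitmx.
    rewrite unitmxE unitfE; apply/eqP => d0; apply: S2; rewrite z1E raddfD /= opprD addrA.
    by rewrite det_border_add d0 mul0r addr0 S1.
  have uM1 : M1 \in unitmx by rewrite -uG.
  split=> //; split=> //; move/eqP: S1.
  rewrite det_border_unit // mulf_eq0 => /orP[|].
    by move: uG0; rewrite unitmxE unitfE => /negbTE ->.
  rewrite addrAC (border_value uM0 M1E _ _ uM1) mxE [X in _ + X]mxE [X in _ - X]mxE mulr1n subr_eq0.
  by rewrite -rowE -colE !mxE => /eqP.
move=> [uM1 [zp zE]]; have [z1p z1E] := z1 zp.
have uG0 : G0 \in unitmx by rewrite uG.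
have d0 : \det G0 != 0 by rewrite -unitfE -unitmxE.
have val (y : F) : \det (block_mx G0 (col_mx (Q *m Bi *m VB v) 0) (row_mx 0 (UB u *m Bi *m P))
    (UB u *m Bi *m VB v - y%:M)) = \det G0 * (invmx M1 u v - y).
  rewrite det_border_unit // addrAC (border_value uM0 M1E _ _ uM1); congr (_ * _).
  by rewrite mxE [X in _ + X]mxE [X in _ - X]mxE mulr1n -rowE -colE !mxE.
split=> //; do 4!split=> //; split.
  by apply/Sing_border; rewrite // val zE subrr mulr0.
move/(Sing_border _ _ z1p)/eqP; rewrite val z1E -zE opprD addrA subrr sub0r mulf_eq0 (negbTE d0) /=.
by rewrite oppr_eq0 oner_eq0.
Qed.

End UpdCorrect.

(** * Squaring the size of an arithmetic structure *)

Definition split_digits N (xs : seq nat) := flatten [seq [:: x %/ N; x %% N] | x <- xs].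

(** Numbers with two digits in base [sz M]. Nodes and edges keep their numbers; the stored relation
    is read through the digits. *)
Definition sqm M := Model (sz M ^ 2) (nn M) (fun x y => [/\ x < sz M, y < sz M & ed M x y])
  (fun xs => au M (split_digits (sz M) xs)).

Definition join M (d : env) : env := fun i => d i.*2 * sz M + d i.*2.+1.

Definition sqmin : nat := locked ((2 ^ 16) ^ 2).

Definition sqgood M := nn M <= sz M /\ sqmin <= sz M.

Lemma leq_exp2_div256 t : 2 ^ 12 <= t -> t <= 2 ^ (t %/ 256).
Proof.
elim/ltn_ind: t => t IH ht; have [h|h] := leqP (2 ^ 12 + 256) t; last first.
  apply: (@leq_trans (2 ^ 16)).
    by apply: ltnW; apply: leq_trans h _; rewrite (expnD 2 12 4) ; lia.
  by rewrite leq_exp2l // leq_divRL //; apply: leq_trans ht.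
have h256 : 256 <= t by apply: leq_trans h; rewrite leq_addl.
have h12 : 2 ^ 12 <= t - 256 by rewrite leq_subRL // addnC.
have lt : t - 256 < t by rewrite ltn_subrL; apply: leq_trans h256.
have {}IH := IH _ lt h12; rewrite (_ : t %/ 256 = ((t - 256) %/ 256).+1); last first.
  by rewrite -{1}(subnK h256) divnDr // divnn addn1.
rewrite expnS mul2n -addnn -{1}(subnK h256); apply: leq_add => //.
by apply: leq_trans IH; apply: leq_trans h12.
Qed.

(** For t = s + 1 one has N^4 <= t^8 <= 2^(t/32). The value 2^32 of [sqmin] makes t at least 2^16,
    the threshold of [eq_mod_small]. *)
Lemma sq_bound N s : sqmin <= N -> N <= s.+1 ^ 2 -> 2 ^ 16 <= s.+1 /\ N ^ 4 < 2 ^ (s.+1 %/ 16).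
Proof.
rewrite /sqmin -lock => h1 h2.
have hs : 2 ^ 16 <= s.+1 by have := leq_trans h1 h2; rewrite leq_exp2r.
split=> //; set t := s.+1 in h2 hs *.
have ht : 2 ^ 12 <= t by apply: leq_trans hs; rewrite leq_exp2l.
have h3 : N ^ 4 <= t ^ 8 by rewrite (expnM t 2 4) leq_exp2r.
apply: leq_ltn_trans h3 _.
have h4 : t ^ 8 <= 2 ^ (t %/ 256 * 8) by rewrite expnM leq_exp2r // leq_exp2_div256.
apply: leq_ltn_trans h4 _; rewrite ltn_exp2l //.
have : 4096 <= t by [].
by lia.
Qed.

Section Square.
Notation G := sqgood.
Implicit Types (M : model) (d : env).

(** [sz M] is not an element, so its residue is obtained from that of [(sz M).-1]. All intermediate
    values stay in the structure as long as m^2 < [sz M]. *)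
Definition resd M d m i :=
  tr M (d i.*2 %% m * (tr M ((sz M).-1 %% m).+1 %% m) + d i.*2.+1 %% m) %% m.

Lemma resdE M d m i : 0 < sz M -> 0 < m -> m * m < sz M -> resd M d m i = join M d i %% m.
Proof.
move=> N0 m0 mN; rewrite /resd /join.
have h : (sz M).-1 %% m < m by rewrite ltn_pmod.
rewrite (trE (x := _.+1)); last by nia.
have -> : ((sz M).-1 %% m).+1 %% m = sz M %% m by rewrite -addn1 modnDml addn1 prednK.
have h1 x : x %% m < m by rewrite ltn_pmod.
rewrite trE; last by have := h1 (d i.*2); have := h1 (sz M); have := h1 (d i.*2.+1); nia.
by rewrite -[LHS]modnDm modnMm !modn_mod modnDm.
Qed.

(** The bound [sz M ^ 4] covers the product of two elements of the squared structure. *)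
Lemma sq_eqP M a b : sqgood M -> a < sz M ^ 4 -> b < sz M ^ 4 ->
  a = b <-> forall m, m < sz M -> 0 < m -> m * m < sz M -> a %% m = b %% m.
Proof.
move=> [_ hN] ha hb; split=> [->//|h].
have N0 : 0 < sz M by apply: leq_trans hN; rewrite /sqmin -lock expn_gt0.
have [s [h1 h2]] := sqrt_between N0.
have [h3 h4] := sq_bound hN h2.
apply: (eq_mod_small h3); [exact: ltn_trans ha h4|exact: ltn_trans hb h4|].
move=> m /andP[m0 ms]; have mm : m * m < sz M by apply: leq_ltn_trans h1; rewrite -mulnn leq_mul.
by apply: h => //; apply: leq_ltn_trans mm; apply: leq_pmull.
Qed.

Lemma join_lt M d i : bounded M d -> join M d i < sz M ^ 2.
Proof.
by move=> hd; rewrite /join -mulnn; have := hd i.*2; have := hd i.*2.+1; nia.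
Qed.

(* Sums and products of two-digit numbers are verified modulo every [m] with [m^2 < sz]. *)
Lemma d_sem_sq b : dpred G (fun M d => sem (sqm M) (join M d) b).
Proof.
elim: b => [x y|x y z|x y z|x|x y|xs|b IH|b1 IH1 b2 IH2|b IH].
- apply: (@d_ext _ _ (fun M d => d x.*2 = d y.*2 /\ d x.*2.+1 = d y.*2.+1)); last by dp.
  move=> M d hM hd /=; rewrite /join; split=> [e|[-> ->] //].
  have h1 := hd x.*2.+1; have h2 := hd y.*2.+1.
  have N0 : 0 < sz M by apply: leq_ltn_trans h1.
  split.
    by have := congr1 (divn^~ (sz M)) e; rewrite !divnMDl // !divn_small // !addn0.
  by have := congr1 (modn^~ (sz M)) e; rewrite !modnMDl !modn_small.
- apply: (@d_ext _ _ (fun M d => forall m, m < sz M -> 0 < m -> m * m <= (sz M).-1 ->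
     tr M (resd M d m x + resd M d m y) %% m = resd M d m z)); last by rewrite /resd; dp.
  move=> M d hM hd /=; have N0 : 0 < sz M by apply: leq_ltn_trans (hd 0).
  have N1 : 2 <= sz M.
    by apply: leq_trans hM.2; rewrite /sqmin -lock -expnM; apply: (@leq_trans (2 ^ 1)); rewrite ?leq_exp2l.
  have h4 : sz M ^ 2 * 2 <= sz M ^ 4 by rewrite (expnD _ 2 2) leq_mul2l -mulnn; apply/orP; right; nia.
  have hx := join_lt x hd; have hy := join_lt y hd; have hz := join_lt z hd.
  rewrite (sq_eqP hM); [|lia|lia].
  have e m : 0 < m -> m * m < sz M -> tr M (resd M d m x + resd M d m y) %% m =
     (join M d x + join M d y) %% m /\ resd M d m z = join M d z %% m.
    move=> m0 mm; rewrite !resdE // trE ?modnDm //.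
    by have := ltn_pmod (join M d x) m0; have := ltn_pmod (join M d y) m0; nia.
  have mmE m : (m * m < sz M) = (m * m <= (sz M).-1) by rewrite -[RHS]ltnS prednK.
  split=> h m m1 m2 m3.
    by have := h m m1 m2; rewrite mmE => /(_ m3); rewrite -mmE in m3; have [-> ->] := e m m2 m3.
  by have := h m m1 m2; rewrite -mmE => /(_ m3); have [-> ->] := e m m2 m3.
- apply: (@d_ext _ _ (fun M d => forall m, m < sz M -> 0 < m -> m * m <= (sz M).-1 ->
     tr M (resd M d m x * resd M d m y) %% m = resd M d m z)); last by rewrite /resd; dp.
  move=> M d hM hd /=; have N0 : 0 < sz M by apply: leq_ltn_trans (hd 0).
  have hx := join_lt x hd; have hy := join_lt y hd; have hz := join_lt z hd.
  have h4 : sz M ^ 2 <= sz M ^ 4 by rewrite leq_pexp2l.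
  rewrite (sq_eqP hM); [| |lia]; last first.
    rewrite (expnD _ 2 2); move: (sz M ^ 2) hx hy => N2; nia.
  have e m : 0 < m -> m * m < sz M -> tr M (resd M d m x * resd M d m y) %% m =
     (join M d x * join M d y) %% m /\ resd M d m z = join M d z %% m.
    move=> m0 mm; rewrite !resdE // trE ?modnMm //.
    by have := ltn_pmod (join M d x) m0; have := ltn_pmod (join M d y) m0; nia.
  have mmE m : (m * m < sz M) = (m * m <= (sz M).-1) by rewrite -[RHS]ltnS prednK.
  split=> h m m1 m2 m3.
    by have := h m m1 m2; rewrite mmE => /(_ m3); rewrite -mmE in m3; have [-> ->] := e m m2 m3.
  by have := h m m1 m2; rewrite -mmE => /(_ m3); have [-> ->] := e m m2 m3.
- apply: (@d_ext _ _ (fun M d => d x.*2 = 0 /\ d x.*2.+1 < nn M)); last by dp.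
  move=> M d hM hd /=; rewrite /join; have := hM.1; have := hd x.*2.+1.
  by case: (d x.*2) => [|a]; split; nia.
- apply: (@d_ext _ _ (fun M d => d x.*2 = 0 /\ (d y.*2 = 0 /\ ed M (d x.*2.+1) (d y.*2.+1)))); last by dp.
  move=> M d hM hd /=; rewrite /join; have := hd x.*2.+1; have := hd y.*2.+1.
  case: (d x.*2) => [|a]; case: (d y.*2) => [|c] hy hx; rewrite ?mul0n ?add0n;
    (split=> [[h1 h2 h3]|[h1 [h2 h3]]]; [|]); rewrite //; move: h1 h2; rewrite ?mulSn; lia.
- exists (BAux (flatten [seq [:: x.*2; x.*2.+1] | x <- xs])) => M d hM hd /=.
  suff -> : [seq d i | i <- flatten [seq [:: x.*2; x.*2.+1] | x <- xs]] =
    split_digits (sz M) [seq join M d i | i <- xs] by [].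
  have N0 : 0 < sz M by apply: leq_ltn_trans (hd 0).
  rewrite /split_digits; elim: xs => //= x xs <-.
  by rewrite /join divnMDl // divn_small ?hd // addn0 modnMDl modn_small ?hd.
- by apply: (d_ext _ (d_not IH)).
- by apply: (d_ext _ (d_and IH1 IH2)).
- apply: (@d_ext _ _ (fun M d => exists2 lo, lo < sz M & exists2 hi, hi < sz M &
    sem (sqm M) (join M (econs hi (econs lo d))) b)).
    move=> M d hM hd /=; have N0 : 0 < sz M by apply: leq_ltn_trans (hd 0).
    have e hi lo : join M (econs hi (econs lo d)) = econs (hi * sz M + lo) (join M d).
      by apply/funext => -[|i].
    split=> [[a ha h]|[lo hlo [hi hhi]]].
      exists (a %% sz M); first by rewrite ltn_pmod.
      exists (a %/ sz M); first by rewrite ltn_divLR // mulnn.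
      by rewrite e -divn_eq.
    by rewrite e => h; exists (hi * sz M + lo) => //; rewrite -mulnn; nia.
  apply: d_ex; apply: d_ex; apply: d_ext IH => M e hM he.
  suff -> : econs (e 0) (econs (e 1) (fun i => e i.+2)) = e by [].
  by apply/funext => -[|[|i]].
Qed.

End Square.

Definition sqn j M := iter j sqm M.

Fixpoint joinn j M (d : env) : env := if j is j'.+1 then join (sqn j' M) (joinn j' M d) else d.

Lemma sz_sqn j M : sz (sqn j M) = sz M ^ (2 ^ j).
Proof. by elim: j => [|j IH]; rewrite ?expn1 //= IH -expnM -expnSr. Qed.

Lemma nn_sqn j M : nn (sqn j M) = nn M.
Proof. by elim: j. Qed.

Lemma sqgood_sqn j M : sqgood M -> sqgood (sqn j M).
Proof.
move=> [h1 h2]; have h : sz M <= sz (sqn j M).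
  rewrite sz_sqn -{1}(expn1 (sz M)) leq_pexp2l ?expn_gt0 //.
  by apply: leq_trans h2; rewrite /sqmin -lock expn_gt0.
by split; [rewrite nn_sqn; apply: leq_trans h | apply: leq_trans h].
Qed.

Lemma bounded_joinn j M d : bounded M d -> bounded (sqn j M) (joinn j M d).
Proof. by move=> hd; elim: j => //= j IH i; apply: join_lt. Qed.

Lemma d_sem_sqn j b : dpred sqgood (fun M d => sem (sqn j M) (joinn j M d) b).
Proof.
elim: j b => [|j IH] b; first by exists b.
have [b1 hb1] := d_sem_sq b; have [b2 hb2] := IH b1; exists b2 => M d hM hd.
by rewrite hb2 // hb1 //; [exact: sqgood_sqn | exact: bounded_joinn].
Qed.

(** The digit expansion inverse to [joinn]; it turns a stored 5-tuple into a tuple of 5 * 2^j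
    nodes. *)
Fixpoint encode j M (xs : seq nat) :=
  if j is j'.+1 then encode j' M (split_digits (sz (sqn j' M)) xs) else xs.

Lemma au_sqn j M xs : au (sqn j M) xs = au M (encode j M xs).
Proof. by elim: j xs => //= j IH xs; rewrite IH. Qed.

Lemma size_split_digits N xs : size (split_digits N xs) = (size xs).*2.
Proof. by elim: xs => //= x xs ->. Qed.

Lemma size_encode j M xs : size (encode j M xs) = size xs * 2 ^ j.
Proof.
by elim: j xs => [|j IH] xs; rewrite ?muln1 //= IH size_split_digits expnS mulnA muln2.
Qed.

Lemma nth_split_digits N xs i : 0 < N ->
  nth 0 (split_digits N xs) i.*2 * N + nth 0 (split_digits N xs) i.*2.+1 = nth 0 xs i.
Proof.
move=> N0; elim: xs i => [|x xs IH] [|i] //=; by rewrite ?nth_nil // -divn_eq.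
Qed.

Lemma joinn_encode j M xs i : 0 < sz M -> joinn j M (nth 0 (encode j M xs)) i = nth 0 xs i.
Proof.
move=> N0; elim: j xs i => //= j IH xs i; rewrite /join !IH nth_split_digits //.
by rewrite sz_sqn expn_gt0 N0.
Qed.

Lemma encode_lt j M xs : 0 < sz M -> all (fun x => x < sz (sqn j M)) xs ->
  all (fun x => x < sz M) (encode j M xs).
Proof.
move=> N0; elim: j xs => //= j IH xs h; apply: IH; elim: xs h => //= x xs IHx /andP[hx /IHx ->].
have N1 : 0 < sz (sqn j M) by rewrite sz_sqn expn_gt0 N0.
by rewrite ltn_divLR // mulnn hx ltn_pmod.
Qed.

Lemma ed_sqn j M x y : 0 < sz M -> (forall x y, ed M x y -> x < sz M /\ y < sz M) ->
  ed (sqn j M) x y <-> ed M x y.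
Proof.
move=> N0 h; elim: j => //= j IH; split; first by case=> _ _ /IH.
move=> e; have [h1 h2] := h _ _ e.
have hN : sz M <= sz (sqn j M) by rewrite sz_sqn -{1}(expn1 (sz M)) leq_pexp2l ?expn_gt0.
by split; [exact: leq_trans h1 hN|exact: leq_trans h2 hN|apply/IH].
Qed.

(** * From arithmetic structures to dynamic programs *)

Section Rank.
Variables (d : Order.disp_t) (V : finOrderType d).
Implicit Types x y : V.

Lemma rank_lt x : rank x < #|V|.
Proof.
rewrite /rank -cardsT; apply: proper_card; apply/properP; split; first exact: subsetT.
by exists x; rewrite ?inE // ltxx.
Qed.

Lemma rank_mono x y : (x < y)%O -> rank x < rank y.
Proof.
move=> xy; apply: proper_card; apply/properP; split.
  by apply/subsetP => z; rewrite !inE => /lt_trans; apply.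
by exists x; rewrite !inE ?xy // ltxx.
Qed.

Lemma rank_inj : injective (@rank d V).
Proof.
by move=> x y e; case: (ltgtP x y) => // /rank_mono; rewrite e ltnn.
Qed.

Lemma rank_onto i : i < #|V| -> exists x : V, rank x = i.
Proof.
move=> hi; have inj : injective (fun x : V => Ordinal (rank_lt x)).
  by move=> x y /(congr1 val) /rank_inj.
have [g gK1 gK2] := inj_card_bij inj (eq_leq (card_ord _)).
by exists (g (Ordinal hi)); have /(congr1 val) := gK2 (Ordinal hi).
Qed.

End Rank.

Fixpoint wf m b :=
  match b with
  | BEq x y => (x < m) && (y < m)
  | BAdd x y z => [&& x < m, y < m & z < m]
  | BMul x y z => [&& x < m, y < m & z < m]
  | BNode x => x < m
  | BEdge x y => (x < m) && (y < m)
  | BAux xs => all (fun x => x < m) xs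
  | BNot b => wf m b
  | BAnd b1 b2 => wf m b1 && wf m b2
  | BEx b => wf m.+1 b
  end.

Lemma wf_ren m r b : (forall i, r i < m) -> wf m (ren r b).
Proof.
elim: b m r => //=.
- by move=> x y m r h; rewrite !h.
- by move=> x y z m r h; rewrite !h.
- by move=> x y z m r h; rewrite !h.
- by move=> x y m r h; rewrite !h.
- by move=> xs m r h; rewrite all_map; apply/allP => x _ /=; rewrite h.
- by move=> b1 IH1 b2 IH2 m r h; rewrite IH1 // IH2.
- by move=> b IH m r h; apply: IH => -[|i] //=; rewrite ltnS.
Qed.

(** Symbol [true] holds the whole stored state, symbol [false] the binary answer; [base_model] reads
    only the former. *)
Definition two_ar (a : nat) (s : bool) := if s then a else 2.

Section Base.
Variables (a : nat) (d : Order.disp_t) (V : finOrderType d).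

Definition base_model (E : {set V * V}) (A : aux_state (two_ar a) V) : model :=
  Model #|V| #|V| (fun x y => exists u v : V, [/\ rank u = x, rank v = y & (u, v) \in E])
    (fun xs => exists t : a.-tuple V, [seq rank x | x <- t] = xs /\ t \in A true).

End Base.

Section Translate.
Variable a : nat.
Notation ar := (two_ar a).

(** Two atoms need care: every base element is a node, so [BNode] becomes a tautology, and a tuple
    of the wrong length is never stored, so it becomes a contradiction. *)
Lemma translate b m : wf m b -> exists f : formula ar m,
  forall (d : Order.disp_t) (V : finOrderType d) (E : {set V * V}) (A : aux_state ar V)
    (t : m.-tuple V) (e : env), (forall i : 'I_m, e i = rank (tnth t i)) ->
  (eval E A f t <-> sem (base_model E A) e b).
Proof.
elim: b m => [x y|x y z|x y z|x|x y|xs|b IH|b1 IH1 b2 IH2|b IH] m /=.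
- move=> /andP[hx hy]; exists (FEq ar (Ordinal hx) (Ordinal hy)) => d V E A t e he /=.
  by rewrite (he (Ordinal hx)) (he (Ordinal hy)); split=> [/eqP ->//|/rank_inj ->].
- move=> /and3P[hx hy hz]; exists (FAdd ar (Ordinal hx) (Ordinal hy) (Ordinal hz)) => d V E A t e he /=.
  by rewrite (he (Ordinal hx)) (he (Ordinal hy)) (he (Ordinal hz)); split=> /eqP.
- move=> /and3P[hx hy hz]; exists (FMul ar (Ordinal hx) (Ordinal hy) (Ordinal hz)) => d V E A t e he /=.
  by rewrite (he (Ordinal hx)) (he (Ordinal hy)) (he (Ordinal hz)); split=> /eqP.
- move=> hx; exists (FEq ar (Ordinal hx) (Ordinal hx)) => d V E A t e he /=.
  by rewrite (he (Ordinal hx)) eqxx rank_lt.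
- move=> /andP[hx hy]; exists (FEdge ar (Ordinal hx) (Ordinal hy)) => d V E A t e he /=.
  rewrite (he (Ordinal hx)) (he (Ordinal hy)); split.
    by move=> h; exists (tnth t (Ordinal hx)), (tnth t (Ordinal hy)).
  by move=> [u [v [/rank_inj -> /rank_inj ->]]].
- move=> hxs; have [hs|hs] := eqVneq (size xs) a; last first.
    exists (FExists (FNot (FEq ar (ord0 : 'I_m.+1) ord0))) => d V E A t e he /=; split.
      by move=> /existsP[u]; rewrite eqxx.
    by move=> [t' [e' _]]; move: hs; rewrite -(size_map e) -e' size_map size_tuple eqxx.
  pose ys := pmap (insub : nat -> option 'I_m) xs.
  have hys : size ys == ar true.
    by rewrite size_pmap_sub -[ar true]/a -hs -all_count.
  exists (@FAux _ ar m true (Tuple hys)) => d V E A t e he /=.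
  have ey : [seq e i | i <- xs] = [seq rank x | x <- [seq tnth t i | i <- ys]].
    rewrite /ys {hys hs ys}; elim: xs hxs => //= x xs IH /andP[hx /IH ->].
    by rewrite insubT /= -he.
  split.
    by move=> h; eexists; split; [|exact: h]; rewrite ey.
  move=> [t' [e' ht']]; suff <- : t' = [tuple of map (tnth t) (Tuple hys)] by [].
  by apply/val_inj/(inj_map (@rank_inj _ V)); rewrite e' ey.
- move=> /IH[f hf]; exists (FNot f) => d V E A t e he /=.
  have := hf d V E A t e he; case: (eval E A f t) => /= h; split=> //; last by move=> _ /h.
  by move=> h'; exfalso; apply: h'; apply/h.
- move=> /andP[/IH1[f1 h1] /IH2[f2 h2]]; exists (FAnd f1 f2) => d V E A t e he /=.
  rewrite -(h1 d V E A t e he) -(h2 d V E A t e he); split; first by move/andP.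
  by move=> [-> ->].
- move=> /IH[f hf]; exists (FExists f) => d V E A t e he /=.
  have hu (u : V) : eval E A f [tuple of u :: t] <-> sem (base_model E A) (econs (rank u) e) b.
    apply: hf => i; rewrite (tnth_nth u) /=; case: i => -[|i] hi //=.
    by rewrite (he (Ordinal (hi : i < m))) (tnth_nth u).
  split; first by move=> /existsP[u /hu h]; exists (rank u) => //; exact: rank_lt.
  by move=> [i /rank_onto[u <-] /hu h]; apply/existsP; exists u.
Qed.

End Translate.

(** Answers the query on domains with fewer than [n0] elements, where the asymptotic estimates fail
    but paths of bounded length suffice. *)
Fixpoint reach_upto i M x y :=
  if i is i'.+1 then x = y \/ exists2 z, z < sz M & ed M x z /\ reach_upto i' M z y else x = y.

Lemma d_reach_upto G i f g : dval G f -> dval G g ->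
  dpred G (fun M e => reach_upto i M (f M e) (g M e)).
Proof. by elim: i f g => [|i IH] f g hf hg /=; [apply: d_eq; dp | dp]. Qed.

(* Big variable [k] is read from the base variables [k 2^j, ..., (k + 1) 2^j - 1], most significant first. *)
Lemma joinn_small j M (w : nat -> nat) k :
  joinn j M (fun i => if i %% 2 ^ j == (2 ^ j).-1 then w (i %/ 2 ^ j) else 0) k = w k.
Proof.
elim: j w k => [|j IH] w k; first by rewrite /= modn1 divn1.
set d := (fun i : nat => _).
pose w' l := if odd l then w l./2 else 0.
have -> : d = (fun i => if i %% 2 ^ j == (2 ^ j).-1 then w' (i %/ 2 ^ j) else 0).
  apply/funext => i; rewrite /d /w' expnS; have P0 : 0 < 2 ^ j by rewrite expn_gt0.
  move: (2 ^ j) P0 => P P0; rewrite {1 2}(divn_eq i P); set q := i %/ P; set r := i %% P.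
  have rP : r < P by rewrite ltn_pmod.
  rewrite -[q](odd_double_half q); set o := odd q; set h := q./2.
  have -> : (o + h.*2) * P + r = h * (2 * P) + (o * P + r) by rewrite -mul2n; lia.
  have sm : o * P + r < 2 * P by case: (o); lia.
  have P20 : 0 < 2 * P by lia.
  rewrite modnMDl modn_small // divnMDl // divn_small // addn0.
  rewrite oddD odd_double addbF oddb half_bit_double.
  case: (o) sm => /= sm; rewrite ?mul1n ?mul0n ?add0n.
    by rewrite (_ : (P + r == (2 * P).-1) = (r == P.-1)) //; apply/eqP/eqP; lia.
  by rewrite if_same (_ : (r == (2 * P).-1) = false) //; apply/eqP; lia.
by rewrite /= /join !(IH w') /w' odd_double mul0n add0n /= odd_double /= uphalf_double.
Qed.

Section Program.
Variables (j n0 : nat) (PS PA : model -> env -> Prop) (G : model -> Prop).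
Hypotheses (dS : dpred G PS) (dA : dpred G PA).
Hypothesis PS_ext : forall M e e', (forall i, i < 5 -> e i = e' i) -> PS M e <-> PS M e'.
Hypothesis n0_ge : sqmin <= n0.
Hypothesis G_sqn : forall M, nn M = sz M -> n0 <= sz M -> G (sqn j M).

Definition base_good M := nn M = sz M /\ n0 <= sz M.

Lemma sqgood_base M : base_good M -> sqgood M.
Proof. by move=> [h1 h2]; split; [rewrite h1|apply: leq_trans h2]. Qed.

Lemma d_base P : dpred G P -> dpred base_good (fun M d => P (sqn j M) (joinn j M d)).
Proof.
move=> [b hb]; have [c hc] := d_sem_sqn j b; exists c => M d hM hd.
rewrite hc //; last exact: sqgood_base.
by apply: hb; [case: hM => *; exact: G_sqn | exact: bounded_joinn].
Qed.

Definition big_model (d : Order.disp_t) (V : finOrderType d) E A :=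
  sqn j (@base_model (5 * 2 ^ j) d V E A).

Lemma update_formula : exists f : formula (two_ar (5 * 2 ^ j)) (5 * 2 ^ j),
  forall (d : Order.disp_t) (V : finOrderType d) (E : {set V * V}) (A : aux_state _ V) t,
  n0 <= #|V| -> (eval E A f t <->
    PS (big_model E A) (joinn j (base_model E A) (nth 0 [seq rank x | x <- t]))).
Proof.
have [b hb] := d_base dS; set m := 5 * 2 ^ j.
have m0 : 0 < m by rewrite muln_gt0 expn_gt0.
(* Variables beyond the tuple are redirected to variable 0, which is harmless by [PS_ext]. *)
pose r i := if i < m then i else 0.
have hr i : r i < m by rewrite /r; case: ifP.
have [f hf] := translate m (wf_ren b hr).
exists f => d V E A t hn; set e := nth 0 [seq rank x | x <- t].
have he (i : 'I_m) : e i = rank (tnth t i).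
  have x0 := tnth t i; rewrite /e (nth_map x0) ?size_tuple //.
  by rewrite (tnth_nth x0).
rewrite (hf d V E A t e he) sem_ren hb; last 2 first.
- by split.
- by move=> i; have := he (Ordinal (hr i)) => /= ->; exact: rank_lt.
apply: PS_ext => i hi; rewrite /big_model.
have key l : forall (e1 e2 : env) M k, (forall i, i < k * 2 ^ l -> e1 i = e2 i) ->
    forall i, i < k -> joinn l M e1 i = joinn l M e2 i.
  elim: l => [|l IHl] e1 e2 M k h i'; first by move=> hi'; apply: h; rewrite muln1.
  move=> hi' /=; rewrite /join; have h2 i2 : i2 < k * 2 * 2 ^ l -> e1 i2 = e2 i2.
    by rewrite -mulnA -expnS; exact: h.
  by rewrite !(IHl _ _ M _ h2) //; lia.
by apply: (key _ _ _ _ 5) => // i' hi'; rewrite /r hi'.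
Qed.

Lemma answer_formula : exists f : formula (two_ar (5 * 2 ^ j)) 2,
  forall (d : Order.disp_t) (V : finOrderType d) (E : {set V * V}) (A : aux_state _ V) (u v : V),
  (eval E A f [tuple u; v] <->
    if n0 <= #|V| then PA (big_model E A) (nth 0 [:: rank u; rank v])
    else reach_upto n0 (base_model E A) (rank u) (rank v)).
Proof.
(* A node is a small number: its lowest digit is the node and the other digits are 0. They are read
   from an extra variable that [bA] binds to the number 0. *)
have [b hb] := d_base dA; pose r i := if i %% 2 ^ j == (2 ^ j).-1 then
  (if i %/ 2 ^ j == 0 then 1 else if i %/ 2 ^ j == 1 then 2 else 0) else 0.
have [c hc] := d_reach_upto n0 (dval_var (fun _ => True) 0) (dval_var (fun _ => True) 1).
have [s hs] : dpred (fun _ => True) (fun M e => exists2 x, x < sz M & x = n0.-1) by dp.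
have [z hz] : dpred (fun _ => True) (fun M e => e 0 = 0) by dp.
pose bA := BEx (BAnd z (ren r b)).
pose r2 i := if i == 0 then 0 else 1.
(* Case distinction on the size of the domain: [s] holds iff there are at least [n0] elements. *)
pose bb := BNot (BAnd (BNot (BAnd s bA)) (BNot (BAnd (BNot s) c))).
have hr2 i : r2 i < 2 by rewrite /r2; case: ifP.
have [f hf] := translate (5 * 2 ^ j) (wf_ren bb hr2).
exists f => d V E A u v; set M := base_model E A.
pose e i := if i == 0 then rank u else rank v.
have he : bounded M e by move=> i; rewrite /e; case: ifP => _; exact: rank_lt.
rewrite (hf d V E A _ e); last first.
  by move=> i; rewrite (tnth_nth u) /e; case: i => -[|[|i]] //.
rewrite sem_ren; have -> : (fun i => e (r2 i)) = e by apply/funext => -[|i].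
have N0 : 0 < sz M by apply: leq_ltn_trans (he 0).
have n00 : 0 < n0 by apply: leq_trans n0_ge; rewrite /sqmin -lock expn_gt0.
have sE : sem M e s <-> n0 <= #|V|.
  rewrite hs //; split; first by move=> [x hx ex]; move: hx; rewrite ex /= prednK.
  by move=> h; exists n0.-1 => //=; rewrite prednK.
have bAE : n0 <= #|V| -> (sem M e bA <-> PA (big_model E A) (nth 0 [:: rank u; rank v])).
  move=> hn; have hM : base_good M by split.
  have main : sem M (econs 0 e) (BAnd z (ren r b)) <-> PA (big_model E A) (nth 0 [:: rank u; rank v]).
    rewrite /= sem_ren hz //; last exact: bounded_econs.
    rewrite hb //; last by move=> i; apply: bounded_econs.
    rewrite /big_model -/M; set e1 := joinn _ _ _; suff -> : e1 = nth 0 [:: rank u; rank v].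
      by split=> [[]|].
    rewrite -[RHS](funext (joinn_small j M (nth 0 [:: rank u; rank v]))) /e1; congr joinn.
    apply/funext => i; rewrite /r; case: ifP => // _; case: (i %/ 2 ^ j) => [|[|l]] //=.
    by rewrite nth_nil.
  split; last by move/main => h; exists 0.
  move=> [x hx h]; apply/main.
  by have /(hz M _ I (bounded_econs hx he)) /= <- := h.1.
have cE : sem M e c <-> reach_upto n0 M (rank u) (rank v) by apply: hc.
rewrite [sem M e bb]/=; case: leqP => hn.
  have h1 : sem M e s by apply/sE.
  rewrite -(bAE hn) /bA; have := pselect (sem M e bA); rewrite /bA /=; tauto.
have h1 : ~ sem M e s by rewrite sE; lia.
by rewrite -cE; have := pselect (sem M e c); tauto.
Qed.

(** [PS] is evaluated over the changed graph with the current relations, as the semantics of an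
    update prescribes. The new relations are placed next to any graph [E], because the graph will
    have changed again when they are read. *)
Lemma program_exists : exists P : dyn_program, exists A0 : forall (d : Order.disp_t) (V : finOrderType d),
    aux_state (@aux_ar P) V -> aux_state (two_ar (5 * 2 ^ j)) V,
  forall (d : Order.disp_t) (V : finOrderType d), 
  [/\ forall E xs, n0 <= #|V| -> ~ au (big_model E (A0 d V (fun=> set0))) xs,
      forall (S : {set V * V} * aux_state (@aux_ar P) V) c E xs, n0 <= #|V| ->
        size xs = 5 -> all (fun x => x < #|V| ^ (2 ^ j)) xs ->
        (au (big_model E (A0 d V (step S c).2)) xs <->
         PS (big_model (step S c).1 (A0 d V S.2)) (nth 0 xs)) &
      forall (S : {set V * V} * aux_state (@aux_ar P) V) c u v,
        ((u, v) \in answer_set (step S c).2 <->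
         if n0 <= #|V| then PA (big_model (step S c).1 (A0 d V S.2)) (nth 0 [:: rank u; rank v])
         else reach_upto n0 (base_model (step S c).1 (A0 d V S.2)) (rank u) (rank v))].
Proof.
have [fS hS] := update_formula; have [fA hA] := answer_formula.
pose P := @DynProgram bool (two_ar (5 * 2 ^ j))
  (fun s => if s return formula (two_ar (5 * 2 ^ j)) (two_ar (5 * 2 ^ j) s) then fS else fA) false erefl.
exists P, (fun d V A => A) => d V; split.
- move=> E xs hn; rewrite /big_model au_sqn /= => -[t [_]].
  by rewrite inE.
- move=> S c E xs hn h5 hxs; rewrite /big_model au_sqn /=.
  set M := base_model E _.
  have n00 : 0 < #|V|.
    by apply: leq_trans hn; apply: leq_trans n0_ge; rewrite /sqmin -lock expn_gt0.
  have ext A1 A2 : encode j (@base_model (5 * 2 ^ j) _ _ (step S c).1 A1) xs =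
     encode j (@base_model (5 * 2 ^ j) _ _ E A2) xs.
    have key l : forall ys, encode l (@base_model (5 * 2 ^ j) _ _ (step S c).1 A1) ys =
       encode l (@base_model (5 * 2 ^ j) _ _ E A2) ys.
      by elim: l => //= l IHl ys; rewrite IHl !sz_sqn.
    exact: key.
  have main t : [seq rank x | x <- (t : (5 * 2 ^ j).-tuple V)] = encode j M xs ->
    t \in (step S c).2 true <-> PS (sqn j (base_model (step S c).1 S.2)) (nth 0 xs).
    move=> et; rewrite inE /= hS // /big_model et.
    by apply: PS_ext => i hi; rewrite -(ext S.2) joinn_encode.
  split; first by move=> [t [et ht]]; apply/(main t et).
  move=> h; have hall : all (fun x => x < #|V|) (encode j M xs).
    by apply: (@encode_lt j M) => //; rewrite sz_sqn.
  have [x0 _] : exists x0 : V, rank x0 = 0 by apply: rank_onto.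
  pose un i := [pick x : V | rank x == i].
  pose ys := [seq odflt x0 (un i) | i <- encode j M xs].
  have hys : size ys == 5 * 2 ^ j by rewrite size_map size_encode h5.
  have e : [seq rank x | x <- Tuple hys] = encode j M xs.
    rewrite /= -map_comp; apply/map_id_in => i hi /=.
    move/allP: hall => /(_ i hi) /rank_onto[x hx]; rewrite /un; case: pickP => [y /eqP //|/(_ x)].
    by rewrite hx eqxx.
  by exists (Tuple hys); split=> //; apply/(main _ e).
- move=> S c u v; rewrite inE /= -hA.
  by rewrite inE.
Qed.

End Program.

(** * Reachability and the inverse of (n+1) I - A *)

Section ReachMatrix.
Variables (n : nat) (g : nat -> nat -> Prop).
Notation greach := (connect [rel i j : 'I_n | `[< g i j >]]).

Lemma reach_mx_map (F : nzRingType) : reach_mx F n g = map_mx (intr : int -> F) (reach_mx int n g).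
Proof.
apply/matrixP => i j; rewrite !mxE rmorphB rmorph_nat /= rmorphMn /=.
by rewrite rmorph_nat.
Qed.

Local Open Scope ring_scope.

Let A := reach_mx rat n g.

Lemma mul_reach_mx (v : 'rV[rat]_n) j :
  (v *m A) 0 j = n.+1%:R * v 0 j - \sum_i v 0 i * (`[< g i j >] : nat)%:R.
Proof.
rewrite /A /reach_mx mulmxBr mul_mx_scalar [LHS]mxE [X in _ + X]mxE; congr (_ - _); rewrite mxE //.
by apply: eq_bigr => i _; rewrite !mxE.
Qed.

Lemma sum_adj_le (F : 'I_n -> rat) (b : 'I_n -> bool) (c : rat) : 0 <= c -> (forall i, b i -> F i <= c) ->
  \sum_i F i * (b i : nat)%:R <= n%:R * c.
Proof.
move=> c0 h; apply: (@le_trans _ _ (\sum_(i < n) c)).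
  by apply: ler_sum => i _; have := h i; case: (b i) => /= hi; rewrite ?mulr1 ?mulr0 // hi.
by rewrite sumr_const card_ord mulr_natl.
Qed.

Lemma mulS_le (c : rat) : n.+1%:R * c <= n%:R * c -> c <= 0.
Proof. by rewrite -natr1 mulrDl mul1r gerDl. Qed.

(** Strict diagonal dominance: the largest absolute value c in a left kernel vector satisfies (n+1)
    c <= n c. *)
Lemma reach_mx_det0 : \det A != 0.
Proof.
apply/negP => /det0P[v v0 vA]; move/negP: v0; apply; apply/eqP/rowP => j; rewrite mxE.
case: (@arg_maxP _ _ _ j predT (fun i => `|v 0 i|) isT) => l _ hl.
suff : `|v 0 l| <= 0.
  by move=> h; apply/eqP; rewrite -normr_le0; apply: le_trans (hl j isT) h.
apply: mulS_le; have := mul_reach_mx v l; rewrite vA mxE => /esym/eqP; rewrite subr_eq0 => /eqP e.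
rewrite -[n.+1%:R]normr_nat -normrM e; apply: (le_trans (ler_norm_sum _ _ _)).
under eq_bigr do rewrite normrM normr_nat.
by apply: (@sum_adj_le _ (fun i => `[< g i l >])) => // i _; apply: hl.
Qed.

Lemma reach_mx_unit : A \in unitmx.
Proof. by rewrite unitmxE unitfE reach_mx_det0. Qed.

Let B := invmx A.

(** The equation [B *m A = 1] entrywise. Nonnegativity and vanishing of entries follow by evaluating
    it at a minimal or maximal entry, which replaces the convergence of the Neumann series. *)
Lemma inv_reach_mx s j :
  n.+1%:R * B s j = (s == j)%:R + \sum_i B s i * (`[< g i j >] : nat)%:R.
Proof.
have rE i : row s B 0 i = B s i by rewrite mxE.
have := mul_reach_mx (row s B) j; rewrite -row_mul mulVmx ?reach_mx_unit // rE.
by under eq_bigr do rewrite rE; rewrite [row _ _ _ _]mxE [1%:M _ _]mxE => ->; rewrite subrK.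
Qed.

Lemma inv_reach_ge0 s j : 0 <= B s j.
Proof.
case: (@arg_minP _ _ _ j predT (B s) isT) => l _ hl.
apply: (le_trans _ (hl j isT)); rewrite leNgt; apply/negP => l0.
have : n.+1%:R * (- B s l) <= n%:R * (- B s l).
  rewrite mulrN inv_reach_mx opprD; apply: (@le_trans _ _ (\sum_i (- B s i) * (`[< g i l >] : nat)%:R)).
    rewrite -sumrN; under [X in _ <= X]eq_bigr do rewrite mulNr.
    by rewrite gerDr oppr_le0 ler0n.
  apply: (@sum_adj_le _ (fun i => `[< g i l >])); first by rewrite oppr_ge0 ltW.
  by move=> i _; rewrite lerN2; apply: hl.
by move/mulS_le; rewrite oppr_le0 leNgt l0.
Qed.

Lemma inv_reach_gt0 s t : greach s t -> 0 < B s t.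
Proof.
have n0 : (0 : rat) < n.+1%:R by rewrite ltr0n.
have b0 : 0 < B s s.
  rewrite -(pmulr_rgt0 _ n0) inv_reach_mx eqxx; apply: (@lt_le_trans _ _ 1) => //.
  rewrite lerDl; apply: sumr_ge0 => i _; rewrite mulr_ge0 ?inv_reach_ge0 //.
move=> /connectP[p]; elim/last_ind: p t => [|p x IH] t /=; first by move=> _ ->.
rewrite rcons_path last_rcons => /andP[hp /= hg] ->; have {}IH := IH _ hp erefl.
rewrite -(pmulr_rgt0 _ n0) inv_reach_mx; apply: (lt_le_trans IH).
rewrite (bigD1 (last s p)) //= hg mulr1 addrCA lerDl addr_ge0 // sumr_ge0 // => i _.
by rewrite mulr_ge0 // inv_reach_ge0.
Qed.

(** Predecessors of an unreachable node are unreachable, so the largest entry c over the unreachable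
    nodes satisfies (n+1) c <= n c. *)
Lemma inv_reach_eq0 s t : ~~ greach s t -> B s t = 0.
Proof.
move=> ht; apply/eqP; rewrite eq_le inv_reach_ge0 andbT.
case: (@arg_maxP _ _ _ t (fun i => ~~ greach s i) (B s) ht) => l hl hmax.
apply: (le_trans (hmax t ht)); apply: mulS_le; rewrite inv_reach_mx.
have -> : (s == l) = false by apply/eqP => e; move/negP: hl; apply; rewrite e connect0.
rewrite add0r; apply: (@sum_adj_le _ (fun i => `[< g i l >])); first exact: inv_reach_ge0.
move=> i hg; apply: hmax; apply: contra hl => hi.
exact: connect_trans hi (connect1 hg).
Qed.

(** The adjugate clears the denominator: its entries are integers, which can be reduced modulo p and
    bounded by n! (n+1)^n. *)
Lemma adj_reach s t : (\adj (reach_mx int n g)) s t != 0 <-> greach s t.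
Proof.
have e : B s t = (\det A)^-1 * ((\adj (reach_mx int n g)) s t)%:~R.
  rewrite /B /invmx reach_mx_unit mxE /A reach_mx_map -map_mx_adj; congr (_ * _).
  by rewrite mxE.
have d0 : (\det A)^-1 != 0 by rewrite invr_eq0 reach_mx_det0.
split=> h.
  apply: contraT => /inv_reach_eq0; rewrite e => /eqP; rewrite mulf_eq0 (negbTE d0) /= intr_eq0.
  by rewrite (negbTE h).
have := inv_reach_gt0 h; rewrite e lt0r => /andP[h0 _]; move: h0.
by rewrite mulf_eq0 (negbTE d0) /= intr_eq0.
Qed.

Lemma det_reach_int : \det (reach_mx int n g) != 0.
Proof.
by have := reach_mx_det0; rewrite /A reach_mx_map det_map_mx intr_eq0.
Qed.

Lemma reach_mx_entry i j : (`|reach_mx int n g i j| <= n.+1)%N.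
Proof. by rewrite !mxE; case: (i == j); case: `[< _ >]; rewrite /= ?mulr1n ?mulr0n; lia. Qed.

Lemma det_reach_le : (`|\det (reach_mx int n g)| <= n`! * n.+1 ^ n)%N.
Proof. by apply: det_absz_le => i j; exact: reach_mx_entry. Qed.

Lemma adj_reach_le s t : (`|(\adj (reach_mx int n g)) s t| <= n`! * n.+1 ^ n)%N.
Proof.
rewrite mxE /cofactor abszM abszX abszN1 exp1n mul1n.
apply: (@leq_trans (n.-1`! * n.+1 ^ n.-1)%N).
  by apply: det_absz_le => i j; rewrite !mxE -[X in (`|X| <= _)%N]/(_ - _); have := reach_mx_entry (lift t i) (lift s j); rewrite !mxE.
by apply: leq_mul; [case: (n) => // m; rewrite factS leq_pmull | rewrite leq_pexp2l // leq_pred].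
Qed.

Section ModP.
Variables (p : nat) (pp : prime p).

Lemma intr_Fp_eq0 (z : int) : (z%:~R == 0 :> 'F_p) = (p %| `|z|)%N.
Proof.
case: z => m; first by rewrite -pmulrn Fp_eq0.
by rewrite NegzE rmorphN oppr_eq0 /= -pmulrn Fp_eq0.
Qed.

Lemma unit_reach_Fp : (reach_mx 'F_p n g \in unitmx) = ~~ (p %| `|\det (reach_mx int n g)|)%N.
Proof. by rewrite reach_mx_map unitmxE unitfE det_map_mx intr_Fp_eq0. Qed.

Lemma inv_reach_Fp s t : reach_mx 'F_p n g \in unitmx ->
  (invmx (reach_mx 'F_p n g) s t == 0) = (p %| `|(\adj (reach_mx int n g)) s t|)%N.
Proof.
move=> u; rewrite /invmx u mxE mulf_eq0 invr_eq0.
have -> : (\det (reach_mx 'F_p n g) == 0) = false by apply/negbTE; rewrite -unitfE -unitmxE.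
by rewrite /= reach_mx_map -map_mx_adj mxE intr_Fp_eq0.
Qed.

End ModP.
End ReachMatrix.

(** * The dynamic program *)

(* The first entry of a stored tuple is a tag: 0 initialised, 1 previous graph, 2 stage of the second
   copy, 3 first copy, 4 second copy. *)
Definition ini M := au M [:: 0; 0; 0; 0; 0].
Definition Eold M u v := au M [:: 1; 0; u; v; 0].
Definition tau M := mu (sz M) (fun t => au M [:: 2; 0; 0; 0; t]).
(** The inverse of (n+1) I modulo p, belonging to the empty graph. *)
Definition fresh M p u v z := prange M p /\ (z < p /\ (u < nn M /\ (v < nn M /\
  ((u = v /\ tr M (z * (nn M).+1) %% p = 1) \/ (~ u = v /\ z = 0))))).
(** All relations start empty, which is not a table of an inverse; until the flag [ini] is set, the
    table of the empty graph is read instead. *)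
Definition stored M tag p u v z := prange M p /\ (z < p /\
  ((ini M /\ au M [:: tag; p; u; v; z]) \/ (~ ini M /\ fresh M p u v z))).

(* The second copy is rebuilt from the empty graph, one edge position per step. *)
Definition back_old M u v := Eold M u v /\ u * nn M + v < tau M.
Definition back_new M u v := ed M u v /\ u * nn M + v <= tau M.

Definition new_main M := Upd M (Eold M) (ed M) (stored M 3).
Definition new_back M := Upd M (back_old M) (back_new M) (stored M 4).
Definition going M := tr M (tau M).+1 < nn M * nn M.
Definition next_tau M := cif (going M) (tr M (tau M).+1) 0.
Definition next_main M p u v z :=
  (going M /\ new_main M p u v z) \/ (~ going M /\ new_back M p u v z).
Definition next_back M p u v z :=
  (going M /\ new_back M p u v z) \/ (~ going M /\ fresh M p u v z).

Definition next_aux M (e : env) :=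
  (e 0 = 0 /\ (e 1 = 0 /\ (e 2 = 0 /\ (e 3 = 0 /\ e 4 = 0)))) \/
  ((e 0 = 1 /\ (e 1 = 0 /\ (e 4 = 0 /\ ed M (e 2) (e 3)))) \/
  ((e 0 = 2 /\ (e 1 = 0 /\ (e 2 = 0 /\ (e 3 = 0 /\ e 4 = next_tau M)))) \/
  ((e 0 = 3 /\ next_main M (e 1) (e 2) (e 3) (e 4)) \/
   (e 0 = 4 /\ next_back M (e 1) (e 2) (e 3) (e 4))))).

Definition next_answer M (e : env) :=
  exists2 p, p < sz M & exists2 z, z < sz M & 0 < z /\ next_main M p (e 0) (e 1) z.

Lemma d_ini : dpred goodM (fun M _ => ini M).
Proof. by rewrite /ini; dp. Qed.

Lemma d_Eold f g : dval goodM f -> dval goodM g -> dpred goodM (fun M e => Eold M (f M e) (g M e)).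
Proof. by move=> hf hg; rewrite /Eold; dp. Qed.

Lemma dval_tau : dval goodM (fun M _ => tau M).
Proof. by rewrite /tau; dp. Qed.

Lemma d_fresh p u v z : dval goodM p -> dval goodM u -> dval goodM v -> dval goodM z ->
  dpred goodM (fun M e => fresh M (p M e) (u M e) (v M e) (z M e)).
Proof. by move=> hp hu hv hz; have h := d_prange hp; rewrite /fresh; dp. Qed.

Lemma d_stored tag p u v z : tag <= 24 -> dval goodM p -> dval goodM u -> dval goodM v -> dval goodM z ->
  dpred goodM (fun M e => stored M tag (p M e) (u M e) (v M e) (z M e)).
Proof.
move=> ht hp hu hv hz; have h := d_prange hp; have h1 := d_ini; have h2 := d_fresh.
by have h3 := dval_c ht; rewrite /stored; dp.
Qed.

Lemma d_new_main p u v z : dval goodM p -> dval goodM u -> dval goodM v -> dval goodM z ->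
  dpred goodM (fun M e => new_main M (p M e) (u M e) (v M e) (z M e)).
Proof.
apply: (d_Upd (g0 := Eold) (g1 := ed) (B := fun M => stored M 3)).
- exact: d_Eold.
- by move=> f g hf hg; apply: d_edge.
- by move=> *; apply: d_stored.
Qed.

Lemma d_new_back p u v z : dval goodM p -> dval goodM u -> dval goodM v -> dval goodM z ->
  dpred goodM (fun M e => new_back M (p M e) (u M e) (v M e) (z M e)).
Proof.
have h1 := d_Eold; have h2 := dval_tau.
apply: (d_Upd (g0 := back_old) (g1 := back_new) (B := fun M => stored M 4)).
- by move=> f g hf hg; rewrite /back_old; dp.
- by move=> f g hf hg; rewrite /back_new; dp.
- by move=> *; apply: d_stored.
Qed.

Lemma d_going : dpred goodM (fun M _ => going M).
Proof. by have h := dval_tau; rewrite /going; dp. Qed.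

Lemma d_next_main p u v z : dval goodM p -> dval goodM u -> dval goodM v -> dval goodM z ->
  dpred goodM (fun M e => next_main M (p M e) (u M e) (v M e) (z M e)).
Proof.
move=> hp hu hv hz; have h := d_going; rewrite /next_main.
by apply: d_or; apply: d_and; [exact: h|exact: d_new_main|exact: d_not|exact: d_new_back].
Qed.

Lemma d_next_back p u v z : dval goodM p -> dval goodM u -> dval goodM v -> dval goodM z ->
  dpred goodM (fun M e => next_back M (p M e) (u M e) (v M e) (z M e)).
Proof.
move=> hp hu hv hz; have h := d_going; rewrite /next_back.
by apply: d_or; apply: d_and; [exact: h|exact: d_new_back|exact: d_not|exact: d_fresh].
Qed.

Lemma d_next_aux : dpred goodM next_aux.
Proof.
have h1 := d_going; have h2 := dval_tau; rewrite /next_aux.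
have h3 : dval goodM (fun M _ => next_tau M) by rewrite /next_tau; dp.
have v i := dval_var goodM i.
do 3![apply: d_or; first by dp].
by apply: d_or; (apply: d_and; first by dp); [exact: d_next_main|exact: d_next_back].
Qed.

Lemma d_next_answer : dpred goodM next_answer.
Proof.
rewrite /next_answer; have v i := dval_var goodM i.
apply: d_ex; apply: d_ex; apply: d_and; first by dp.
exact: d_next_main.
Qed.

Lemma next_aux_ext M e e' : (forall i, i < 5 -> e i = e' i) -> next_aux M e <-> next_aux M e'.
Proof. by move=> h; rewrite /next_aux !h. Qed.

(** * The invariant of the two copies *)

Definition det_bound n := n`! * n.+1 ^ n.

(* [D] collects the determinants met by the copy: only their prime divisors are lost. *)
Definition copy_ok M B g age := exists D, [/\ 0 < D, D <= det_bound (nn M) ^ age &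
  forall p, prange M p -> tabulates (nn M) p g B \/
    (p %| D /\ forall (u v : 'I_(nn M)) z, ~ B p u v z)].

Lemma det_bound_gt0 n : 0 < det_bound n.
Proof. by rewrite muln_gt0 fact_gt0 expn_gt0. Qed.

Lemma copy_ok_le M B g a b : a <= b -> copy_ok M B g a -> copy_ok M B g b.
Proof.
move=> ab [D [h1 h2 h3]]; exists D; split=> //; apply: (leq_trans h2).
by rewrite leq_pexp2l // det_bound_gt0.
Qed.

Lemma eq_reach_mx (F : nzRingType) n (g g' : nat -> nat -> Prop) : (forall u v : 'I_n, g u v <-> g' u v) ->
  reach_mx F n g = reach_mx F n g'.
Proof.
move=> h; rewrite /reach_mx; congr (_ - _)%R; apply/matrixP => i j; rewrite !mxE.
by rewrite (asbool_equiv_eq (h i j)).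
Qed.

Lemma copy_ok_ext M M' (B B' : nat -> nat -> nat -> nat -> Prop) (g g' : nat -> nat -> Prop) a : nn M = nn M' ->
  (forall u v : 'I_(nn M), g u v <-> g' u v) ->
  (forall p, prange M p -> forall (u v : 'I_(nn M)) z, B p u v z <-> B' p u v z) ->
  copy_ok M B g a -> copy_ok M' B' g' a.
Proof.
rewrite /copy_ok /prange => <- hg hB [D [h1 h2 h3]]; exists D; split=> // p hp.
have [[t1 t2]|[d1 d2]] := h3 p hp; [left|right].
  by rewrite /tabulates -(eq_reach_mx _ hg); split=> // u v z; rewrite -hB.
by split=> // u v z; rewrite -hB.
Qed.

Section Step.
Variable M : model.
Hypothesis hM : goodM M.
Let n := nn M.

Lemma nn_ge : 2 ^ 24 <= n.
Proof. by case: (hM) => _ h _; apply: leq_trans (YM_ge hM) h. Qed.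

Let n128 : 128 <= n.
Proof. by apply: leq_trans nn_ge; apply: (@leq_trans (2 ^ 7)) => //; rewrite leq_exp2l. Qed.

Lemma nn7_lt : n ^ 7 + n ^ 7 < sz M.
Proof.
case: (hM) => _ _; apply: leq_trans; have Y0 : 0 < YM M ^ 3 by rewrite expn_gt0 (YM_gt0 hM).
have P0 : 0 < nn M ^ 7 by rewrite expn_gt0 (leq_trans _ n128).
have -> : nn M ^ 8 = n * nn M ^ 7 by rewrite -expnS.
rewrite -/n in P0 *; move: (n ^ 7) P0 => P P0.
apply: (@leq_trans (16 * (n * P) * 1)); last by rewrite leq_mul2l Y0 orbT.
have : P <= n * P by rewrite leq_pmull //; apply: leq_trans n128.
lia.
Qed.

Lemma prange_lt p : prange M p -> n.+1 < p /\ p * n.+1 < sz M.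
Proof.
move=> [pp [h1 h2]]; rewrite -/n in h1 h2; have h7 := nn7_lt.
have e3 : n ^ 3 = n * (n * n) by rewrite !expnS expn0 muln1.
split; first by apply: leq_ltn_trans h1; rewrite e3; nia.
apply: leq_ltn_trans h7; apply: (@leq_trans (n ^ 6 * n.+1)); first by rewrite leq_mul2r h2 orbT.
rewrite mulnS -expnSr leq_add2r leq_pexp2l //; exact: leq_trans n128.
Qed.

(** p > n + 1 makes n + 1 invertible modulo every p in the range, so no prime is lost and D = 1 at
    age 0. *)
Lemma copy_fresh : copy_ok M (fresh M) (fun _ _ => False) 0.
Proof.
exists 1; split=> // p hp; left; have [pp _] := hp; have [h1 h2] := prange_lt hp.
have e : reach_mx 'F_p (nn M) (fun _ _ => False) = ((nn M).+1%:R)%:M%R.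
  rewrite /reach_mx (_ : adj_mx _ _ _ = 0%R) ?subr0 //; apply/matrixP => i j; rewrite !mxE.
  by rewrite asboolF.
have nz : ((nn M).+1%:R : 'F_p)%R != 0%R.
  by rewrite Fp_eq0 //; apply/negP => /dvdn_leq; rewrite -/n; lia.
rewrite /tabulates e; split; first by rewrite unitmxE det_scalar unitfE expf_neq0.
move=> u v z; rewrite invmx_scalar mxE; split.
  move=> [_ [zp [_ [_ [[uv hz]|[uv ->]]]]]]; split=> //.
    move/val_inj: uv => ->; rewrite eqxx mulr1n; apply: (mulIf nz); rewrite mulVf // -natrM.
    rewrite trE in hz; last by apply: leq_ltn_trans h2; rewrite leq_mul2r ltnW ?orbT.
    by apply/eqP; rewrite -[1%R]/(1%:R)%R Fp_eq // hz modn_small // prime_gt1.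
  - exact: prime_gt0.
  by rewrite (_ : u == v = false) ?mulr0n //; apply/eqP => h; apply: uv; rewrite h.
move=> [zp hz]; split=> //; split=> //; split=> //; split=> //.
have [uv|uv] := eqVneq u v; [left|right].
  split; first by rewrite uv.
  rewrite trE; last by apply: leq_ltn_trans h2; rewrite leq_mul2r ltnW ?orbT.
  rewrite -[RHS](modn_small (prime_gt1 pp)); apply/eqP; rewrite -Fp_eq // natrM hz uv eqxx mulr1n.
  by rewrite mulVf.
split; first by move=> h; move/eqP: uv; apply; apply: val_inj.
apply/eqP; rewrite -(modn_small zp) -(mod0n p) -Fp_eq // hz (negbTE uv) mulr0n.
by [].
Qed.

(** If p divides the new determinant, [Upd] accepts no z; its condition on [z0] keeps an empty table
    empty. Hence multiplying D by the new determinant accounts for all lost primes. *)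
Lemma copy_step B g0 g1 a :
  size [seq u <- iota 0 (nn M) | `[< changed M g0 g1 u >]] * 2 + 1 <= TM M ->
  copy_ok M B g0 a -> copy_ok M (Upd M g0 g1 B) g1 a.+1.
Proof.
move=> hk [D [h1 h2 h3]]; exists (D * `|(\det (reach_mx int (nn M) g1))%R|%N); split.
- by rewrite muln_gt0 h1 absz_gt0 det_reach_int.
- by rewrite expnSr leq_mul // det_reach_le.
move=> p hp; have [pp _] := hp; have [ht|[d1 d2]] := h3 p hp; last first.
  right; split; first exact: dvdn_mulr.
  by move=> u v z [_ [_ [_ [_ [[z0 _ hz] _]]]]]; exact: (d2 u v z0 hz).
have hk' : size [seq u <- iota 0 (nn M) | `[< changed M g0 g1 u >]] +
  size [seq u <- iota 0 (nn M) | `[< changed M g0 g1 u >]] + 1 <= TM M by lia.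
have hU := UpdP hM hp hk' ht.
have [u1|nu1] := boolP (reach_mx 'F_p (nn M) g1 \in unitmx); [left|right].
  by split=> // u v z; rewrite hU; split=> [[]|].
split; first by move: nu1; rewrite unit_reach_Fp // negbK => h; rewrite dvdn_mull.
by move=> u v z /hU[]; rewrite (negbTE nu1).
Qed.

(** A copy takes over as the first one at age at most n^2 and then ages together with the stage
    [tau M] of its successor. *)
Definition Inv := tau M < n * n /\
  (copy_ok M (stored M 3) (Eold M) (n * n + tau M) /\ copy_ok M (stored M 4) (back_old M) (tau M)).

Variable k : nat.
Hypothesis hk : size [seq u <- iota 0 (nn M) | `[< changed M (Eold M) (ed M) u >]] <= k.
Hypothesis hkT : (k + 2) * 2 + 1 <= TM M.
Hypothesis hI : Inv.

Let nnN : n * n < sz M.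
Proof.
apply: leq_ltn_trans nn7_lt; rewrite mulnn; apply: (@leq_trans (n ^ 7)); last exact: leq_addr.
by rewrite leq_pexp2l // (leq_trans _ n128).
Qed.

Let tauN : tr M (tau M).+1 = (tau M).+1.
Proof. by rewrite trE //; case: hI => h _; apply: leq_ltn_trans nnN. Qed.

(** Beyond the nodes touched by the change, only the two endpoints of the edge position [tau M] can
    differ, where the strict comparison becomes a weak one; this is the 2 in k + 2. *)
Lemma back_changed :
  size [seq u <- iota 0 (nn M) | `[< changed M (back_old M) (back_new M) u >]] <= k + 2.
Proof.
set s := [seq _ <- _ | _]; set s0 := [seq u <- iota 0 (nn M) | `[< changed M (Eold M) (ed M) u >]].
apply: (@leq_trans (size (s0 ++ [:: tau M %/ n; tau M %% n]))); last first.
  by rewrite size_cat /= leq_add2r.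
apply: uniq_leq_size; first by rewrite filter_uniq // iota_uniq.
move=> u; rewrite mem_filter => /andP[/asboolP[un [v vN [vn h]]] hu].
rewrite mem_cat mem_filter hu andbT.
have [c|nc] := boolP (u \in [:: tau M %/ n; tau M %% n]); first by rewrite orbT.
have n0 : 0 < n by apply: leq_trans n128.
have code x y : x < n -> y < n -> x * n + y = tau M -> x = tau M %/ n /\ y = tau M %% n.
  by move=> xn yn <-; rewrite divnMDl // modnMDl divn_small // modn_small // addn0.
have ne1 : u * n + v <> tau M.
  by move=> /(code _ _ un vn)[e _]; move: nc; rewrite e !inE eqxx.
have ne2 : v * n + u <> tau M.
  by move=> /(code _ _ vn un)[_ e]; move: nc; rewrite e !inE eqxx orbT.
rewrite orbF; apply/asboolP; split=> //; exists v => //; split=> //.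
have lt1 : (u * n + v <= tau M) = (u * n + v < tau M) by rewrite [LHS]leq_eqVlt; case: eqP.
have lt2 : (v * n + u <= tau M) = (v * n + u < tau M) by rewrite [LHS]leq_eqVlt; case: eqP.
move: h; rewrite /back_old /back_new -/n lt1 lt2.
by case: (_ < tau M); case: (_ < tau M); intuition.
Qed.

Lemma new_main_ok : copy_ok M (new_main M) (ed M) (n * n + tau M).+1.
Proof. by apply: copy_step; [lia | case: hI => _ []]. Qed.

Lemma new_back_ok : copy_ok M (new_back M) (back_new M) (tau M).+1.
Proof. by apply: copy_step; [have := back_changed; lia | case: hI => _ []]. Qed.

Lemma going_E : going M <-> (tau M).+1 < n * n.
Proof. by rewrite /going tauN. Qed.

Lemma next_tau_lt : next_tau M < n * n.
Proof.
rewrite /next_tau /cif; case: asboolP => [/going_E|_]; first by rewrite tauN.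
by rewrite muln_gt0 (leq_trans _ n128).
Qed.

Lemma next_main_ok : copy_ok M (next_main M) (ed M) (n * n + next_tau M).
Proof.
rewrite /next_tau /next_main; have [h|h] := pselect (going M).
  rewrite cifT // tauN addnS; apply: copy_ok_ext new_main_ok => //.
  by move=> p _ u v z; tauto.
rewrite cifF // addn0; have ht : tau M < n * n by case: hI.
apply: (@copy_ok_le _ _ _ (tau M).+1) => //.
apply: copy_ok_ext new_back_ok => //; last by move=> p _ u v z; tauto.
(* At the hand-over [tau M] is the last position n^2 - 1, so the rebuilt copy contains every
   edge. *)
move=> u v; rewrite /back_new; split; first by case.
move=> e; split=> //; have /negP := fun h' => h (iffRL going_E h'); rewrite -leqNgt => hn.
have := ltn_ord u; have := ltn_ord v; rewrite -/n => hv hu.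
have : u * n + v < n * n.
  by apply: (@leq_trans (u.+1 * n)); [rewrite mulSnr ltn_add2l | rewrite leq_mul2r hu orbT].
by move=> hlt; rewrite -ltnS; apply: leq_trans hlt hn.
Qed.

Lemma next_back_ok : copy_ok M (next_back M) (fun u v => ed M u v /\ u * n + v < next_tau M) (next_tau M).
Proof.
rewrite /next_tau /next_back; have [h|h] := pselect (going M).
  rewrite cifT // tauN; apply: copy_ok_ext new_back_ok => //.
  by move=> p _ u v z; tauto.
rewrite cifF //; apply: copy_ok_ext copy_fresh => //; last by move=> p _ u v z; tauto.
by move=> u v; split=> // -[_]; rewrite ltn0.
Qed.

(** [det_bound n] is at most (n+1)^(2n) <= 2^(2 n^2), so the exponent 4 n^4 is compared with n^6 /
    4. *)
Lemma det_bound_exp_lt : det_bound n ^ (2 * (n * n)) < 2 ^ ((n ^ 3) ^ 2 %/ 4).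
Proof.
have h1 : det_bound n <= 2 ^ (2 * n * n).
  rewrite /det_bound; apply: (@leq_trans (n.+1 ^ n * n.+1 ^ n)).
    by rewrite leq_mul2r; apply/orP; right; apply: leq_trans (fact_le_exp n) _; rewrite leq_exp2r // (leq_trans _ n128).
  rewrite -expnD addnn -mul2n [2 * n * n]mulnC [2 ^ _]expnM leq_exp2r ?muln_gt0 ?(leq_trans _ n128) //.
  exact: ltn_expl.
apply: (@leq_ltn_trans ((2 ^ (2 * n * n)) ^ (2 * (n * n)))).
  by rewrite leq_exp2r // muln_gt0 muln_gt0 (leq_trans _ n128).
rewrite -expnM ltn_exp2l // -expnM.
have -> : n ^ (3 * 2) = (n * n) * (n * n) * (n * n) by rewrite !expnS expn0 muln1 !mulnA.
have hN : 128 * 128 <= n * n by apply: leq_mul.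
have -> : 2 * n * n = 2 * (n * n) by rewrite mulnA.
move: (n * n) hN => N hN.
have : 128 * 128 * (N * N) <= N * (N * N) by rewrite leq_mul2r hN orbT.
rewrite -[N * N * N]mulnA.
have : 1 <= N * N by rewrite muln_gt0 (leq_trans _ hN).
lia.
Qed.

Lemma next_answer_ok (u v : 'I_(nn M)) :
  next_answer M (nth 0 [:: u : nat; v : nat]) <->
  connect [rel i j : 'I_(nn M) | `[< ed M i j >]] u v.
Proof.
have [D [D0 hD hp]] := next_main_ok.
have main_range p z : next_main M p u v z -> prange M p by case=> -[_ []].
split.
  move=> [p pN [z zN [z0 /= hz]]]; have hpr := main_range _ _ hz; have [pp _] := hpr.
  have [[un ht]|[_ nh]] := hp p hpr; last by case: (nh u v z).
  have /ht [zp ez] := hz; apply/(adj_reach (ed M)).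
  apply/negP => /eqP a0; have := inv_reach_Fp pp u v un; rewrite a0 dvdn0 -ez Fp_eq0 //.
  by move=> /dvdn_leq; lia.
move=> hr; have a0 : (\adj (reach_mx int (nn M) (ed M)))%R u v != 0%R by apply/adj_reach.
set a := `|(\adj (reach_mx int (nn M) (ed M)))%R u v|%N.
have ha : 0 < a by rewrite absz_gt0.
(* One prime must avoid both D, so that its table is intact, and the adjugate entry, so that the
   entry stays nonzero modulo p; the entry costs one more factor [det_bound n]. *)
have [||p [pp hp3 nd]] := @prime_ndvd_exists (n ^ 3) (D * a).
- by apply: (leq_trans n128); rewrite -{1}(expn1 n) leq_pexp2l // (leq_trans _ n128).
- rewrite muln_gt0 D0 ha /=; apply: leq_ltn_trans det_bound_exp_lt.
  apply: (@leq_trans (det_bound n ^ (n * n + next_tau M).+1)).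
    by rewrite expnSr leq_mul // adj_reach_le.
  by rewrite leq_pexp2l ?det_bound_gt0 //; have := next_tau_lt; lia.
have hpr : prange M p by split=> //; move: hp3; rewrite -expnM => /andP[].
move: nd; rewrite Euclid_dvdM // negb_or => /andP[ndD nda].
have [[un ht]|[h _]] := hp p hpr; last by rewrite h in ndD.
have := inv_reach_Fp pp u v un; rewrite -/a (negbTE nda) => /negbT nz.
have [hp1 hp2] := prange_lt hpr.
have pN : p < sz M by apply: leq_ltn_trans hp2; rewrite leq_pmulr.
set x := invmx _ u v in nz; exists p => //; exists (x : nat).
  by apply: ltn_trans pN; apply: Fp_val_lt.
split; first by rewrite lt0n.
by apply/ht; rewrite Fp_natr_val; split=> //; apply: Fp_val_lt.
Qed.

End Step.

Lemma Inv_init M : goodM M -> (forall xs, ~ au M xs) -> Inv M.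
Proof.
move=> hM h; have n0 : 0 < nn M by case: (hM) => _ hY _; apply: leq_trans (YM_gt0 hM) hY.
have t0 : tau M = 0 by apply: mu_none => x _; exact: h.
have st tag p : prange M p -> forall (u v : 'I_(nn M)) z, fresh M p u v z <-> stored M tag p u v z.
  move=> hp u v z; rewrite /stored /ini; split=> [hf|[_ [_ [[/h] //|[]//]]]].
  by split=> //; split; [case: hf => _ []|right; split=> //; exact: h].
rewrite /Inv t0 muln_gt0 n0 addn0; split=> //; split.
  apply: (@copy_ok_le _ _ _ 0) => //; apply: copy_ok_ext (copy_fresh hM) => //; last exact: st.
  by move=> u v; split=> // /h.
apply: copy_ok_ext (copy_fresh hM) => //; last exact: st.
by move=> u v; split=> // -[/h].
Qed.

(** M joins the changed graph with the old relations and is where the formulas are evaluated; M'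
    carries the new relations, next to whatever graph comes afterwards. *)
Lemma Inv_step M M' k : goodM M -> sz M' = sz M -> nn M' = nn M ->
  size [seq u <- iota 0 (nn M) | `[< changed M (Eold M) (ed M) u >]] <= k ->
  (k + 2) * 2 + 1 <= TM M -> Inv M ->
  (forall xs, size xs = 5 -> all (fun x => x < sz M) xs -> (au M' xs <-> next_aux M (nth 0 xs))) ->
  Inv M' /\ forall u v, u < nn M -> v < nn M -> (Eold M' u v <-> ed M u v).
Proof.
move=> hM hsz hnn hk hkT hI hau.
have N24 c : c <= 24 -> c < sz M by exact: goodM_gt.
have nN u : u < nn M -> u < sz M by move=> hu; apply: ltn_trans hu (nn_lt_sz hM).
have hE u v : u < nn M -> v < nn M -> (Eold M' u v <-> ed M u v).
  move=> hu hv; rewrite /Eold hau //=; last by rewrite (N24 1) // (N24 0) // !nN.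
  rewrite /next_aux /=; split; last by move=> h; right; left.
  by case=> [[]//|[[_ [_ [_ h]]]//|[[]//|[[]//|[]//]]]].
have hini : ini M'.
  by apply/hau => //; [rewrite /= (N24 0)|left].
have htau : tau M' = next_tau M.
  have hlt := next_tau_lt hM hI.
  have tN : next_tau M < sz M.
    apply: ltn_trans hlt _; apply: leq_ltn_trans (nn7_lt hM); rewrite mulnn.
    apply: (@leq_trans (nn M ^ 7)); last exact: leq_addr.
    by rewrite leq_pexp2l //; case: (hM) => _ hY _; apply: leq_trans (YM_gt0 hM) hY.
  rewrite /tau hsz; apply: mu_eq => //.
    by apply/hau => //; [rewrite /= (N24 2) // (N24 0) // tN|right; right; left].
  move=> t ht; rewrite hau //=; last by rewrite (N24 2) // (N24 0) // ht.
  by case=> [[]//|[[]//|[[_ [_ [_ [_ h]]]]//|[[]//|[]//]]]].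
have stE tag B : tag <= 4 -> (forall p u v z, B p u v z -> z < p) ->
    (forall p u v z, next_aux M (nth 0 [:: tag; p; u; v; z]) <-> B p u v z) ->
    forall p, prange M p -> forall (u v : 'I_(nn M)) z, B p u v z <-> stored M' tag p u v z.
  move=> ht Blt hB p hp u v z; have [hp1 hp2] := prange_lt hM hp.
  have pN : p < sz M by apply: leq_ltn_trans hp2; rewrite leq_pmulr.
  have hall : z < p -> all (fun x => x < sz M) [:: tag; p; u : nat; v : nat; z].
    move=> zp; have tagN : tag < sz M by apply: N24; lia.
    by rewrite /= tagN pN (nN u) ?ltn_ord // (nN v) ?ltn_ord // (ltn_trans zp pN).
  rewrite /stored /prange hnn -/(prange M p); split.
    move=> h; have zp := Blt _ _ _ _ h; split=> //; split=> //; left; split=> //.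
    by have [_] := hau [:: tag; p; u : nat; v : nat; z] erefl (hall zp); apply; apply/hB.
  by move=> [_ [zp [[_ hz]|[]//]]]; have [h _] := hau [:: tag; p; u : nat; v : nat; z] erefl (hall zp); apply/hB/h.
split=> //; rewrite /Inv hnn htau; split; first exact: next_tau_lt.
have Upd_lt g0 g1 B p u v z : Upd M g0 g1 B p u v z -> z < p by case=> _ [_ [_ []]].
split.
- apply: copy_ok_ext (next_main_ok hM hk hkT hI) => //.
    by move=> u v; rewrite hE.
  apply: stE => //; first by move=> p u v z [[_ /Upd_lt]|[_ /Upd_lt]].
  move=> p u v z; rewrite /next_aux /=; split; last by move=> h; right; right; right; left.
  by case=> [[]//|[[]//|[[]//|[[_ h]//|[]//]]]].
- apply: copy_ok_ext (next_back_ok hM hk hkT hI) => //.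
    by move=> u v; rewrite /back_old hE // hnn htau.
  apply: stE => //; first by move=> p u v z [[_ /Upd_lt]|[_ [_ []]]].
  move=> p u v z; rewrite /next_aux /=; split; last by move=> h; right; right; right; right.
  by case=> [[]//|[[]//|[[]//|[[]//|[_ h]//]]]].
Qed.

(** * Choice of the parameters *)

Lemma lin_lt_exp_half m : 24 <= m -> 26 * m < 2 ^ m./2.
Proof.
elim/ltn_ind: m => m IH hm; have [h|h] := leqP 26 m; last first.
  have hh : 12 <= m./2 by lia.
  apply: (@leq_trans (2 ^ 12)); last by rewrite leq_exp2l.
  by apply: (@leq_trans (26 * 26)); [lia | by []].
have := IH (m - 2) _ _; rewrite (_ : m./2 = (m - 2)./2.+1); last by lia.
by rewrite expnS => h'; have := h' ltac:(lia) ltac:(lia); lia.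
Qed.

Lemma lin_lt_exp m : 24 <= m -> 2000 * m <= 2 ^ m.
Proof.
move=> hm; have h := lin_lt_exp_half hm.
have : 2 ^ m./2 * 2 ^ m./2 <= 2 ^ m by rewrite -expnD leq_exp2l //; lia.
by nia.
Qed.

Definition lg n := trunc_log 2 n.

Lemma params_exist C : exists j m0, forall n, m0 <= lg (lg n) -> forall k, k * lg (lg n) <= C * lg n ->
  let N := n ^ (2 ^ j) in let Y := mu N (fun y => valid_base N y) in
  [/\ exists2 y, y < N & valid_base N y, Y <= n, 16 * n ^ 8 * Y ^ 3 <= N & (k + 2) * 2 + 1 <= ylog N Y].
Proof.
(* Below, T >= 2^j v / (26 m) up to rounding, with v = log n and m = log log n. From k m <= C v, the
   summand 52 C = 2 * 26 C gives room for 2 k digits, and 2000 covers the lower-order terms. *)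
have [j hj] : exists j, 52 * C + 2000 <= 2 ^ j by exists (52 * C + 2000); apply: ltnW; apply: ltn_expl.
exists j, (12 * j + 24) => n hm k hk N Y.
set v := lg n in hm hk; set m := lg v in hm hk; set c := 2 ^ j in hj N Y *.
have m24 : 24 <= m by lia.
have v0 : 0 < v by rewrite lt0n; apply/eqP => e; move: m24; rewrite /m e /lg trunc_log0.
have n0 : 0 < n by rewrite lt0n; apply/eqP => e; move: v0; rewrite /v e /lg trunc_log0.
have v1 : 2 ^ m <= v by apply: trunc_logP.
have v2 : v < 2 ^ m.+1 by apply: trunc_log_ltn.
have n1 : 2 ^ v <= n by apply: trunc_logP.
have n2 : n < 2 ^ v.+1 by apply: trunc_log_ltn.
have mv : 2000 * m <= v by apply: leq_trans v1; apply: lin_lt_exp.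
have c0 : 0 < c by lia.
have N1 : 2 ^ (v * c) <= N by rewrite expnM leq_exp2r.
have N2 : N < 2 ^ (v.+1 * c) by rewrite expnM ltn_exp2r.
have s128 : 128 <= 2 ^ (13 * m) by apply: (@leq_trans (2 ^ 7)) => //; rewrite leq_exp2l //; lia.
(* The window from 2^(13m) to 2^(26m) fits [valid_base]: T <= 2^(j+m+1) gives T^12 <= 2^(13m) for m
   >= 12 j + 24, and T >= 2^(m/2) gives T^64 >= 2^(26m). *)
have [|y [py /andP[y1 y2] _]] := prime_ndvd_exists (d := 1) s128.
  by rewrite /= -{1}(expn0 2) ltn_exp2l // divn_gt0 // -mulnn; nia.
have {}y2 : y <= 2 ^ (26 * m) by apply: (leq_trans y2); rewrite -expnM leq_exp2l //; lia.
have vc : 2000 * v <= v * c by rewrite mulnC leq_mul2l; apply/orP; right; lia.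
have yN : y < N.
  apply: leq_ltn_trans y2 _; apply: leq_trans N1; rewrite ltn_exp2l //; lia.
have yg : 1 < y := prime_gt1 py.
have Nle z t : 0 < z -> z <= y -> 26 * m * t < v * c -> z ^ t <= N.-1.
  move=> z0 zy ht; have : z ^ t < N; last by lia.
  apply: leq_trans N1; apply: (@leq_ltn_trans (2 ^ (26 * m * t))); last by rewrite ltn_exp2l.
  rewrite expnM; case: t {ht} => // t; rewrite leq_exp2r //; exact: leq_trans zy y2.
(* Stated for every base z <= y, because the program works with the least valid base Y instead of
   y. *)
have Tge z t : 1 < z -> z <= y -> 26 * m * t < v * c -> t <= ylog N z.
  by move=> z0 zy ht; apply: trunc_log_max => //; apply: Nle => //; lia.
have [t0 T1 T2] := ylog_bounds yg yN.
have Tle : ylog N y <= c * 2 ^ m.+1.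
  have h : 13 * m * ylog N y < v.+1 * c.
    rewrite -(ltn_exp2l _ _ (_ : 1 < 2)) //; apply: leq_ltn_trans N2; apply: ltnW.
    by apply: leq_ltn_trans T1; rewrite expnM leq_exp2r // ltnW.
  apply: (@leq_trans (v.+1 * c)); last by rewrite mulnC leq_mul2l v2 orbT.
  by apply: ltnW; apply: leq_ltn_trans h; rewrite leq_pmull //; lia.
have val : valid_base N y.
  rewrite /valid_base py /=; apply/and4P; split.
  - by rewrite /ymin -lock; apply: ltnW; apply: leq_ltn_trans y1; rewrite leq_exp2l //; lia.
  - by rewrite /ydeg -lock; apply: Tge => //; nia.
  - apply: (@leq_trans ((c * 2 ^ m.+1) ^ 12)); first by rewrite leq_exp2r.
    rewrite /c -expnD -expnM; apply: ltnW; apply: leq_ltn_trans y1; rewrite leq_exp2l //; lia.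
  - have h : 2 ^ (uphalf m) <= ylog N y.
      apply: Tge => //; apply: (@leq_trans (v * 1)); last by rewrite leq_mul2l c0 orbT.
      rewrite muln1; apply: leq_trans v1.
      have -> : 2 ^ m = 2 ^ m./2 * 2 ^ uphalf m by rewrite -expnD; congr (2 ^ _); lia.
      by rewrite ltn_pmul2r ?expn_gt0 // lin_lt_exp_half.
    rewrite /ydeg -lock; apply: (leq_trans y2); apply: (@leq_trans ((2 ^ uphalf m) ^ 64)).
      by rewrite -expnM leq_exp2l //; lia.
    by rewrite leq_exp2r.
have ex : exists2 y, y < N & valid_base N y by exists y.
have [YN Yval Ymin] := muP ex; rewrite -/Y in YN Yval Ymin.
have Yy : Y <= y by apply: Ymin.
have Y1 : 1 < Y by case/and5P: Yval => /prime_gt1.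
have Yn : Y ^ 3 <= n.
  apply: leq_trans n1; apply: (@leq_trans ((2 ^ (26 * m)) ^ 3)).
    by rewrite leq_exp2r // (leq_trans Yy).
  by rewrite -expnM leq_exp2l //; lia.
split=> //.
- by apply: leq_trans Yn; rewrite -{1}(expn1 Y) leq_pexp2l //; lia.
- have n16 : 16 <= n by apply: leq_trans n1; apply: (@leq_trans (2 ^ 4)) => //; rewrite leq_exp2l //; lia.
  apply: (@leq_trans (n * n ^ 8 * n)); first by rewrite leq_mul // leq_mul2r n16 orbT.
  by rewrite -expnS -expnSr /N leq_pexp2l //; lia.
apply: Tge => //.
have : 52 * (k * m) <= 52 * C * v by nia.
have : (52 * C + 2000) * v <= v * c by rewrite mulnC leq_mul2l hj orbT.
by nia.
Qed.

(** * Correctness of the dynamic program *)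

Lemma connect_homo (T T' : finType) (e : rel T) (e' : rel T') (h : T -> T') x y :
  (forall a b, e a b -> e' (h a) (h b)) -> connect e x y -> connect e' (h x) (h y).
Proof.
move=> hh /connectP[p]; elim: p x => [|z p IH] x /=; first by move=> _ ->; exact: connect0.
move=> /andP[xz hp] hy; apply: connect_trans (connect1 (hh _ _ xz)) (IH z hp hy).
Qed.

Section GraphOnRanks.
Variables (d : Order.disp_t) (V : finOrderType d) (E : {set V * V}).
Notation gE := [rel x y | (x, y) \in E].

Lemma connect_rank n (g : nat -> nat -> Prop) (hV : n = #|V|)
    (hg : forall x y : V, g (rank x) (rank y) <-> (x, y) \in E) (x y : V) (i j : 'I_n) :
  rank x = i -> rank y = j ->
  connect [rel i j : 'I_n | `[< g i j >]] i j <-> connect gE x y.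
Proof.
move=> hi hj; pose f x : 'I_n := cast_ord (esym hV) (Ordinal (rank_lt x)).
have fx z (l : 'I_n) : rank z = l -> f z = l by move=> h; apply/val_inj.
have /choice[h hh] : forall l : 'I_n, exists z : V, rank z = l.
  by move=> l; apply: rank_onto; rewrite -hV.
rewrite -(fx _ _ hi) -(fx _ _ hj); have hf z : h (f z) = z by apply: rank_inj; rewrite hh.
split.
  move/(connect_homo (h := h)); rewrite !hf; apply => a b /asboolP.
  by rewrite -(hh a) -(hh b) hg.
by apply: connect_homo => a b hab; apply/asboolP; apply/hg.
Qed.

Lemma reach_upto_connect i a (A : aux_state (two_ar a) V) (x y : V) : #|V| <= i ->
  reach_upto i (base_model E A) (rank x) (rank y) <-> connect gE x y.
Proof.
move=> hi; split.
  move=> {hi}; elim: i x => [|i IH] x /=; first by move=> /rank_inj ->; exact: connect0.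
  case=> [/rank_inj -> |[z _ [[u [v [/rank_inj -> <- huv]]] h]]]; first exact: connect0.
  exact: connect_trans (connect1 huv) (IH v h).
move=> /connectP[p0 hp0 ->]; case/shortenP: hp0 => p hp up _.
have hs : size p <= i.
  apply: leq_trans hi; apply: ltnW; have := card_uniqP up; rewrite /= => <-; exact: max_card.
elim: p i x hs hp {up hi p0} => [|z p IH] [|i] x //= hs; first by move=> _; left.
move=> /andP[xz hp]; right; exists (rank z); first exact: rank_lt.
by split; [exists x, z | exact: IH].
Qed.

End GraphOnRanks.

Section Correct.
Variables (k : nat -> nat) (j n0 : nat).
Hypothesis n0_ge : sqmin <= n0.
Hypothesis params : forall n, n0 <= n ->
  let N := n ^ (2 ^ j) in let Y := mu N (fun y => valid_base N y) in
  [/\ exists2 y, y < N & valid_base N y, Y <= n, 16 * n ^ 8 * Y ^ 3 <= N &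
      (k n + 2) * 2 + 1 <= ylog N Y].

Lemma goodM_sqn M : nn M = sz M -> n0 <= sz M -> goodM (sqn j M).
Proof.
move=> h1 h2; have [p1 p2 p3 _] := params h2.
by split; rewrite ?nn_sqn ?h1 /YM sz_sqn.
Qed.

Lemma reachability_program : DynFO_arith reachability k.
Proof.
have [P [A0 hP]] := program_exists d_next_aux d_next_answer next_aux_ext n0_ge goodM_sqn.
exists P => d V cs cs0 hcs; have [hP0 hPS hPA] := hP d V.
case/lastP: cs cs0 hcs => // cs c _; rewrite all_rcons => /andP[hc hcs].
have runE cs' c' : run P (rcons cs' c') = step (run P cs') c' by rewrite /run foldl_rcons.
rewrite runE; set S := run P cs.
suff main (u v : V) : ((u, v) \in answer_set (step S c).2) <->
    connect [rel x y | (x, y) \in (step S c).1] u v.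
  by apply/setP => -[u v]; rewrite [RHS]inE; apply/idP/idP => /main.
rewrite hPA; case: leqP => hn; last exact: (reach_upto_connect _ _ _ _ (ltnW hn)).
set M := big_model _ _; have [p1 p2 p3 p4] := params hn.
have edE E' A' (x y : V) : ed (big_model E' (A' : aux_state (two_ar (5 * 2 ^ j)) V)) (rank x) (rank y) <-> (x, y) \in E'.
  rewrite /big_model ed_sqn /=; last first.
  - by move=> a b [x' [y' [<- <- _]]]; split; exact: rank_lt.
  - exact: leq_ltn_trans (rank_lt x).
  split; first by move=> [x' [y' [/rank_inj -> /rank_inj ->]]].
  by move=> h; exists x, y.
have nnE E' A' : nn (big_model E' (A' : aux_state (two_ar (5 * 2 ^ j)) V)) = #|V| by rewrite nn_sqn.
have szE E' A' : sz (big_model E' (A' : aux_state (two_ar (5 * 2 ^ j)) V)) = #|V| ^ (2 ^ j) by rewrite sz_sqn.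
have good E' A' : goodM (big_model E' (A' : aux_state (two_ar (5 * 2 ^ j)) V)) by apply: goodM_sqn.
have TME E' A' : (k #|V| + 2) * 2 + 1 <= TM (big_model E' (A' : aux_state (two_ar (5 * 2 ^ j)) V)).
  by rewrite /TM /YM szE.
have chg (S' : {set V * V} * aux_state (@aux_ar P) V) c' :
    #|affected c'| <= k #|V| -> let M' := big_model (step S' c').1 (A0 d V S'.2) in
    (forall x y : V, Eold M' (rank x) (rank y) <-> (x, y) \in S'.1) ->
    size [seq u <- iota 0 (nn M') | `[< changed M' (Eold M') (ed M') u >]] <= k #|V|.
  move=> hc1 M' hE; apply: leq_trans hc1; rewrite cardE -(size_map (@rank d V)).
  apply: uniq_leq_size; first by rewrite filter_uniq // iota_uniq.
  have nM : nn M' = #|V| by exact: nnE.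
  move=> a; rewrite mem_filter => /andP[/asboolP[]].
  rewrite nM => /rank_onto[x <-] [b _ [/rank_onto[y <-]]].
  have dif x' y' : ((x', y') \in S'.1) != ((x', y') \in (step S' c').1) -> (x', y') \in ins c' :|: del c'.
    by rewrite /= /apply_change !inE; case: (_ \in S'.1); case: (_ \in ins _); case: (_ \in del _).
  rewrite !hE !edE => h _; apply: map_f; rewrite mem_enum inE; apply/orP.
  have [e1|e1] := boolP (((x, y) \in S'.1) == ((x, y) \in (step S' c').1)); last first.
    by left; apply/imsetP; exists (x, y) => //; exact: dif.
  have [e2|e2] := boolP (((y, x) \in S'.1) == ((y, x) \in (step S' c').1)); last first.
    by right; apply/imsetP; exists (y, x) => //; exact: dif.
  by move: h; rewrite -(eqP e1) -(eqP e2); case: (_ \in _); case: (_ \in _); intuition.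
(* Quantified over E' because the stored relations are read next to a graph that has already been
   changed. *)
have inv : forall E', let M' := big_model E' (A0 d V S.2) in
    Inv M' /\ forall x y : V, Eold M' (rank x) (rank y) <-> (x, y) \in S.1.
  rewrite /S {M S}; elim/last_ind: cs hcs => [|cs c' IH] hcs E'.
    split; first by apply: Inv_init => // xs; exact: hP0.
    by move=> x y; rewrite inE /Eold; split=> // h; case: (hP0 _ _ hn h).
  move: hcs; rewrite all_rcons => /andP[hc' /IH {}IH]; rewrite runE.
  set S := run P cs; have [I1 I2] := IH (step S c').1.
  have [J1 J2] := Inv_step (M' := big_model E' (A0 d V (step S c').2)) (good _ _)
    ltac:(by rewrite !szE) ltac:(by rewrite !nnE) (chg _ _ hc' I2) (TME _ _) I1
    (fun xs h5 h => hPS S c' E' xs hn h5 ltac:(by rewrite szE in h)).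
  split=> // x y; rewrite J2 ?nnE ?rank_lt //; exact: edE.
have [I1 I2] := inv (step S c).1.
have lt (x : V) : rank x < nn M by rewrite /M nnE rank_lt.
have := next_answer_ok (good _ _) (chg S c hc I2) (TME _ _) I1 (Ordinal (lt u)) (Ordinal (lt v)).
by move=> ->; apply: connect_rank; rewrite ?nnE //; exact: edE.
Qed.

End Correct.

(** * The growth condition *)

From mathcomp Require Import reals topology normedtype landau sequences exp.
From mathcomp Require Import lra.

Import numFieldNormedType.Exports.
Local Open Scope ring_scope.
Local Open Scope classical_set_scope.

(** In [bigO_lg] this bounds ln (ln 2) from below by - ln 2. *)
Lemma ln2_ge (R : realType) : 2^-1 <= ln (2 : R).
Proof.
have h : ln (1 + (- 2^-1) : R) <= - 2^-1 by apply: le_ln1Dx; lra.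
have e : 1 + (- 2^-1) = 2^-1 :> R by lra.
by move: h; rewrite e lnV ?posrE // lerN2.
Qed.

Lemma ln_lg_bounds (R : realType) n : (0 < n)%N ->
  (lg n)%:R * ln (2 : R) <= ln (n%:R : R) /\ ln (n%:R : R) <= (lg n).+1%:R * ln (2 : R).
Proof.
move=> n0; have h1 : (2 ^ lg n <= n)%N by apply: trunc_logP.
have h2 : (n <= 2 ^ (lg n).+1)%N by apply: ltnW; apply: trunc_log_ltn.
have p2 : (0 : R) < 2 by lra.
by split; rewrite mulr_natl -lnXn // ler_ln ?posrE ?exprn_gt0 ?ltr0n // -natrX ler_nat.
Qed.

Lemma bigO_lg (R : realType) (k : nat -> nat) :
  (fun n : nat => (k n)%:R : R) =O_\oo (fun n : nat => ln (n%:R : R) / ln (ln (n%:R : R))) ->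
  exists C n1, forall n, (n1 <= n)%N -> (2 <= lg (lg n))%N -> (k n * lg (lg n) <= C * lg n)%N.
Proof.
move=> /eqO_exP[c c0 [n1 _ hn1]].
(* The factor 4 is 2 * 2: one 2 from m ln 2 <= 2 ln (ln n), which uses m >= 2, the other from ln n
   <= 2 v ln 2, where v = [lg n] and m = [lg v]. *)
have [C hC] : exists C : nat, 4 * c <= C%:R.
  exists (Num.bound (4 * c)); apply: ltW; apply: archi_boundP.
  by rewrite mulr_ge0 // ltW.
exists C, n1 => n hn hm; have := hn1 n hn; rewrite normr_nat.
set v := lg n in hm *; set m := lg v in hm *.
have v0 : (0 < v)%N by rewrite lt0n; apply/eqP => e; move: hm; rewrite /m e /lg trunc_log0.
have n0 : (0 < n)%N by rewrite lt0n; apply/eqP => e; move: v0; rewrite /v e /lg trunc_log0.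
have [a1 a2] := ln_lg_bounds R n0; have [b1 b2] := ln_lg_bounds R v0.
rewrite -/v in a1 a2; rewrite -/m in b1 b2.
have l2 := ln2_ge R; set L := ln (n%:R : R) in a1 a2 *; set l := ln (2 : R) in l2 a1 a2 b1 b2.
have v0R : (0 : R) < v%:R by rewrite ltr0n.
have l0 : 0 < l by lra.
have vl : 0 < v%:R * l by rewrite mulr_gt0.
have L0 : 0 < L by apply: lt_le_trans a1.
have lnL : m%:R * l - l <= ln L.
  apply: (@le_trans _ _ (ln (v%:R * l))); last by rewrite ler_ln ?posrE.
  rewrite lnM ?posrE // -/l; apply: lerD => //.
  apply: (@le_trans _ _ (ln (2^-1))); first by rewrite lnV ?posrE.
  by rewrite ler_ln ?posrE // invr_gt0.
have m2 : (2 : R) <= m%:R by rewrite ler_nat.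
have lnL2 : m%:R * l <= 2 * ln L by nra.
have lnL0 : 0 < ln L by have : 0 < m%:R * l by [apply: mulr_gt0; lra]; lra.
have nE : `|L / ln L| = L / ln L by rewrite ger0_norm // ltW // divr_gt0.
rewrite nE mulrA ler_pdivlMr // => h.
have kR : (0 : R) <= (k n)%:R by rewrite ler0n.
have v1 : (1 : R) <= v%:R by rewrite ler1n.
rewrite -(ler_nat R) !natrM.
have h1 : (k n)%:R * (m%:R * l) <= 2 * (c * L).
  apply: (@le_trans _ _ ((k n)%:R * (2 * ln L))); first by rewrite ler_wpM2l.
  by lra.
have h2 : L <= 2 * v%:R * l by rewrite -natr1 in a2; nra.
have h3 : c * L <= c * (2 * v%:R * l) by rewrite ler_pM2l.
have h4 : 4 * c * v%:R <= C%:R * v%:R by rewrite ler_pM2r.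
rewrite -(ler_pM2r l0); apply: (@le_trans _ _ (4 * c * v%:R * l)); first by lra.
by rewrite ler_pM2r.
Qed.

Theorem theorem1 (R : realType) (k : nat -> nat)
    (hk : (fun n : nat => (k n)%:R : R) =O_\oo
          (fun n : nat => ln (n%:R : R) / ln (ln (n%:R : R)))) :
  DynFO_arith reachability k.
Proof.
have [C [n1 hC]] := bigO_lg hk; have [j [m0 hj]] := params_exist C.
(* The double exponential forces [m <= lg (lg n)] for n >= [n0]; smaller domains are left to
   [reach_upto]. *)
pose m := maxn m0 2; pose n0 := maxn (maxn (2 ^ (2 ^ m)) n1) sqmin.
apply: (@reachability_program k j n0); first exact: leq_maxr.
move=> n; rewrite !geq_max => /andP[/andP[hn hn1] _].
have hlg : (m <= lg (lg n))%N by do 2!apply: trunc_log_max => //.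
move: hlg; rewrite geq_max => /andP[h1 h2].
by apply: hj => //; apply: hC.
Qed.
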